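(* Let $K$ be a number field with ring of integers $\mathcal{O}_K$, and let $\mathcal{R}_K$ be a unique factorization domain with $\mathcal{O}_K\subset\mathcal{R}_K\subset K$ whose group of units is finitely generated. Let $e_1,e_2,e_3\in\mathcal{R}_K[t]$ and let $E=E(t): y^2=(x-e_1)(x-e_2)(x-e_3)$ be a nonconstant elliptic curve over $K(t)$. Let $t_0\in K$ be such that the specialization $E(t_0)$ is an elliptic curve over $K$. Assume that for every nonconstant square-free divisor $h$ in $\mathcal{R}_K[t]$ of $(e_1-e_2)(e_1-e_3)$, or of $(e_2-e_1)(e_2-e_3)$, or of $(e_3-e_1)(e_3-e_2)$, the algebraic number $h(t_0)$ is not a square in $K$. Then the specialization homomorphism $\sigma: E(K(t))\to E(t_0)(K)$ is injective.
   Context: An elliptic curve over $K(t)$ is nonconstant if it is not isomorphic over $K(t)$ to an elliptic curve defined over $K$. The specialization homomorphism $\sigma=\sigma_{t_0}$ sends a point of $E(K(t))$ to the point of $E(t_0)(K)$ obtained by evaluating its projective coordinates at $t=t_0$. Divisibility and square-freeness are taken in the UFD $\mathcal{R}_K[t]$. *)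

(* Defs.v *)
From HB Require Import structures.
From mathcomp Require Import all_boot all_order all_algebra all_field fraction.
Set Implicit Arguments. Unset Strict Implicit. Unset Printing Implicit Defensive.
Import Order.TTheory GRing.Theory Num.Theory.
Local Open Scope ring_scope.

(* A number field is modelled as K : fieldExtType rat (a field that is a
   finite-dimensional Q-algebra). *)

Section RingOfIntegers.
Variable K : fieldExtType rat.

Definition integralZ (x : K) : Prop :=
  exists p : {poly int}, p \is monic /\ root (map_poly intr p) x.

End RingOfIntegers.

Section SubringArith.
Variables (K : fieldType) (S : {pred K}).

Definition subring_of (S' : {pred K}) : Prop :=
  1 \in S' /\ forall x y, x \in S' -> y \in S' -> (x - y \in S') /\ (x * y \in S').

Definition unitS (x : K) : Prop := x \in S /\ exists y, y \in S /\ x * y = 1.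

Definition irredS (x : K) : Prop :=
  [/\ x \in S, x != 0, ~ unitS x &
      forall a b, a \in S -> b \in S -> x = a * b -> unitS a \/ unitS b].

Definition assocS (a b : K) : Prop := exists u, unitS u /\ a = u * b.

Definition UFD : Prop :=
  (forall x, x \in S -> x != 0 -> ~ unitS x ->
     exists r : seq K, (forall a, a \in r -> irredS a) /\ x = \prod_(a <- r) a)
  /\
  (forall r1 r2 : seq K, (forall a, a \in r1 -> irredS a) ->
     (forall a, a \in r2 -> irredS a) ->
     \prod_(a <- r1) a = \prod_(a <- r2) a ->
     exists r2', [/\ perm_eq r2 r2', size r1 = size r2' &
        forall i, (i < size r1)%N -> assocS (nth 0 r1 i) (nth 0 r2' i)]).

Definition units_fin_gen : Prop :=
  exists gens : seq K, (forall g, g \in gens -> unitS g) /\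
    forall u, unitS u -> exists ks : seq int,
      size ks = size gens /\ u = \prod_(i < size gens) (gens`_i ^ ks`_i).

Definition polyS (p : {poly K}) : Prop := forall i, p`_i \in S.

Definition dvdS (h g : {poly K}) : Prop := exists q, polyS q /\ g = h * q.

Definition unitSt (g : {poly K}) : Prop :=
  polyS g /\ exists q, polyS q /\ g * q = 1.

Definition squarefreeS (h : {poly K}) : Prop :=
  polyS h /\ forall g, polyS g -> dvdS (g * g) h -> unitSt g.

End SubringArith.

Section Curves.
Variable F : fieldType.

(* isomorphism of Weierstrass equations W = 0 and W' = 0 over F via the
   admissible change x = u^2 X + r, y = u^3 Y + s u^2 X + w *)
Definition iso_weq (W W' : F -> F -> F) : Prop :=
  exists u r s w : F, u != 0 /\
    forall X Y, W (u^+2 * X + r) (u^+3 * Y + s * u^+2 * X + w) = u^+6 * W' X Y.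

Definition weier (a1 a2 a3 a4 a6 : F) (x y : F) : F :=
  y^+2 + a1 * x * y + a3 * y - (x^+3 + a2 * x^+2 + a4 * x + a6).

Definition wdisc (a1 a2 a3 a4 a6 : F) : F :=
  let b2 := a1^+2 + 4 * a2 in
  let b4 := 2 * a4 + a1 * a3 in
  let b6 := a3^+2 + 4 * a6 in
  let b8 := a1^+2 * a6 + 4 * a2 * a6 - a1 * a3 * a4 + a2 * a3^+2 - a4^+2 in
  - b2^+2 * b8 - 8 * b4^+3 - 27 * b6^+2 + 9 * b2 * b4 * b6.

Definition leg (c1 c2 c3 : F) (x y : F) : F :=
  y^+2 - (x - c1) * (x - c2) * (x - c3).

(* points: None is the point at infinity O, Some (x,y) an affine point *)
Definition on_leg (c1 c2 c3 : F) (P : option (F * F)) : Prop :=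
  match P with None => True | Some (x, y) => leg c1 c2 c3 x y = 0 end.

End Curves.

Section RatFun.
Variable K : fieldType.

Notation KT := {fraction {poly K}}.

Definition cstF (c : K) : KT := @FracField.tofrac _ (c%:P).
Definition polF (p : {poly K}) : KT := @FracField.tofrac _ p.

Definition fnum (f : KT) : {poly K} :=
  \n_(repr f) %/ gcdp \n_(repr f) \d_(repr f).
Definition fden (f : KT) : {poly K} :=
  \d_(repr f) %/ gcdp \n_(repr f) \d_(repr f).

Definition regular_at (t0 : K) (f : KT) : bool := (fden f).[t0] != 0.
Definition fval (t0 : K) (f : KT) : K := (fnum f).[t0] / (fden f).[t0].

(* specialization at t0 of a point of y^2 = (x-e1)(x-e2)(x-e3) over K(t):
   evaluation of the projective coordinates (x : y : 1).  For a point on the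
   curve, x is regular at t0 iff y is; if not, the image is O = (0:1:0). *)
Definition specialize (t0 : K) (P : option (KT * KT)) : option (K * K) :=
  match P with
  | None => None
  | Some (x, y) =>
      if regular_at t0 x && regular_at t0 y then Some (fval t0 x, fval t0 y)
      else None
  end.

Definition nonconstant_leg (e1 e2 e3 : {poly K}) : Prop :=
  ~ exists a1 a2 a3 a4 a6 : K, wdisc a1 a2 a3 a4 a6 != 0 /\
      iso_weq (leg (polF e1) (polF e2) (polF e3))
              (weier (cstF a1) (cstF a2) (cstF a3) (cstF a4) (cstF a6)).

End RatFun.

(* Main.v *)
(** Let [sigma] be the specialization at [t0].  If two distinct points had the
    same image, their difference would be a nonzero point whose abscissa has a
    pole at [t0]; so it is enough to show that there is no such point [P].

    2-descent: [x(P) - e1 = d * z^2] with [d] square-free in [R_K[t]] dividing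
    [(e1 - e2)(e1 - e3)], and looking at leading terms at [t0] shows that
    [d(t0)] is a square.  By hypothesis [d] is then a constant square, so every
    [x(P) - e_i] is a square [r_i^2] and [P = 2 P'].  With the signs of the
    [r_i] chosen to agree at [t0], [P'] again has a pole at [t0], hence there is
    a sequence [P_0 = P], [P_n = 2 P_{n+1}], and the leading coefficients of the
    [r_i(P_n)] double at each step.

    A triple [(r1, r2, r3)] with [r_i^2 = x - e_i] has a degree, that of
    [t |-> (r1 : r2 : r3)].  Doubling is a quartic map of the projective plane,
    and it multiplies the degree by 4 as long as, at each place of [K(t)], at
    least two of the [r_i] have maximal absolute value (the point lies on the
    identity component).  Only finitely many places and finitely many components
    can violate this, so by the pigeonhole principle there are arbitrarily large
    [n] and bounded [k > 0] for which [P_n - P_{n+k}] lies on the identity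
    component everywhere.  Then [P_0 - P_k] has degree at least [4^n], which is
    absurd since [k] is bounded. *)

From Stdlib Require Import Classical IndefiniteDescription.
Require Import Defs.
From HB Require Import structures.
From mathcomp Require Import all_boot all_order all_algebra all_field fraction.
From mathcomp Require Import generic_quotient ring zify.
Set Implicit Arguments. Unset Strict Implicit. Unset Printing Implicit Defensive.
Import Order.TTheory GRing.Theory Num.Theory.
Local Open Scope ring_scope.

(** * Doubling and subtraction on triples [r_i^2 = x - e_i] *)

(** The degree of [P_n] itself is out of control: the coordinates of the quartic map acquire a
    common factor wherever a single coordinate of the triple dominates. Differences are used because
    two points on the same component differ by a point of the identity component. That component is
    a subgroup, so if [P_N - P_{N+k}] lies on it, so do its multiples [P_n - P_{n+k}] for [n <= N]:
    one good pair yields [N] consecutive multiplications of the degree by 4. The gap [k] is bounded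
    by the number of colours, hence the degree of [P_0 - P_k] is bounded before [N] is chosen. The
    evaluation at [t0] also supplies every nonvanishing condition. The leading coefficients are
    [2 ^ n * l], distinct up to sign in characteristic 0, so the coordinates of a difference share
    one explicit nonzero value at [t0]. This excludes zero coordinates, and also triples
    proportional to constants, so that the growth starts from degree at least 1. *)

Section Triples.
Variable F : fieldType.
Implicit Types a b c : F.

(* If [q_i^2 = x(Q) - e_i], then [dbl q1 q2 q3] is [r1] for the point [2 Q]; the
   other coordinates are obtained by permuting the arguments.  Likewise [dif]
   gives the first coordinate of the difference of two points. *)
Definition dbl a b c : F := (a * b / c + a * c / b - b * c / a) / 2.
Definition dif a b c a' b' c' : F := (a * b' * c' + a' * b * c) / (a' ^+ 2 - a ^+ 2).

Hypothesis two_neq0 : (2 : F) != 0.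

(* Two triples over the same curve satisfy [(q_i - p_i)(q_i + p_i) = w] for all
   [i]; the [a_i = q_i - p_i] and [w] are free parameters, which turns the
   compatibility of [dif] with [dbl] into an identity of rational functions. *)
Lemma dif_dbl_core (a1 a2 a3 w : F) (q1 q2 q3 p1 p2 p3 : F) :
  a1 != 0 -> a2 != 0 -> a3 != 0 -> w != 0 ->
  q1 = (w / a1 + a1) / 2 -> q2 = (w / a2 + a2) / 2 -> q3 = (w / a3 + a3) / 2 ->
  p1 = (w / a1 - a1) / 2 -> p2 = (w / a2 - a2) / 2 -> p3 = (w / a3 - a3) / 2 ->
  q1 != 0 -> q2 != 0 -> q3 != 0 -> p1 != 0 -> p2 != 0 -> p3 != 0 ->
  let d1 := dbl q1 q2 q3 in let d2 := dbl q2 q1 q3 in let d3 := dbl q3 q1 q2 in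
  let f1 := dbl p1 p2 p3 in let f2 := dbl p2 p1 p3 in let f3 := dbl p3 p1 p2 in
  dif q3 q1 q2 p3 p1 p2 * (d1 * f2 * f3 + f1 * d2 * d3 + d2 * f1 * f3 + f2 * d1 * d3)
  = dif q1 q2 q3 p1 p2 p3 * dif q2 q1 q3 p2 p1 p3 * (f1 ^+ 2 - d1 ^+ 2).
Proof.
move=> ha1 ha2 ha3 hw e1 e2 e3 g1 g2 g3.
have n1 : (w + a1 ^+ 2 != 0) = (q1 != 0).
  rewrite e1; have -> : w / a1 + a1 = (w + a1^+2) / a1 by field.
  by rewrite !mulf_eq0 !invr_eq0 (negbTE ha1) (negbTE two_neq0) !orbF.
have n2 : (w + a2 ^+ 2 != 0) = (q2 != 0).
  rewrite e2; have -> : w / a2 + a2 = (w + a2^+2) / a2 by field.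
  by rewrite !mulf_eq0 !invr_eq0 (negbTE ha2) (negbTE two_neq0) !orbF.
have n3 : (w + a3 ^+ 2 != 0) = (q3 != 0).
  rewrite e3; have -> : w / a3 + a3 = (w + a3^+2) / a3 by field.
  by rewrite !mulf_eq0 !invr_eq0 (negbTE ha3) (negbTE two_neq0) !orbF.
have m1 : (w - a1 ^+ 2 != 0) = (p1 != 0).
  rewrite g1; have -> : w / a1 - a1 = (w - a1^+2) / a1 by field.
  by rewrite !mulf_eq0 !invr_eq0 (negbTE ha1) (negbTE two_neq0) !orbF.
have m2 : (w - a2 ^+ 2 != 0) = (p2 != 0).
  rewrite g2; have -> : w / a2 - a2 = (w - a2^+2) / a2 by field.
  by rewrite !mulf_eq0 !invr_eq0 (negbTE ha2) (negbTE two_neq0) !orbF.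
have m3 : (w - a3 ^+ 2 != 0) = (p3 != 0).
  rewrite g3; have -> : w / a3 - a3 = (w - a3^+2) / a3 by field.
  by rewrite !mulf_eq0 !invr_eq0 (negbTE ha3) (negbTE two_neq0) !orbF.
rewrite -n1 -n2 -n3 -m1 -m2 -m3 => {n1 n2 n3 m1 m2 m3} n1 n2 n3 m1 m2 m3.
rewrite /dif.
have -> : p1 ^+ 2 - q1 ^+ 2 = - w by rewrite e1 g1; field; rewrite ?two_neq0 ?ha1.
have -> : p2 ^+ 2 - q2 ^+ 2 = - w by rewrite e2 g2; field; rewrite ?two_neq0 ?ha2.
have -> : p3 ^+ 2 - q3 ^+ 2 = - w by rewrite e3 g3; field; rewrite ?two_neq0 ?ha3.
rewrite e1 e2 e3 g1 g2 g3 /dbl; field.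
rewrite !mulNr -!expr2 oppr_eq0.
by rewrite two_neq0 ha1 ha2 ha3 hw n1 n2 n3 m1 m2 m3.
Qed.

Lemma dblC a b c : dbl a b c = dbl a c b.
Proof. by rewrite /dbl [c * b]mulrC [a * b / c + _]addrC. Qed.

Lemma difC a b c a' b' c' : dif a b c a' b' c' = dif a c b a' c' b'.
Proof. by rewrite /dif -[a * c' * b']mulrA -[a' * c * b]mulrA [c' * b']mulrC [c * b]mulrC !mulrA. Qed.

Lemma dbl_sum a b c : a != 0 -> b != 0 -> c != 0 ->
  dbl a b c + dbl b a c = a * b / c.
Proof. by move=> ha hb hc; rewrite /dbl; field; rewrite ?two_neq0 ?ha ?hb ?hc. Qed.

Lemma dbl_diff a b c : a != 0 -> b != 0 -> c != 0 ->
  dbl a b c - dbl b a c = c * (a ^+ 2 - b ^+ 2) / (a * b).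
Proof. by move=> ha hb hc; rewrite /dbl; field; rewrite ?two_neq0 ?ha ?hb ?hc. Qed.

(** Since 2 is invertible, the pairwise sums determine the triple, and for a double these sums are
    monomials. Identities about [dbl] are therefore checked on sums. *)
Lemma dbl_unique (d1 d2 d3 a b c : F) :
  d1 + d2 = a * b / c -> d1 + d3 = a * c / b -> d2 + d3 = b * c / a ->
  d1 = dbl a b c.
Proof.
by move=> h12 h13 h23; rewrite /dbl -h12 -h13 -h23; field.
Qed.

Section Pair.
Variables (q1 q2 q3 p1 p2 p3 : F).
Hypotheses (h12 : q1 ^+ 2 - p1 ^+ 2 = q2 ^+ 2 - p2 ^+ 2)
           (h13 : q1 ^+ 2 - p1 ^+ 2 = q3 ^+ 2 - p3 ^+ 2)
           (w0 : p1 ^+ 2 - q1 ^+ 2 != 0).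

Let w := q1 ^+ 2 - p1 ^+ 2.

Let w_neq0 : w != 0.
Proof. by rewrite /w -opprB oppr_eq0. Qed.

Lemma half_sum_diff (q p : F) : w = q ^+ 2 - p ^+ 2 ->
  [/\ q - p != 0, q = (w / (q - p) + (q - p)) / 2 & p = (w / (q - p) - (q - p)) / 2].
Proof.
move=> e; have h : q - p != 0.
  by apply: contra_neq w_neq0 => h; rewrite e subr_sqr h mul0r.
by split=> //; rewrite e; field; rewrite ?two_neq0 ?h.
Qed.

Lemma dif_sq_diff :
  dif q1 q2 q3 p1 p2 p3 ^+ 2 - dif q2 q1 q3 p2 p1 p3 ^+ 2 = q1 ^+ 2 - q2 ^+ 2.
Proof.
have [a1 E1 E1'] := half_sum_diff erefl.
have [a2 E2 E2'] := half_sum_diff h12.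
have [a3 E3 E3'] := half_sum_diff h13.
rewrite /dif; have -> : p1 ^+ 2 - q1 ^+ 2 = - w by rewrite /w opprB.
have -> : p2 ^+ 2 - q2 ^+ 2 = - w by rewrite /w h12 opprB.
move: a1 E1 E1' a2 E2 E2' a3 E3 E3' w_neq0; move: w => W.
move: (q1 - p1) (q2 - p2) (q3 - p3) => a1 a2 a3 n1 -> -> n2 -> -> n3 -> -> nW.
by field; rewrite ?oppr_eq0 ?two_neq0 ?n1 ?n2 ?n3 ?nW.
Qed.

Hypotheses (q10 : q1 != 0) (q20 : q2 != 0) (q30 : q3 != 0)
           (p10 : p1 != 0) (p20 : p2 != 0) (p30 : p3 != 0).

Lemma dif_dbl_mul :
  dif q3 q1 q2 p3 p1 p2 *
    (dbl q1 q2 q3 * dbl p2 p1 p3 * dbl p3 p1 p2 + dbl p1 p2 p3 * dbl q2 q1 q3 * dbl q3 q1 q2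
    + dbl q2 q1 q3 * dbl p1 p2 p3 * dbl p3 p1 p2 + dbl p2 p1 p3 * dbl q1 q2 q3 * dbl q3 q1 q2)
  = dif q1 q2 q3 p1 p2 p3 * dif q2 q1 q3 p2 p1 p3
    * (dbl p1 p2 p3 ^+ 2 - dbl q1 q2 q3 ^+ 2).
Proof.
have [a1 E1 E1'] := half_sum_diff erefl.
have [a2 E2 E2'] := half_sum_diff h12.
have [a3 E3 E3'] := half_sum_diff h13.
exact: (dif_dbl_core a1 a2 a3 w_neq0 E1 E2 E3 E1' E2' E3' q10 q20 q30 p10 p20 p30).
Qed.

End Pair.

Lemma dbl_sq_diff a b c : a != 0 -> b != 0 -> c != 0 ->
  dbl a b c ^+ 2 - dbl b a c ^+ 2 = a ^+ 2 - b ^+ 2.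
Proof.
move=> ha hb hc; rewrite subr_sqr dbl_sum // dbl_diff //.
by field; rewrite ha hb hc.
Qed.

Lemma dif_dbl_sum (q1 q2 q3 p1 p2 p3 : F) :
  q1 ^+ 2 - p1 ^+ 2 = q2 ^+ 2 - p2 ^+ 2 ->
  q1 ^+ 2 - p1 ^+ 2 = q3 ^+ 2 - p3 ^+ 2 ->
  p1 ^+ 2 - q1 ^+ 2 != 0 ->
  q1 != 0 -> q2 != 0 -> q3 != 0 -> p1 != 0 -> p2 != 0 -> p3 != 0 ->
  dif q3 q1 q2 p3 p1 p2 != 0 ->
  dbl p1 p2 p3 ^+ 2 - dbl q1 q2 q3 ^+ 2 != 0 ->
  dif (dbl q1 q2 q3) (dbl q2 q1 q3) (dbl q3 q1 q2)
      (dbl p1 p2 p3) (dbl p2 p1 p3) (dbl p3 p1 p2) +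
  dif (dbl q2 q1 q3) (dbl q1 q2 q3) (dbl q3 q1 q2)
      (dbl p2 p1 p3) (dbl p1 p2 p3) (dbl p3 p1 p2) =
  dif q1 q2 q3 p1 p2 p3 * dif q2 q1 q3 p2 p1 p3 / dif q3 q1 q2 p3 p1 p2.
Proof.
move=> h12 h13 w0 q10 q20 q30 p10 p20 p30 s0 W0.
have := dif_dbl_mul h12 h13 w0 q10 q20 q30 p10 p20 p30.
(* Doubling preserves the differences of the squares of the coordinates, so both [dif] on the left
   have the same denominator. *)
have E : dbl p2 p1 p3 ^+ 2 - dbl q2 q1 q3 ^+ 2 = dbl p1 p2 p3 ^+ 2 - dbl q1 q2 q3 ^+ 2.
  have A := dbl_sq_diff p10 p20 p30; have B := dbl_sq_diff q10 q20 q30.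
  apply/eqP; rewrite -subr_eq0; apply/eqP.
  transitivity ((dbl q1 q2 q3 ^+ 2 - dbl q2 q1 q3 ^+ 2) - (dbl p1 p2 p3 ^+ 2 - dbl p2 p1 p3 ^+ 2)).
    by ring.
  rewrite A B; transitivity ((q1 ^+ 2 - p1 ^+ 2) - (q2 ^+ 2 - p2 ^+ 2)); first by ring.
  by rewrite h12 subrr.
move=> M; rewrite {1 2}/dif E -mulrDl.
apply: (mulIf s0); rewrite divfK //.
apply: (mulIf W0); rewrite -M mulrAC divfK // mulrC.
by congr (_ * _); rewrite -!addrA.
Qed.

Lemma dif_dbl (q1 q2 q3 p1 p2 p3 : F) :
  q1 ^+ 2 - p1 ^+ 2 = q2 ^+ 2 - p2 ^+ 2 ->
  q1 ^+ 2 - p1 ^+ 2 = q3 ^+ 2 - p3 ^+ 2 ->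
  p1 ^+ 2 - q1 ^+ 2 != 0 ->
  q1 != 0 -> q2 != 0 -> q3 != 0 -> p1 != 0 -> p2 != 0 -> p3 != 0 ->
  dif q1 q2 q3 p1 p2 p3 != 0 -> dif q2 q1 q3 p2 p1 p3 != 0 ->
  dif q3 q1 q2 p3 p1 p2 != 0 ->
  dbl p1 p2 p3 ^+ 2 - dbl q1 q2 q3 ^+ 2 != 0 ->
  dif (dbl q1 q2 q3) (dbl q2 q1 q3) (dbl q3 q1 q2)
      (dbl p1 p2 p3) (dbl p2 p1 p3) (dbl p3 p1 p2) =
  dbl (dif q1 q2 q3 p1 p2 p3) (dif q2 q1 q3 p2 p1 p3) (dif q3 q1 q2 p3 p1 p2).
Proof.
move=> h12 h13 w0 q10 q20 q30 p10 p20 p30 s1 s2 s3 W0.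
have h23 : q2 ^+ 2 - p2 ^+ 2 = q3 ^+ 2 - p3 ^+ 2 by rewrite -h12.
have w2 : p2 ^+ 2 - q2 ^+ 2 != 0 by rewrite -opprB -h12 opprB.
have w3 : p3 ^+ 2 - q3 ^+ 2 != 0 by rewrite -opprB -h13 opprB.
have W2 : dbl p2 p1 p3 ^+ 2 - dbl q2 q1 q3 ^+ 2 != 0.
  have A := dbl_sq_diff p10 p20 p30; have B := dbl_sq_diff q10 q20 q30.
  have -> : dbl p2 p1 p3 ^+ 2 - dbl q2 q1 q3 ^+ 2 = dbl p1 p2 p3 ^+ 2 - dbl q1 q2 q3 ^+ 2
     - (p1 ^+ 2 - p2 ^+ 2) + (q1 ^+ 2 - q2 ^+ 2) by rewrite -A -B; ring.
  have -> : q1 ^+ 2 = q2 ^+ 2 - p2 ^+ 2 + p1 ^+ 2 by rewrite -h12 subrK.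
  by rewrite [X in X != 0](_ : _ = dbl p1 p2 p3 ^+ 2 - dbl q1 q2 q3 ^+ 2) //; ring.
apply: (@dbl_unique _ (dif (dbl q2 q1 q3) (dbl q1 q2 q3) (dbl q3 q1 q2)
      (dbl p2 p1 p3) (dbl p1 p2 p3) (dbl p3 p1 p2))
  (dif (dbl q3 q1 q2) (dbl q1 q2 q3) (dbl q2 q1 q3)
      (dbl p3 p1 p2) (dbl p1 p2 p3) (dbl p2 p1 p3))).
- exact: dif_dbl_sum.
- have := @dif_dbl_sum q1 q3 q2 p1 p3 p2 h13 h12 w0 q10 q30 q20 p10 p30 p20 s2.
  rewrite [dbl q1 q3 q2]dblC [dbl p1 p3 p2]dblC => /(_ W0).
  by rewrite [dif q1 q3 q2 _ _ _]difC [dif (dbl q1 q2 q3) _ _ _ _ _]difC.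
have := @dif_dbl_sum q2 q3 q1 p2 p3 p1 h23 (esym h12) w2 q20 q30 q10 p20 p30 p10 s1.
rewrite [dbl q3 q2 q1]dblC [dbl p3 p2 p1]dblC [dbl q2 q3 q1]dblC [dbl p2 p3 p1]dblC => /(_ W2).
rewrite [dif q3 q2 q1 _ _ _]difC [dif q2 q3 q1 _ _ _]difC.
by rewrite [dif (dbl q2 q1 q3) _ _ _ _ _]difC [dif (dbl q3 q1 q2) _ _ _ _ _]difC.
Qed.

(** The second factor is the numerator of [dif] for the sum of the two points, as negating a point
    negates its triple. In the product the denominator cancels. *)
Lemma dif_mul_conj a b c a' b' c' al be :
  b ^+ 2 = a ^+ 2 - al -> c ^+ 2 = a ^+ 2 - be ->
  b' ^+ 2 = a' ^+ 2 - al -> c' ^+ 2 = a' ^+ 2 - be ->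
  a' ^+ 2 - a ^+ 2 != 0 ->
  dif a b c a' b' c' * (a * b' * c' - a' * b * c) = a ^+ 2 * a' ^+ 2 - al * be.
Proof.
move=> hb hc hb' hc' w0; rewrite /dif.
transitivity ((a ^+ 2 * b' ^+ 2 * c' ^+ 2 - a' ^+ 2 * b ^+ 2 * c ^+ 2) / (a' ^+ 2 - a ^+ 2)).
  by field; rewrite w0.
by rewrite hb hc hb' hc'; field; rewrite w0.
Qed.

End Triples.

(** * Nonarchimedean absolute values *)

(** Values in the powers of 2 make every absolute value discrete, which is needed for parity of
    orders and for finite ranges of values. [av_add] says that balls are closed under addition. *)
Record absval (F : fieldType) := Absval {
  av :> F -> rat;
  av0 : av 0 = 0;
  av_pow2 : forall x, x != 0 -> exists k : int, av x = 2 ^ k;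
  avM : forall x y, av (x * y) = av x * av y;
  av_add : forall x y m, av x <= m -> av y <= m -> av (x + y) <= m }.

Lemma swap_ratio_sq (R : fieldType) (c a b : R) :
  c != 0 -> a != 0 -> b != 0 -> c * a / b = c * b / a -> a * a = b * b.
Proof.
move=> c0 a0 b0 h.
have -> : a * a = c * a / b * (a * b / c) by field; rewrite ?c0 ?b0.
by rewrite h; field; rewrite ?c0 ?a0.
Qed.

Section AbsTheory.
Variables (F : fieldType) (v : absval F).

Lemma av_gt0 x : x != 0 -> 0 < v x.
Proof. by move=> /(@av_pow2 _ v)[k ->]; exact: exprz_gt0. Qed.

Lemma av_ge0 x : 0 <= v x.
Proof. by have [->|/av_gt0/ltW//] := eqVneq x 0; rewrite av0. Qed.

Lemma av_eq0 x : (v x == 0) = (x == 0).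
Proof.
by apply/idP/eqP => [|->]; [apply: contraTeq => /av_gt0/gt_eqF-> | rewrite av0].
Qed.

Lemma av1 : v 1 = 1.
Proof.
have h : v 1 != 0 by rewrite av_eq0 oner_eq0.
by apply: (mulfI h); rewrite -avM !mulr1.
Qed.

Lemma avN1 : v (-1) = 1.
Proof.
have : v (-1) ^+ 2 == 1 by rewrite expr2 -avM mulrNN mulr1 av1.
rewrite sqrf_eq1 => /orP[/eqP//|/eqP h].
by have := av_ge0 (-1); rewrite h.
Qed.

Lemma avN x : v (- x) = v x.
Proof. by rewrite -mulN1r avM avN1 mul1r. Qed.

Lemma avV x : v x^-1 = (v x)^-1.
Proof.
have [->|h] := eqVneq x 0; first by rewrite invr0 av0 invr0.
have h' : v x != 0 by rewrite av_eq0.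
by apply: (mulfI h'); rewrite -avM !divff // av1.
Qed.

Lemma avX x n : v (x ^+ n) = v x ^+ n.
Proof. by elim: n => [|n IH]; rewrite ?expr0 ?av1 // !exprS avM IH. Qed.

Lemma avB x y m : v x <= m -> v y <= m -> v (x - y) <= m.
Proof. by move=> hx hy; apply: av_add => //; rewrite avN. Qed.

Lemma av_ltD x y m : v x < m -> v y < m -> v (x + y) < m.
Proof.
move=> hx hy; case: (leP (v x) (v y)) => h.
  by apply: le_lt_trans hy; apply: av_add.
by apply: le_lt_trans hx; apply: av_add => //; exact: ltW.
Qed.

Lemma av_ltB x y m : v x < m -> v y < m -> v (x - y) < m.
Proof. by move=> hx hy; apply: av_ltD => //; rewrite avN. Qed.

Lemma av_domD x y : v y < v x -> v (x + y) = v x.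
Proof.
move=> h; apply/eqP; rewrite eq_le; apply/andP; split.
  by apply: av_add => //; exact: ltW.
rewrite leNgt; apply/negP => h'.
have := av_ltB h' h; by rewrite addrK ltxx.
Qed.

Lemma av_domB x y : v y < v x -> v (x - y) = v x.
Proof. by move=> h; apply: av_domD; rewrite avN. Qed.

Lemma av_domBr x y : v y < v x -> v (y - x) = v x.
Proof. by move=> h; rewrite -opprB avN; exact: av_domB. Qed.

(* The point with coordinates [(a, b, c)] is not on the identity component. *)
Definition bad (a b c : F) := (v a < v c) && (v b < v c).

Let sqle (x y : rat) : 0 <= x -> 0 <= y -> (x ^+ 2 <= y ^+ 2) = (x <= y).
Proof. by move=> hx hy; rewrite ler_pXn2r. Qed.

Let sqlt (x y : rat) : 0 <= x -> 0 <= y -> (x ^+ 2 < y ^+ 2) = (x < y).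
Proof. by move=> hx hy; rewrite ltr_pXn2r. Qed.

Lemma bad_sqr a b c : bad a b c ->
  v (a ^+ 2 - b ^+ 2) < v (a ^+ 2 - c ^+ 2) /\ v (a ^+ 2 - c ^+ 2) = v c ^+ 2.
Proof.
case/andP=> h1 h2.
have h1' : v (a ^+ 2) < v (c ^+ 2) by rewrite !avX sqlt ?av_ge0.
have h2' : v (b ^+ 2) < v (c ^+ 2) by rewrite !avX sqlt ?av_ge0.
have e : v (a ^+ 2 - c ^+ 2) = v c ^+ 2 by rewrite av_domBr // avX.
by split => //; rewrite e -avX; exact: av_ltB.
Qed.

Hypothesis two0 : (2 : F) != 0.

(** If the third coordinate of the double dominates, its sums [c * a / b] and [c * b / a] with the
    others both have its absolute value, so [v a = v b]. The remaining sum [a * b / c] is smaller,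
    which gives [v a < v c]. *)
Lemma bad_dbl a b c : a != 0 -> b != 0 -> c != 0 ->
  bad (dbl a b c) (dbl b a c) (dbl c a b) -> bad a b c.
Proof.
move=> ha hb hc /andP[h1 h2].
have e12 := dbl_sum two0 ha hb hc.
have e13 : dbl c a b + dbl a b c = c * a / b by rewrite [dbl a b c]dblC dbl_sum.
have e23 : dbl c a b + dbl b a c = c * b / a.
  by rewrite [dbl c _ _]dblC [dbl b a c]dblC dbl_sum.
have := av_domD h1; rewrite e13 => E13.
have := av_domD h2; rewrite e23 => E23.
have := av_ltD h1 h2; rewrite e12 -E13.
have := E13; rewrite -E23; rewrite !avM !avV => Eq.
have pa := av_gt0 ha; have pb := av_gt0 hb; have pc := av_gt0 hc.
have Eab : v a = v b.
  have [na nb nc] : [/\ v a != 0, v b != 0 & v c != 0] by rewrite !gt_eqF.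
  have : v a * v a = v b * v b by exact: swap_ratio_sq nc na nb Eq.
  by rewrite -!expr2 => /eqP; rewrite eqrXn2 ?av_ge0 // => /eqP.
rewrite /bad -Eab mulfK ?gt_eqF // ltr_pdivrMr // -!expr2 sqlt ?av_ge0 //.
by move=> ->.
Qed.

Section Same.
Variables (al be : F).
Hypothesis (hab : v al < v be).

(** After scaling by [be], the assumption [v al < v be] says that [e1] and [e2], but not [e3],
    coincide at the place. The bad points are those that reduce to this double root. *)
Lemma badE a b c : b ^+ 2 = a ^+ 2 - al -> c ^+ 2 = a ^+ 2 - be ->
  bad a b c = (v a ^+ 2 < v be).
Proof.
move=> hb hc; apply/idP/idP => [h|h].
  have [_] := bad_sqr h; have -> : a ^+ 2 - c ^+ 2 = be by rewrite hc opprB addrC subrK.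
  by move=> ->; case/andP: h => h _; rewrite sqlt ?av_ge0.
have ec : v c ^+ 2 = v be by rewrite -avX hc av_domBr // avX.
rewrite /bad -sqlt ?av_ge0 // -[v b < _]sqlt ?av_ge0 // ec h /=.
by rewrite -avX hb; apply: av_ltB => //; rewrite avX.
Qed.

Lemma not_badE a b c : b ^+ 2 = a ^+ 2 - al -> c ^+ 2 = a ^+ 2 - be ->
  v be <= v a ^+ 2 -> v b = v a /\ v c <= v a.
Proof.
move=> hb hc h; split.
  apply/eqP; rewrite -(@eqrXn2 _ 2) ?av_ge0 // -avX hb av_domB ?avX //.
  exact: lt_le_trans h.
by rewrite -sqle ?av_ge0 // -avX hc; apply: avB => //; rewrite avX.
Qed.

(* [dif_mul_conj] avoids the cancellation that may occur in the numerator of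
   [dif] when the second point is close to the opposite of the first. *)
Lemma dif_not_bad a b c a' b' c' :
  b ^+ 2 = a ^+ 2 - al -> c ^+ 2 = a ^+ 2 - be ->
  b' ^+ 2 = a' ^+ 2 - al -> c' ^+ 2 = a' ^+ 2 - be ->
  a' ^+ 2 - a ^+ 2 != 0 ->
  v be <= v a ^+ 2 -> v be <= v a' ^+ 2 ->
  v be <= v (dif a b c a' b' c') ^+ 2.
Proof.
move=> hb hc hb' hc' w0 ha ha'.
have be0 : 0 < v be by apply: le_lt_trans hab; exact: av_ge0.
have pa : 0 < v a.
  by rewrite lt_neqAle av_ge0 andbT eq_sym; apply: contraTneq ha => ->; rewrite expr2 mul0r -ltNge.
have pa' : 0 < v a'.
  by rewrite lt_neqAle av_ge0 andbT eq_sym; apply: contraTneq ha' => ->; rewrite expr2 mul0r -ltNge.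
have [eb lc] := not_badE hb hc ha; have [eb' lc'] := not_badE hb' hc' ha'.
have := dif_mul_conj hb hc hb' hc' w0; move/(congr1 v); rewrite avM.
rewrite [v (_ - al * be)]av_domB; last first.
  rewrite !avM; apply: lt_le_trans (_ : v be * v be <= _).
    by rewrite ltr_pM2r.
  by apply: ler_pM => //; exact: ltW.
rewrite avM !avX => E.
set s := v (dif _ _ _ _ _ _) in E *; set n := v (_ - _) in E.
have s0 : 0 <= s by exact: av_ge0.
(* By [E], [s * n = v a ^+ 2 * v a' ^+ 2], while [n] is at most [v a * v a'] times the larger of
   [v a] and [v a']. Hence [s] is at least the smaller of the two. *)
wlog le : / v a <= v a' => [W|]; last first.
  apply: le_trans ha _; rewrite sqle ?av_ge0 //.
  have hn : n <= v a * v a' * v a'.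
    apply: avB; rewrite !avM ?eb ?eb'; first by rewrite ler_pM2l ?mulr_gt0.
    rewrite [v a' * v a]mulrC ler_pM2l ?mulr_gt0 //; exact: le_trans lc le.
  have n0 : 0 < n.
    rewrite lt_neqAle av_ge0 andbT eq_sym; apply/eqP => n0.
    by move/eqP: E; rewrite n0 mulr0 eq_sym gt_eqF // mulr_gt0 // exprn_gt0.
  rewrite -(ler_pM2r n0) E; apply: le_trans (_ : v a * (v a * v a' * v a') <= _).
    by rewrite ler_pM2l.
  by rewrite !expr2 !mulrA.
case/orP: (le_total (v a) (v a')) => [|le]; first exact: W.
apply: le_trans ha' _; rewrite sqle ?av_ge0 //.
have hn : n <= v a * v a' * v a.
  apply: avB; rewrite !avM ?eb ?eb'; first by rewrite ler_pM2l ?mulr_gt0 //; exact: le_trans lc' le.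
  by rewrite [v a' * v a]mulrC ler_pM2l ?mulr_gt0.
have n0 : 0 < n.
  rewrite lt_neqAle av_ge0 andbT eq_sym; apply/eqP => n0.
  by move/eqP: E; rewrite n0 mulr0 eq_sym gt_eqF // mulr_gt0 // exprn_gt0.
rewrite -(ler_pM2r n0) E; apply: le_trans (_ : v a' * (v a * v a' * v a) <= _).
  by rewrite ler_pM2l.
by rewrite !expr2 [leRHS]mulrACA [leLHS]mulrC -[leLHS]mulrA.
Qed.

(** When [a / b] and [a' / b'] have the same residue [1] or [-1] and [c'] is close to [c], both
    terms of the numerator of [dif] are close to [b * b' * c], or both to its opposite. As
    [v 2 = 1], they add up without cancellation. *)
Lemma dif_bad_close a b c a' b' c' :
  v 2 = 1 ->
  b ^+ 2 = a ^+ 2 - al -> c ^+ 2 = a ^+ 2 - be ->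
  b' ^+ 2 = a' ^+ 2 - al -> c' ^+ 2 = a' ^+ 2 - be ->
  a' ^+ 2 - a ^+ 2 != 0 -> b != 0 ->
  v a ^+ 2 < v be -> v a = v b -> v a' = v b' -> v b' = v b ->
  (v (a - b) < v b /\ v (a' - b') < v b) \/ (v (a + b) < v b /\ v (a' + b') < v b) ->
  v (c' - c) < v c ->
  v be <= v (dif a b c a' b' c') ^+ 2.
Proof.
move=> v2 hb hc hb' hc' w0 b0 ha eab eab' ebb' hs hc3.
have ec : v c ^+ 2 = v be by rewrite -avX hc av_domBr // avX.
have c0 : c != 0.
  by rewrite -(av_eq0) gt_eqF // -sqlt ?av_ge0 // expr2 mul0r ec; apply: le_lt_trans hab; exact: av_ge0.
have pb := av_gt0 b0; have pc := av_gt0 c0.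
have ec' : v c' = v c by rewrite -(subrK c c') addrC av_domD.
have M : v (2 * b * b' * c) = v b * v b * v c by rewrite !avM v2 ebb' mul1r.
have hN : v (a * b' * c' + a' * b * c) = v b * v b * v c.
  case: hs => -[hs hs'].
    have -> : a * b' * c' + a' * b * c = 2 * b * b' * c +
       ((a - b) * b' * c' + b * b' * (c' - c) + (a' - b') * b * c) by ring.
    rewrite av_domD // M; apply: av_ltD; first apply: av_ltD.
    - by rewrite !avM ebb' ec' ltr_pM2r // ltr_pM2r.
    - by rewrite !avM ebb' ltr_pM2l // mulr_gt0.
    by rewrite !avM ltr_pM2r // ltr_pM2r.
  have -> : a * b' * c' + a' * b * c = - (2 * b * b' * c) +
       ((a + b) * b' * c' - b * b' * (c' - c) + (a' + b') * b * c) by ring.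
  rewrite av_domD avN // M; apply: av_ltD; first apply: av_ltB.
  - by rewrite !avM ebb' ec' ltr_pM2r // ltr_pM2r.
  - by rewrite !avM ebb' ltr_pM2l // mulr_gt0.
  by rewrite !avM ltr_pM2r // ltr_pM2r.
rewrite -ec sqle ?av_ge0 // /dif avM avV hN.
have pw := av_gt0 w0; rewrite ler_pdivlMr // mulrC ler_pM2r //.
by apply: avB; rewrite avX expr2 ?eab ?eab' ?ebb'.
Qed.

End Same.

(* The component of order 2, where the residue of [a / b] is not [1] or [-1]. *)
Definition antipodal (a b : F) := (v a ^+ 2 <= v (a ^+ 2 - b ^+ 2)) && (v b ^+ 2 <= v (a ^+ 2 - b ^+ 2)).

(** The first two coordinates of the double differ by [c * (a ^+ 2 - b ^+ 2) / (a * b)], which is at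
    least as large as [c]. For a bad point this puts the double on the identity component. *)
Lemma antipodal_dbl a b c : a != 0 -> b != 0 -> c != 0 -> antipodal a b ->
  v c <= v (dbl a b c) \/ v c <= v (dbl b a c).
Proof.
move=> ha hb hc /andP[h1 h2].
have pa := av_gt0 ha; have pb := av_gt0 hb; have pc := av_gt0 hc.
have H : v c <= v (dbl a b c - dbl b a c).
  rewrite dbl_diff // avM avV !avM ler_pdivlMr ?mulr_gt0 // ler_pM2l //.
  case: (leP (v a) (v b)) => h.
    by apply: le_trans h2; rewrite expr2 ler_pM2r.
  by apply: le_trans h1; rewrite expr2 ler_pM2l // ltW.
case: (leP (v c) (v (dbl a b c))) => h; first by left.
case: (leP (v c) (v (dbl b a c))) => h'; first by right.
by have := av_ltB h h'; rewrite ltNge H.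
Qed.

Lemma not_antipodal a b : a != 0 -> b != 0 -> ~~ antipodal a b ->
  v a = v b /\ (v (a - b) < v b \/ v (a + b) < v b).
Proof.
move=> ha hb; rewrite /antipodal negb_and -!ltNge => H.
have E : v a = v b.
  case: (ltgtP (v a) (v b)) => // h.
    have : v (a ^+ 2 - b ^+ 2) = v b ^+ 2 by rewrite av_domBr ?avX // sqlt ?av_ge0.
    move=> E; move: H; rewrite E ltxx orbF sqlt ?av_ge0 // => h'.
    by have := lt_trans h h'; rewrite ltxx.
  have : v (a ^+ 2 - b ^+ 2) = v a ^+ 2 by rewrite av_domB ?avX // sqlt ?av_ge0.
  move=> E; move: H; rewrite E ltxx /= sqlt ?av_ge0 // => h'.
  by have := lt_trans h h'; rewrite ltxx.
split=> //; move: H; rewrite E orbb subr_sqr avM.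
case: (ltP (v (a - b)) (v b)) => h1; first by left.
case: (ltP (v (a + b)) (v b)) => h2; first by right.
by rewrite ltNge expr2 ler_pM ?av_ge0.
Qed.

End AbsTheory.

(** * Finite colourings of the halving sequence *)

(** Finite partitions are kept as colourings because conjunctions then correspond to products of
    colours; this is how several places are treated at once. *)
Definition colorable (R : nat -> nat -> Prop) := exists (T : finType) (col : nat -> T),
  forall n m, (n < m)%N -> col n = col m -> R n m.

Lemma colorable_and R1 R2 : colorable R1 -> colorable R2 ->
  colorable (fun n m => R1 n m /\ R2 n m).
Proof.
move=> [T1 [c1 h1]] [T2 [c2 h2]]; exists (T1 * T2)%type, (fun n => (c1 n, c2 n)).
by move=> n m nm [e1 e2]; split; [exact: h1 | exact: h2].
Qed.

Lemma colorable_all (I : eqType) (s : seq I) (R : I -> nat -> nat -> Prop) :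
  (forall i, i \in s -> colorable (R i)) ->
  colorable (fun n m => forall i, i \in s -> R i n m).
Proof.
elim: s => [|i s IH] H; first by exists unit, (fun _ => tt).
have [T [c h]] := colorable_and (H i (mem_head _ _))
  (IH (fun j js => H j (mem_behead (s := i :: s) js))).
exists T, c => n m nm e j; have [h1 h2] := h n m nm e.
by rewrite inE => /orP[/eqP->|/h2].
Qed.

(** Among [M + 1] consecutive indices, with [M] the number of colours, two share a colour. What
    matters is that [M] bounds the gap independently of [N]. *)
Lemma colorable_pigeonhole R : colorable R ->
  exists M, forall N, exists i k, [/\ (N <= i)%N, (0 < k <= M)%N & R i (i + k)%N].
Proof.
move=> [T [col h]]; exists #|T| => N.
pose f (i : 'I_#|T|.+1) := col (N + i)%N.
have : ~~ injectiveb f.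
  by apply/negP => /injectiveP /leq_card; rewrite card_ord ltnn.
case/injectivePn => x [y xy e].
wlog lt : x y xy e / (x < y)%N => [W|].
  case: (ltngtP x y) => [l|l|/val_inj l]; first exact: W l.
    by apply: (W y x) => //; rewrite eq_sym.
  by rewrite l eqxx in xy.
exists (N + x)%N, (y - x)%N; split; first exact: leq_addr.
  by rewrite subn_gt0 lt /= (leq_trans (leq_subr _ _)) // -ltnS.
by rewrite -addnA subnKC 1?ltnW //; apply: h => //; rewrite ltn_add2l.
Qed.

Lemma exp2z_lt (a b : int) : ((2 : rat) ^ a < 2 ^ b) = (a < b).
Proof. by rewrite ltr_eXz2l. Qed.

Lemma absval_finite_range (F : fieldType) (v : absval F) (lo hi : F) :
  lo != 0 -> hi != 0 ->
  exists L : seq rat, forall x, v lo < v x ^+ 2 -> v x ^+ 2 < v hi -> v x \in L.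
Proof.
move=> /(@av_pow2 _ v)[h eh] /(@av_pow2 _ v)[g eg].
pose B := (absz h + absz g)%N.
exists [seq (2 : rat) ^ (i%:Z - B%:Z) | i <- iota 0 (B + B).+1] => x.
have [->|x0] := eqVneq x 0; first by rewrite av0 expr2 mul0r eh ltNge ltW ?exprz_gt0.
have [k ek] := av_pow2 v x0; rewrite ek eh eg.
have -> : ((2 : rat) ^ k) ^+ 2 = 2 ^ (k + k) by rewrite expr2 expfzDr.
rewrite !exp2z_lt => h1 h2; apply/mapP; exists (absz (k + B%:Z)).
  by rewrite mem_iota; lia.
by congr (_ ^ _); lia.
Qed.

Section Colour.
Variables (F : fieldType) (v : absval F).
Hypothesis two0 : (2 : F) != 0.
Hypothesis v2 : v 2 = 1.
Variables (r1 r2 r3 : nat -> F) (al be : F).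
Hypotheses (r10 : forall n, r1 n != 0) (r20 : forall n, r2 n != 0) (r30 : forall n, r3 n != 0).
Hypotheses (hal : forall n, r2 n ^+ 2 = r1 n ^+ 2 - al) (hbe : forall n, r3 n ^+ 2 = r1 n ^+ 2 - be).
Hypotheses (al0 : al != 0) (be0 : be != 0).
Hypothesis w0 : forall n m, (n < m)%N -> r1 m ^+ 2 - r1 n ^+ 2 != 0.
Hypotheses (d1 : forall n, r1 n = dbl (r1 n.+1) (r2 n.+1) (r3 n.+1))
  (d2 : forall n, r2 n = dbl (r2 n.+1) (r1 n.+1) (r3 n.+1))
  (d3 : forall n, r3 n = dbl (r3 n.+1) (r1 n.+1) (r2 n.+1)).

Definition sdif1 n m := dif (r1 n) (r2 n) (r3 n) (r1 m) (r2 m) (r3 m).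
Definition sdif2 n m := dif (r2 n) (r1 n) (r3 n) (r2 m) (r1 m) (r3 m).
Definition sdif3 n m := dif (r3 n) (r1 n) (r2 n) (r3 m) (r1 m) (r2 m).

Hypotheses (s10 : forall n m, (n < m)%N -> sdif1 n m != 0)
  (s20 : forall n m, (n < m)%N -> sdif2 n m != 0) (s30 : forall n m, (n < m)%N -> sdif3 n m != 0).

Let h12 n m : r1 n ^+ 2 - r1 m ^+ 2 = r2 n ^+ 2 - r2 m ^+ 2.
Proof. by rewrite !hal; ring. Qed.
Let h13 n m : r1 n ^+ 2 - r1 m ^+ 2 = r3 n ^+ 2 - r3 m ^+ 2.
Proof. by rewrite !hbe; ring. Qed.

Lemma sdif1_dbl n m : (n < m)%N -> sdif1 n m = dbl (sdif1 n.+1 m.+1) (sdif2 n.+1 m.+1) (sdif3 n.+1 m.+1).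
Proof.
move=> nm; rewrite /sdif1 (d1 n) (d1 m) (d2 n) (d2 m) (d3 n) (d3 m).
apply: dif_dbl => //; try exact: w0; try exact: s10; try exact: s20; try exact: s30.
by rewrite -!d1; exact: w0.
Qed.

Lemma sdif2_dbl n m : (n < m)%N -> sdif2 n m = dbl (sdif2 n.+1 m.+1) (sdif1 n.+1 m.+1) (sdif3 n.+1 m.+1).
Proof.
move=> nm; rewrite /sdif2 (d1 n) (d1 m) (d2 n) (d2 m) (d3 n) (d3 m).
rewrite [dbl (r3 n.+1) _ _]dblC [dbl (r3 m.+1) _ _]dblC dif_dbl //.
- by rewrite /sdif3 [dif (r3 _) _ _ _ _ _]difC.
- by rewrite -h12 h13.
- by rewrite -opprB -h12 opprB; exact: w0.
- exact: s20.
- exact: s10.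
- by rewrite difC; exact: s30.
by rewrite -!d2 -opprB -h12 opprB; exact: w0.
Qed.

Lemma sdif3_dbl n m : (n < m)%N -> sdif3 n m = dbl (sdif3 n.+1 m.+1) (sdif1 n.+1 m.+1) (sdif2 n.+1 m.+1).
Proof.
move=> nm; rewrite /sdif3 (d1 n) (d1 m) (d2 n) (d2 m) (d3 n) (d3 m).
rewrite [dbl (r1 n.+1) _ _]dblC [dbl (r1 m.+1) _ _]dblC.
rewrite [dbl (r2 n.+1) _ _]dblC [dbl (r2 m.+1) _ _]dblC dif_dbl //.
- by rewrite /sdif1 /sdif2 [dif (r1 _) _ _ _ _ _]difC [dif (r2 _) _ _ _ _ _]difC.
- by rewrite -h13 h12.
- by rewrite -opprB -h13 opprB; exact: w0.
- exact: s30.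
- by rewrite difC; exact: s10.
- by rewrite difC; exact: s20.
by rewrite -!d3 -opprB -h13 opprB; exact: w0.
Qed.

Lemma sdif2_sqr n m : (n < m)%N -> sdif2 n m ^+ 2 = sdif1 n m ^+ 2 - al.
Proof.
move=> nm; have := dif_sq_diff two0 (h12 n m) (h13 n m) (w0 nm).
by rewrite -/(sdif1 n m) -/(sdif2 n m) hal subKr => <-; rewrite subKr.
Qed.

Lemma sdif3_sqr n m : (n < m)%N -> sdif3 n m ^+ 2 = sdif1 n m ^+ 2 - be.
Proof.
move=> nm; have := dif_sq_diff two0 (h13 n m) (h12 n m) (w0 nm).
rewrite [dif (r1 _) _ _ _ _ _]difC -/(sdif1 n m) -/(sdif3 n m) hbe subKr => <-.
by rewrite subKr.
Qed.

Lemma bad_descends n m : (n < m)%N -> bad v (sdif1 n m) (sdif2 n m) (sdif3 n m) ->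
  bad v (sdif1 n.+1 m.+1) (sdif2 n.+1 m.+1) (sdif3 n.+1 m.+1).
Proof.
move=> nm; rewrite (sdif1_dbl nm) (sdif2_dbl nm) (sdif3_dbl nm).
by apply: (bad_dbl two0); [exact: s10|exact: s20|exact: s30].
Qed.

(** The colour determines the component. For a bad point off the component of order 2, the absolute
    value of [r2] fixes the component up to inversion, and the residue signs of [r1 / r2] and of
    [r3] settle the rest; such values of [r2] satisfy [v al < v (r2 n) ^+ 2 < v be], so they are
    finitely many. *)
Lemma bad_colorable : colorable (fun n m => ~~ bad v (sdif1 n m) (sdif2 n m) (sdif3 n m)).
Proof.
(* By [bad_sqr] a bad difference forces [v al < v be]; otherwise one colour is enough. *)
case: (ltP (v al) (v be)) => hv; last first.
  exists unit, (fun _ => tt) => n m nm _; apply/negP => /bad_sqr[].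
  by rewrite sdif2_sqr // sdif3_sqr // !subKr ltNge hv.
have bE n := badE hv (hal n) (hbe n).
(* [rho] is a reference for the sign of [r3] modulo the place. *)
have [rho hrho] : exists rho, forall n, bad v (r1 n) (r2 n) (r3 n) ->
    [/\ v rho = v (r3 n) & (v (r3 n - rho) < v rho \/ v (r3 n + rho) < v rho)].
  case: (classic (exists n, bad v (r1 n) (r2 n) (r3 n))) => [[n0 b0]|H]; last first.
    by exists 0 => n bn; case: H; exists n.
  have e3 n : bad v (r1 n) (r2 n) (r3 n) -> v (r3 n) ^+ 2 = v be.
    rewrite bE => b; rewrite -avX hbe av_domBr ?avX //.
  exists (r3 n0) => n bn.
  have E : v (r3 n0) = v (r3 n).
    by apply/eqP; rewrite -(@eqrXn2 _ 2) ?av_ge0 // !e3.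
  split=> //; case: (ltP (v (r3 n - r3 n0)) (v (r3 n0))) => l1; first by left.
  case: (ltP (v (r3 n + r3 n0)) (v (r3 n0))) => l2; first by right.
  have : v ((r3 n - r3 n0) * (r3 n + r3 n0)) < v be.
    by rewrite -subr_sqr -h13; apply: av_ltB; rewrite avX -bE.
  by rewrite avM ltNge -(e3 _ b0) expr2 ler_pM ?av_ge0.
have [L hL] := absval_finite_range v al0 be0.
(* Outside [L] the function [index] returns [size L], whence the successor in the ordinal type. This
   entry is only used for bad, non-antipodal points, whose value does lie in [L]. *)
pose colr n := (bad v (r1 n) (r2 n) (r3 n), antipodal v (r1 n) (r2 n),
  v (r1 n - r2 n) < v (r2 n), v (r3 n - rho) < v rho,
  inord (index (v (r2 n)) L) : 'I_(size L).+1).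
(* Colours are read one step further, as [antipodal_dbl] needs a doubling. *)
exists (bool * bool * bool * bool * 'I_(size L).+1)%type, (fun n => colr n.+1).
have A n m : (n < m)%N -> ~~ bad v (r1 n) (r2 n) (r3 n) -> ~~ bad v (r1 m) (r2 m) (r3 m) ->
  ~~ bad v (sdif1 n m) (sdif2 n m) (sdif3 n m).
  move=> nm; rewrite !bE (badE hv (sdif2_sqr nm) (sdif3_sqr nm)) -!leNgt => b1 b2.
  exact: dif_not_bad (hal n) (hbe n) (hal m) (hbe m) (w0 nm) b1 b2.
move=> n m nm [eb eh es e3 /(congr1 val)] /=.
rewrite !inordK ?ltnS ?index_size // => eL.
case bn : (bad v (r1 n.+1) (r2 n.+1) (r3 n.+1)); last first.
  apply/negP => /(bad_descends nm); apply/negP.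
  by apply: A => //; rewrite ?bn // -eb bn.
have bm : bad v (r1 m.+1) (r2 m.+1) (r3 m.+1) by rewrite -eb.
case hn : (antipodal v (r1 n.+1) (r2 n.+1)).
  have hm : antipodal v (r1 m.+1) (r2 m.+1) by rewrite -eh.
  have H k : bad v (r1 k.+1) (r2 k.+1) (r3 k.+1) -> antipodal v (r1 k.+1) (r2 k.+1) ->
    ~~ bad v (r1 k) (r2 k) (r3 k).
    move=> bk hk; apply/negP => bk'.
    have := antipodal_dbl two0 (r10 k.+1) (r20 k.+1) (r30 k.+1) hk; rewrite -d1 -d2.
    have [_ e] := bad_sqr bk; have [_ e'] := bad_sqr bk'.
    have ee : v (r3 k.+1) = v (r3 k).
      by apply/eqP; rewrite -(@eqrXn2 _ 2) ?av_ge0 // -e -e' !hbe !subKr.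
    by rewrite ee !leNgt; case/andP: bk' => -> ->; case.
  exact: A nm (H n bn hn) (H m bm hm).
have hm : antipodal v (r1 m.+1) (r2 m.+1) = false by rewrite -eh.
apply/negP => /(bad_descends nm).
have nm1 : (n.+1 < m.+1)%N by [].
rewrite (badE hv (sdif2_sqr nm1) (sdif3_sqr nm1)); apply/negP; rewrite -leNgt.
have [E1 S1] := not_antipodal (r10 n.+1) (r20 n.+1) (negbT hn).
have [E2 S2] := not_antipodal (r10 m.+1) (r20 m.+1) (negbT hm).
have inL k : bad v (r1 k.+1) (r2 k.+1) (r3 k.+1) -> antipodal v (r1 k.+1) (r2 k.+1) = false ->
   v (r1 k.+1) = v (r2 k.+1) -> v (r2 k.+1) \in L.
  rewrite bE => b h e; apply: hL; last by rewrite -e.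
  move: h; rewrite /antipodal e andbb hal subKr => /negbT.
  by rewrite -ltNge.
have E3 : v (r2 m.+1) = v (r2 n.+1).
  by rewrite -(nth_index 0 (inL n bn hn E1)) -(nth_index 0 (inL m bm hm E2)) eL.
apply: (dif_bad_close hv v2 (hal n.+1) (hbe n.+1) (hal m.+1) (hbe m.+1) (w0 nm1) (r20 _)) => //.
- by rewrite -bE.
- case: S1 => S1.
    by left; split=> //; rewrite -E3 -es.
  case: S2 => S2; last by right; split=> //; rewrite -E3.
  by left; split; [rewrite es | rewrite -E3].
have [f1 f2] := hrho _ bn; have [f1' f2'] := hrho _ bm.
rewrite -f1; case: f2 => f2.
  rewrite e3 in f2.
  have -> : r3 m.+1 - r3 n.+1 = (r3 m.+1 - rho) - (r3 n.+1 - rho) by ring.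
  by apply: av_ltB => //; rewrite e3.
case: f2' => f2'.
  have -> : r3 m.+1 - r3 n.+1 = (r3 m.+1 - rho) - (r3 n.+1 - rho) by ring.
  by apply: av_ltB => //; rewrite e3.
have -> : r3 m.+1 - r3 n.+1 = (r3 m.+1 + rho) - (r3 n.+1 + rho) by ring.
exact: av_ltB.
Qed.

End Colour.

(** * Factorial subrings *)

Section Factorial.
Variables (D : idomainType) (A : D -> Prop).

Definition subringA := [/\ A 1, forall x y, A x -> A y -> A (x - y)
  & forall x y, A x -> A y -> A (x * y)].
Definition dvdA x y := exists q, A q /\ y = x * q.
Definition unitA x := A x /\ exists y, A y /\ x * y = 1.
Definition primeA p := [/\ A p, p != 0, ~ unitA p &
  forall x y, A x -> A y -> dvdA p (x * y) -> dvdA p x \/ dvdA p y].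
(** Factoring into primes instead of irreducibles makes uniqueness automatic. Taking [A] as a
    predicate on a larger domain covers [R_K] in [K], [R_K[t]] in [K[t]], [K[t]] itself, and their
    images in [K(t)]. *)
Definition factorialA := forall x, A x -> x != 0 ->
  exists u r, [/\ unitA u, forall p, p \in r -> primeA p & x = u * \prod_(p <- r) p].

Hypothesis HA : subringA.

Lemma A_1 : A 1. Proof. by case: HA. Qed.
Lemma A_B x y : A x -> A y -> A (x - y). Proof. by case: HA => _ h _; exact: h. Qed.
Lemma A_M x y : A x -> A y -> A (x * y). Proof. by case: HA => _ _; exact. Qed.
Lemma A_0 : A 0. Proof. by rewrite -(subrr 1); apply: A_B; exact: A_1. Qed.
Lemma A_N x : A x -> A (- x). Proof. by rewrite -sub0r; apply: A_B; exact: A_0. Qed.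
Lemma A_D x y : A x -> A y -> A (x + y).
Proof. by move=> hx hy; rewrite -(opprK y); apply: A_B => //; exact: A_N. Qed.
Lemma A_X x n : A x -> A (x ^+ n).
Proof. by move=> hx; elim: n => [|n IH]; rewrite ?expr0 ?exprS; [exact: A_1|exact: A_M]. Qed.

Lemma unitA1 : unitA 1.
Proof. by split; [exact: A_1|exists 1; rewrite mulr1; split; [exact: A_1|]]. Qed.

Lemma unitAM x y : unitA x -> unitA y -> unitA (x * y).
Proof.
move=> [Ax [x' [Ax' ex]]] [Ay [y' [Ay' ey]]]; split; first exact: A_M.
by exists (x' * y'); split; [exact: A_M | rewrite mulrACA ex ey mulr1].
Qed.

Lemma unitA_dvd x y : unitA x -> A y -> dvdA y x -> unitA y.
Proof.
move=> [Ax [x' [Ax' ex]]] Ay [q [Aq eq]]; split=> //.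
by exists (q * x'); split; [exact: A_M | rewrite mulrA -eq].
Qed.

Lemma dvdA_mulr x y z : A z -> dvdA x y -> dvdA x (y * z).
Proof. by move=> Az [q [Aq ->]]; exists (q * z); rewrite mulrA; split=> //; exact: A_M. Qed.

Lemma dvdA_mull x y z : A z -> dvdA x y -> dvdA x (z * y).
Proof. by move=> Az h; rewrite mulrC; exact: dvdA_mulr. Qed.

Lemma A_prod (r : seq D) : (forall p, p \in r -> A p) -> A (\prod_(p <- r) p).
Proof.
elim: r => [|q r IH] h; first by rewrite big_nil; exact: A_1.
rewrite big_cons; apply: A_M; first by apply: h; rewrite mem_head.
by apply: IH => p pr; apply: h; rewrite inE pr orbT.
Qed.

Lemma prime_dvd_prime p q : primeA p -> primeA q -> dvdA p q ->
  exists c, unitA c /\ q = p * c.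
Proof.
move=> [Ap p0 pu pp] [Aq q0 qu qp] [c [Ac e]]; exists c; split=> //.
have : dvdA q (p * c) by exists 1; split; [exact: A_1 | rewrite mulr1].
case/(qp _ _ Ap Ac) => [[d [Ad e']]|[d [Ad e']]].
  split=> //; exists d; split=> //; apply: (mulfI q0).
  by rewrite mulr1 {2}e e'; ring.
case: pu; split=> //; exists d; split=> //; apply: (mulfI q0).
by rewrite mulr1 {2}e e'; ring.
Qed.

Lemma prime_dvd_prod p u r : primeA p -> unitA u -> (forall q, q \in r -> primeA q) ->
  dvdA p (u * \prod_(q <- r) q) -> exists q c, [/\ q \in r, unitA c & q = p * c].
Proof.
move=> pp uu hr; have Pp := pp; case: Pp => Ap p0 pu pd.
elim: r hr => [|q r IH] hr.
  by rewrite big_nil mulr1 => /(unitA_dvd uu Ap).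
rewrite big_cons mulrCA => /pd[].
- by case: (hr q); rewrite ?mem_head.
- apply: A_M; first by case: uu.
  by apply: A_prod => x xr; case: (hr x); rewrite // inE xr orbT.
- move=> /(prime_dvd_prime pp (hr q (mem_head _ _)))[c [uc ec]].
  by exists q, c; rewrite mem_head.
case/IH => [x xr|x [c [xr uc ec]]]; first by apply: hr; rewrite inE xr orbT.
by exists x, c; rewrite inE xr orbT.
Qed.

Lemma prime_cancel p u r : primeA p -> unitA u -> (forall q, q \in r -> primeA q) ->
  dvdA p (u * \prod_(q <- r) q) ->
  exists u' r', [/\ unitA u', forall q, q \in r' -> primeA q, (size r').+1 = size r
    & u * \prod_(q <- r) q = p * (u' * \prod_(q <- r') q)].
Proof.
move=> pp uu hr /(prime_dvd_prod pp uu hr)[q [c [qr uc ec]]].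
exists (u * c), (rem q r); split; first exact: unitAM.
- by move=> x /mem_rem; exact: hr.
- by rewrite size_rem // prednK //; case: (r) qr.
by rewrite (big_rem q qr) /= {1}ec; ring.
Qed.

Lemma prime_mult p : primeA p -> factorialA -> forall x, A x -> x != 0 ->
  exists k y, [/\ A y, x = p ^+ k * y & ~ dvdA p y].
Proof.
move=> pp fact x Ax x0; have [u [r [uu hr ex]]] := fact x Ax x0; have Pp := pp.
case: Pp => Ap p0 pu pd; rewrite ex {x ex Ax x0}.
elim: (size r) {-2}r (leqnn (size r)) u uu hr => [|n IH] {}r sr u uu hr.
  exists 0%N, (u * \prod_(q <- r) q); rewrite mul1r.
  case: r sr hr => // _ hr; rewrite big_nil mulr1; split=> //; first by case: uu.
  by move/(unitA_dvd uu Ap).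
have AA : A (u * \prod_(q <- r) q).
  by apply: A_M; [case: uu | apply: A_prod => x xr; case: (hr x xr)].
case: (classic (dvdA p (u * \prod_(q <- r) q))) => H; last first.
  by exists 0%N, (u * \prod_(q <- r) q); rewrite mul1r.
have [u' [r' [uu' hr' sr' e]]] := prime_cancel pp uu hr H.
have [|k [y [Ay ey ny]]] := IH r' _ u' uu' hr'; first by rewrite -ltnS sr'.
by exists k.+1, y; split=> //; rewrite e ey exprS mulrA.
Qed.

End Factorial.

(** * Extension of an absolute value to the field of fractions *)

Section AbsvalExtension.
Variables (F : fieldType) (A : F -> Prop) (a : F -> rat).
Hypothesis HA : subringA A.
Hypothesis fracA : forall x : F, exists n d, [/\ A n, A d, d != 0 & x = n / d].
Hypotheses (a0 : a 0 = 0) (a2 : forall x, A x -> x != 0 -> exists k : int, a x = 2 ^ k).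
Hypothesis aM : forall x y, A x -> A y -> a (x * y) = a x * a y.
Hypothesis aD : forall x y m, A x -> A y -> a x <= m -> a y <= m -> a (x + y) <= m.

Lemma absval_extension : exists v : absval F, forall x, A x -> v x = a x.
Proof.
(* There is no canonical fraction over [A], so a numerator and a denominator are chosen for each
   [x]; [vE] shows that the choice does not matter. *)
have [f hf] : exists f : F -> F * F, forall x, [/\ A (f x).1, A (f x).2, (f x).2 != 0 & x = (f x).1 / (f x).2].
  apply: (functional_choice (fun x (p : F * F) => [/\ A p.1, A p.2, p.2 != 0 & x = p.1 / p.2])).
  by move=> x; have [n [d h]] := fracA x; exists (n, d).
pose v x := a (f x).1 / a (f x).2.
have agt x : A x -> x != 0 -> 0 < a x by move=> Ax /(a2 Ax)[k ->]; exact: exprz_gt0.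
have vE n d : A n -> A d -> d != 0 -> v (n / d) = a n / a d.
  move=> An Ad d0; have [h1 h2 h3 e] := hf (n / d); rewrite /v.
  have p1 : a d != 0 by rewrite gt_eqF ?agt.
  have p2 : a (f (n / d)).2 != 0 by rewrite gt_eqF ?agt.
  apply/eqP; rewrite eqr_div // -!aM //; apply/eqP; congr a.
  by move/eqP: e; rewrite eqr_div // => /eqP.
have v0 : v 0 = 0 by rewrite -(mul0r 1^-1) vE ?a0 ?mul0r ?oner_eq0 //; [exact: A_0|exact: A_1].
have vp x : x != 0 -> exists k : int, v x = 2 ^ k.
  have [h1 h2 h3 e] := hf x; rewrite {1}e mulf_eq0 invr_eq0 negb_or => /andP[n0 d0].
  have [k ek] := a2 h1 n0; have [l el] := a2 h2 d0.
  by exists (k - l); rewrite /v ek el expfzDr // -invr_expz.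
have vM x y : v (x * y) = v x * v y.
  have [h1 h2 h3 e] := hf x; have [g1 g2 g3 e'] := hf y.
  have -> : x * y = ((f x).1 * (f y).1) / ((f x).2 * (f y).2).
    by rewrite {1}e {1}e'; field; rewrite ?h3 ?g3.
  by rewrite vE ?mulf_neq0 ?aM ?invfM; try exact: A_M; rewrite // /v mulrACA.
have vD x y m : v x <= m -> v y <= m -> v (x + y) <= m.
  have [h1 h2 h3 e] := hf x; have [g1 g2 g3 e'] := hf y.
  have -> : x + y = ((f x).1 * (f y).2 + (f y).1 * (f x).2) / ((f x).2 * (f y).2).
    by rewrite {1}e {1}e'; field; rewrite ?h3 ?g3.
  have p1 := agt _ h2 h3; have p2 := agt _ g2 g3.
  rewrite vE ?mulf_neq0 //; [|by apply: A_D => //; exact: A_M | exact: A_M].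
  have p3 : 0 < a ((f x).2 * (f y).2) by rewrite aM // mulr_gt0.
  rewrite /v !ler_pdivrMr // => b1 b2.
  apply: aD; [exact: A_M|exact: A_M| |]; rewrite !aM //.
    by rewrite mulrA ler_pM2r.
  by rewrite [a (f x).2 * _]mulrC mulrA ler_pM2r.
exists (Absval v0 vp vM vD) => x Ax /=.
have a1 : a 1 = 1.
  have h : a 1 != 0 by rewrite gt_eqF // agt ?oner_eq0 //; exact: A_1.
  by apply: (mulfI h); rewrite -aM ?mulr1 //; exact: A_1.
by rewrite -{1}(divr1 x) vE ?oner_eq0 ?a1 ?divr1 //; exact: A_1.
Qed.

End AbsvalExtension.

(** * The absolute value attached to a prime element *)

Section PrimeAbsval.
Variables (F : fieldType) (A : F -> Prop).
Hypothesis HA : subringA A.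
Hypothesis fracA : forall x : F, exists n d, [/\ A n, A d, d != 0 & x = n / d].
Hypothesis fact : factorialA A.
Variable p : F.
Hypothesis pp : primeA A p.

Lemma prime_mult_le k l y z : A y -> A z -> ~ dvdA A p y ->
  p ^+ k * y = p ^+ l * z -> (l <= k)%N.
Proof.
move=> Ay Az ny e; have [Ap p0 _ _] := pp; rewrite leqNgt; apply/negP => lt; apply: ny.
exists (p ^+ (l - k).-1 * z); split; first by apply: A_M => //; exact: A_X.
apply: (mulfI (expf_neq0 k p0)); rewrite e [p * _]mulrA -exprS prednK ?subn_gt0 //.
by rewrite mulrA -exprD subnKC // ltnW.
Qed.

Lemma prime_absval : exists v : absval F, [/\ forall x, A x -> v x <= 1,
  forall x, A x -> (v x < 1 <-> dvdA A p x) & v p = 2^-1].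
Proof.
have [Ap p0 pu pd] := pp.
have [f hf] : exists f : F -> nat * F, forall x, A x -> x != 0 ->
    [/\ A (f x).2, x = p ^+ (f x).1 * (f x).2 & ~ dvdA A p (f x).2].
  apply: (functional_choice (fun x (q : nat * F) => A x -> x != 0 ->
    [/\ A q.2, x = p ^+ q.1 * q.2 & ~ dvdA A p q.2])) => x.
  case: (classic (A x)) => [Ax|]; last by exists (0%N, 0).
  have [->|x0] := eqVneq x 0; first by exists (0%N, 0).
  by have [k [y h]] := prime_mult HA pp fact Ax x0; exists (k, y).
pose a x : rat := if x == 0 then 0 else 2 ^ (- ((f x).1)%:Z).
have aE k y : A y -> ~ dvdA A p y -> a (p ^+ k * y) = 2 ^ (- k%:Z).
  move=> Ay ny; have y0 : y != 0.
    by apply/eqP => y0; apply: ny; exists 0; rewrite mulr0; split=> //; exact: A_0.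
  have x0 : p ^+ k * y != 0 by rewrite mulf_neq0 ?expf_neq0.
  have Ax : A (p ^+ k * y) by apply: A_M => //; exact: A_X.
  rewrite /a (negbTE x0); have [h1 h2 h3] := hf _ Ax x0.
  congr (_ ^ (- _%:Z)); apply/eqP; rewrite eqn_leq.
  by rewrite (prime_mult_le Ay h1 ny h2) (prime_mult_le h1 Ay h3 (esym h2)).
have aP x : A x -> x != 0 -> exists k y, [/\ A y, x = p ^+ k * y, ~ dvdA A p y & a x = 2 ^ (- k%:Z)].
  move=> Ax x0; have [h1 h2 h3] := hf _ Ax x0; exists (f x).1, (f x).2; split=> //.
  by rewrite {1}h2 aE.
have a0 : a 0 = 0 by rewrite /a eqxx.
have age x : 0 <= a x by rewrite /a; case: eqP => // _; rewrite exprz_ge0.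
have [|||v hv] := @absval_extension F A a HA fracA a0.
- by move=> x Ax x0; have [k [y [_ _ _ ->]]] := aP x Ax x0; eexists.
- move=> x y Ax Ay; have [->|x0] := eqVneq x 0; first by rewrite mul0r a0 mul0r.
  have [->|y0] := eqVneq y 0; first by rewrite mulr0 a0 mulr0.
  have [k [x' [Ax' ex nx ->]]] := aP x Ax x0; have [l [y' [Ay' ey ny ->]]] := aP y Ay y0.
  rewrite ex ey mulrACA -exprD aE; first by rewrite PoszD opprD expfzDr.
    exact: A_M.
  by case/(pd _ _ Ax' Ay').
- move=> x y m Ax Ay hx hy.
  have [x0|x0] := eqVneq x 0; first by rewrite x0 add0r.
  have [y0|y0] := eqVneq y 0; first by rewrite y0 addr0.
  have [xy0|xy0] := eqVneq (x + y) 0; first by rewrite xy0 a0; apply: le_trans hx; exact: age.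
  have Axy : A (x + y) by exact: A_D.
  have [k [x' [Ax' ex nx Ex]]] := aP x Ax x0; have [l [y' [Ay' ey ny Ey]]] := aP y Ay y0.
  have [j [z [Az ez nz Ez]]] := aP _ Axy xy0; rewrite Ez.
  have H : (minn k l <= j)%N.
    apply: (@prime_mult_le _ _ z (p ^+ (k - minn k l) * x' + p ^+ (l - minn k l) * y')) => //.
      by apply: A_D => //; apply: A_M => //; exact: A_X.
    by rewrite -ez mulrDr !mulrA -!exprD !subnKC ?geq_minl ?geq_minr // -ex -ey.
  have mono (b c : nat) : (b <= c)%N -> (2 : rat) ^ (- c%:Z) <= 2 ^ (- b%:Z).
    by move=> bc; rewrite ler_eXz2l // lerN2 lez_nat.
  case: (leqP k l) H => h H.
    by apply: le_trans hx; rewrite Ex; apply: mono.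
  by apply: le_trans hy; rewrite Ey; apply: mono.
have le1 x : A x -> v x <= 1.
  move=> Ax; rewrite hv //; have [->|x0] := eqVneq x 0; first by rewrite a0.
  have [k [x' [_ _ _ ->]]] := aP x Ax x0.
  by rewrite -(expr0z 2) ler_eXz2l // oppr_le0.
exists v; split=> //; last first.
  rewrite hv // -{1}(mulr1 p) -{1}(expr1 p) aE //; first exact: A_1.
  by move/(unitA_dvd HA (unitA1 HA) Ap).
move=> x Ax; rewrite hv //; have [->|x0] := eqVneq x 0.
  rewrite a0 ltr01; split=> // _; exists 0; rewrite mulr0; split=> //; exact: A_0.
have [[|k] [x' [Ax' ex nx ->]]] := aP x Ax x0.
  by rewrite oppr0 expr0z ltxx; split=> //; rewrite ex mul1r.
have h : (2 : rat) ^ (- k.+1%:Z) < 1 by rewrite -(expr0z 2) ltr_eXz2l // oppr_lt0.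
split=> // _.
exists (p ^+ k * x'); rewrite ex exprS mulrA; split=> //.
by apply: A_M => //; exact: A_X.
Qed.

End PrimeAbsval.

Lemma exp2z_inj (i j : int) : (2 : rat) ^ i = 2 ^ j -> i = j.
Proof. by apply: ieexprIz; rewrite ?pnatr_eq1. Qed.

(* Otherwise [x + a] and [x + b] both have the absolute value of [x] or both have
   absolute value [1], and the product has odd order. *)
Lemma absval_odd_ord (F : fieldType) (v : absval F) (x a b y : F) (k : int) :
  v x = 2 ^ (1 + (k + k)) -> v a <= 1 -> v b <= 1 ->
  y != 0 -> y ^+ 2 = x * (x + a) * (x + b) -> v a < 1 \/ v b < 1.
Proof.
move=> ex ha hb y0 e.
case: (ltP (v a) 1) => [|ha']; first by left.
case: (ltP (v b) 1) => [|hb']; first by right.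
have Ea : v a = 1 by apply/eqP; rewrite eq_le ha.
have Eb : v b = 1 by apply/eqP; rewrite eq_le hb.
have [l el] := av_pow2 v y0.
have := congr1 v e; rewrite expr2 !avM el -expfzDr //.
case: (ltgtP (v x) 1) => h.
- rewrite [x + a]addrC [x + b]addrC [v (a + x)]av_domD ?Ea // [v (b + x)]av_domD ?Eb // !mulr1 ex.
  by move/exp2z_inj; lia.
- rewrite [v (x + a)]av_domD ?Ea // [v (x + b)]av_domD ?Eb // ex -!expfzDr //.
  by move/exp2z_inj; lia.
by move: h; rewrite ex -(expr0z 2) => /exp2z_inj; lia.
Qed.

(** * Square-free part of an abscissa *)

Section SquarefreeDescent.
Variables (F : fieldType) (A : F -> Prop).
Hypothesis HA : subringA A.
Hypothesis fracA : forall x : F, exists n d, [/\ A n, A d, d != 0 & x = n / d].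
Hypothesis fact : factorialA A.

Lemma prod_dvd_of_coprime (r : seq F) h : (forall p, p \in r -> primeA A p) -> A h ->
  (forall p, p \in r -> ~ dvdA A p (\prod_(q <- rem p r) q)) ->
  (forall p, p \in r -> dvdA A p h) -> dvdA A (\prod_(q <- r) q) h.
Proof.
move=> hr Ah; elim: r hr => [|q r IH] hr hn hd.
  by exists h; rewrite big_nil mul1r.
have [|||s [As es]] := IH.
- by move=> p pr; apply: hr; rewrite inE pr orbT.
- move=> p pr pd; have pr' : p \in q :: r by rewrite inE pr orbT.
  have := hn p pr'; rewrite /=; case: eqP => [e|_]; apply.
    rewrite (big_rem p pr) /=; exists (\prod_(y <- rem p r) y); split=> //.
    by apply: A_prod => // x /mem_rem xr; case: (hr x); rewrite // inE xr orbT.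
  by rewrite big_cons; apply: dvdA_mull => //; case: (hr q (mem_head _ _)).
- by move=> p pr; apply: hd; rewrite inE pr orbT.
have [Aq q0 _ qp] := hr q (mem_head _ _).
have Ar : A (\prod_(q <- r) q).
  by apply: A_prod => // x xr; case: (hr x); rewrite // inE xr orbT.
have := hd q (mem_head _ _); rewrite es => /(qp _ _ Ar As)[H|[t [At et]]].
  by have := hn q (mem_head _ _); rewrite /= eqxx => /(_ H).
by exists t; split=> //; rewrite et big_cons; ring.
Qed.

(** Repeated primes of a factorization of [x] are moved into [z ^+ 2]. Each prime that is left
    occurs to an odd power in [x], so [absval_odd_ord] makes it divide [a] or [b]; as these primes
    are not associate to one another, their product divides [a * b]. *)
Lemma squarefree_descent (x a b y : F) :
  A a -> A b -> y != 0 -> y ^+ 2 = x * (x + a) * (x + b) ->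
  exists d z, [/\ A d, x = d * z ^+ 2, z != 0, dvdA A d (a * b) &
    forall g, A g -> dvdA A (g * g) d -> unitA A g].
Proof.
move=> Aa Ab y0 e.
have x0 : x != 0.
  by apply: contra_neq y0 => x0; apply/eqP; rewrite -sqrf_eq0 e x0 !mul0r.
have [u [r [z [uu hr z0 ex]]]] : exists u r z, [/\ unitA A u, forall p, p \in r -> primeA A p,
    z != 0 & x = u * \prod_(p <- r) p * z ^+ 2].
  have [n [d [An Ad d0 exx]]] := fracA x.
  have n0 : n != 0 by apply: contra_neq x0 => n0; rewrite exx n0 mul0r.
  have [u [r [uu hr er]]] := fact (A_M HA An Ad) (mulf_neq0 n0 d0).
  (* [n / d = (n * d) * d^-1 ^+ 2], so it suffices to factor an element of [A]. *)
  exists u, r, d^-1; split=> //; first by rewrite invr_eq0.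
  by rewrite -er exx; field.
have [n sr] : exists n, (size r < n)%N by exists (size r).+1.
elim: n u r z uu hr z0 ex sr => [//|n IH] u r z uu hr z0 ex; rewrite ltnS => sr.
(* If [p] divides the product of the other factors, [p ^+ 2] is absorbed in [z] and the list shrinks
   by two. *)
case: (classic (exists p, p \in r /\ dvdA A p (\prod_(q <- rem p r) q))) => [[p [pr H]]|H].
  have pp := hr p pr; have hr' q : q \in rem p r -> primeA A q by move/mem_rem; exact: hr.
  have [|u' [r' [uu' hr'' sr' e']]] := prime_cancel HA pp (unitA1 HA) hr'.
    by rewrite mul1r.
  rewrite mul1r in e'.
  have p0 : p != 0 by case: pp.
  apply: (IH (u * u') r' (p * z)) => //; first exact: unitAM.
  - by rewrite mulf_neq0.
  - by rewrite ex (big_rem p pr) /= e'; ring.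
  by rewrite sr' size_rem // (leq_trans (leq_pred _)).
have Ar s : (forall p, p \in s -> primeA A p) -> A (\prod_(p <- s) p).
  by move=> hs; apply: A_prod => // q /hs[].
have Au : A u by case: uu.
exists (u * \prod_(p <- r) p), z; split=> //.
- by apply: A_M => //; exact: Ar.
- have [u' [Au' eu]] := uu.2.
  have [|||s [As es]] := @prod_dvd_of_coprime r (a * b) hr.
  + exact: A_M.
  + by move=> p pr pd; apply: H; exists p.
  + move=> p pr; have pp := hr p pr; have [Ap p0 pu pd] := pp.
    have [v [v1 vd vp]] := prime_absval HA fracA fact pp.
    have vr : v (u * \prod_(q <- rem p r) q) = 1.
      have hr' q : q \in rem p r -> primeA A q by move/mem_rem; exact: hr.
      have Ax := A_M HA Au (Ar _ hr').
      apply/eqP; rewrite eq_le v1 // leNgt; apply/negP => /(vd _ Ax)/(pd _ _ Au (Ar _ hr'))[h|h].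
        by apply: pu; exact: unitA_dvd uu Ap h.
      by apply: H; exists p.
    have [k ek] := av_pow2 v z0.
    (* [p] contributes [2^-1], the other primes 1, and [z ^+ 2] contributes [2 ^ (k + k)]; the total
       exponent [2 k - 1] is [1 + 2 (k - 1)]. *)
    have [|||||h|h] := @absval_odd_ord _ v x a b y (k - 1).
    * rewrite ex (big_rem p pr) /=; set P := \prod_(q <- _) q in vr *.
      have -> : u * (p * P) * z ^+ 2 = p * (u * P) * (z * z) by ring.
      rewrite avM [v (p * _)]avM vr vp [v (z * z)]avM mulr1 ek -expfzDr //.
      by rewrite -[2^-1]/(2 ^ (-1)) -expfzDr //; congr (_ ^ _); lia.
    * exact: v1.
    * exact: v1.
    * by [].
    * by [].
    * by apply: dvdA_mulr => //; apply/vd.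
    by apply: dvdA_mull => //; apply/vd.
  exists (u' * s); split; first exact: A_M.
  by rewrite es mulrACA eu mul1r.
move=> g Ag [q [Aq eq]].
have g0 : g != 0.
  apply/eqP => g0; move: ex; rewrite eq g0 !mul0r => /eqP; by rewrite (negbTE x0).
have [ug [rg [uug hrg eg]]] := fact Ag g0.
case: rg hrg eg => [|p rg] hrg eg; first by rewrite eg big_nil mulr1.
have pp := hrg p (mem_head _ _); have [Ap p0 pu pd] := pp.
have [c [Ac ec]] : dvdA A p g.
  exists (ug * \prod_(q <- rg) q); split; last by rewrite eg big_cons; ring.
  apply: A_M => //; first by case: uug.
  by apply: Ar => w wr; apply: hrg; rewrite inE wr orbT.
have [|w [t [wr ut et]]] := prime_dvd_prod HA pp uu hr.
  rewrite eq ec; exists (c * (p * c) * q); split; last by ring.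
  by do !apply: A_M => //.
case: H; exists w; split=> //.
have [At [t' [At' ett]]] := ut; have [Au0 [u' [Au' eu]]] := uu.
(* Cancelling [p] in [u * w * R = p ^+ 2 * c ^+ 2 * q], with [w = p * t] and [R] the product of the
   other primes, leaves [p] as a factor of [R]; one more [t'] turns this [p] into [w]. *)
exists (t' * t' * (u' * (c * c * q))); split; first by do !apply: A_M => //.
apply: (mulfI p0).
have E : u * (w * \prod_(q <- rem w r) q) = p * c * (p * c) * q.
  by rewrite -ec -eq (big_rem w wr).
have -> : \prod_(q <- rem w r) q = t' * u' * (u * (p * t * \prod_(q <- rem w r) q)) / p.
  have -> : t' * u' * (u * (p * t * \prod_(q <- rem w r) q)) =
     (t * t') * (u * u') * p * \prod_(q <- rem w r) q by ring.
  by rewrite ett eu !mul1r mulrC mulKf.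
rewrite -et E et; transitivity ((t * t') * (t' * u' * (p * c * (p * c) * q))); last by ring.
by rewrite ett mul1r; field.
Qed.

End SquarefreeDescent.

(** Irreducibles are prime by comparing two factorizations of [p * q = a * b]: the partner of [p]
    occurs among the factors of [a] or of [b]. *)
Lemma UFD_factorial (K : fieldType) (S : {pred K}) :
  subring_of S -> UFD S -> subringA (fun x => x \in S) /\ factorialA (fun x => x \in S).
Proof.
move=> [S1 SBM] [ex un].
have HS : subringA (fun x => x \in S).
  by split=> // x y hx hy; case: (SBM x y hx hy).
split=> //.
have irp p : irredS S p -> primeA (fun x => x \in S) p.
  move=> [pS p0 pu pi]; split=> // a b aS bS [q [qS eab]].
  have [->|a0] := eqVneq a 0; first by left; exists 0; rewrite mulr0; split=> //; exact: A_0 HS.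
  have [->|b0] := eqVneq b 0; first by right; exists 0; rewrite mulr0; split=> //; exact: A_0 HS.
  have q0 : q != 0 by apply: contraTneq (mulf_neq0 a0 b0) => q0; rewrite eab q0 mulr0 eqxx.
  (* [UFD] factors only nonzero non-units, hence the separate treatment of the cases where [a], [b]
     or [q] is a unit. *)
  case: (classic (unitS S a)) => [[_ [a' [a'S ea]]]|ua].
    right; exists (q * a'); split; first exact: (A_M HS).
    by rewrite mulrA -eab mulrAC ea mul1r.
  case: (classic (unitS S b)) => [[_ [b' [b'S eb]]]|ub].
    left; exists (q * b'); split; first exact: (A_M HS).
    by rewrite mulrA -eab -mulrA eb mulr1.
  case: (classic (unitS S q)) => [[_ [q' [q'S eq]]]|uq].
    have e : p = a * (b * q') by rewrite mulrA eab -mulrA eq mulr1.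
    case: (pi _ _ aS (A_M HS bS q'S) e) => [//|[_ [c [cS ec]]]].
    case: ub; split=> //; exists (q' * c); split; first exact: (A_M HS).
    by rewrite mulrA.
  have [ra [ira era]] := ex a aS a0 ua; have [rb [irb erb]] := ex b bS b0 ub.
  have [rq [irq erq]] := ex q qS q0 uq.
  have [||| r [pr sr hr]] := un (p :: rq) (ra ++ rb).
  - by move=> x; rewrite inE => /orP[/eqP->|/irq].
  - by move=> x; rewrite mem_cat => /orP[/ira|/irb].
  - by rewrite big_cons big_cat /= -era -erb -erq.
  have [u [[uS [u' [u'S eu]]] eup]] := hr 0%N isT; rewrite /= in eup.
  have cr : nth 0 r 0 \in ra ++ rb.
    by rewrite (perm_mem pr) mem_nth // -sr.
  have dv s : (forall x, x \in s -> irredS S x) -> nth 0 r 0 \in s ->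
      dvdA (fun x => x \in S) p (\prod_(x <- s) x).
    move=> irs cs; rewrite (big_rem _ cs) /=; exists (u' * \prod_(y <- rem (nth 0 r 0) s) y).
    split; last by rewrite eup; transitivity ((u * u') * (nth 0 r 0 * \prod_(y <- rem (nth 0 r 0) s) y));
      [rewrite eu mul1r | ring].
    apply: (A_M HS) => //; apply: (A_prod HS) => x /mem_rem/irs; by case.
  move: cr; rewrite mem_cat => /orP[] cr; [left; rewrite era | right; rewrite erb]; exact: dv.
move=> x xS x0; case: (classic (unitS S x)) => ux.
  by exists x, [::]; rewrite big_nil mulr1.
have [r [ir er]] := ex x xS x0 ux; exists 1, r; split; first exact: unitA1.
  by move=> p /ir/irp.
by rewrite mul1r.
Qed.

Lemma factorial_image (D E : idomainType) (phi : {rmorphism D -> E}) (A : D -> Prop) :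
  injective phi -> subringA A -> factorialA A ->
  let B y := exists x, A x /\ y = phi x in subringA B /\ factorialA B.
Proof.
move=> inj HA fact B.
have AB x : A x -> B (phi x) by exists x.
have dv x y : dvdA B (phi x) (phi y) <-> dvdA A x y.
  split=> [[_ [[q [Aq ->]]]]|[q [Aq ->]]].
    by rewrite -rmorphM => /inj; exists q.
  by exists (phi q); split; [exact: AB | rewrite rmorphM].
have un x : unitA A x <-> unitA B (phi x).
  split=> [[Ax [y [Ay e]]]|[[x' [Ax' /inj ->]] [_ [[y [Ay ->]]]]]].
    by split; [exact: AB | exists (phi y); rewrite -rmorphM e rmorph1; split=> //; exact: AB].
  by rewrite -rmorphM -(rmorph1 phi) => /inj e; split=> //; exists y.
split; first split.
- by exists 1; rewrite rmorph1; split=> //; case: HA.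
- by move=> _ _ [x [Ax ->]] [y [Ay ->]]; exists (x - y); rewrite rmorphB; split=> //; exact: A_B.
- by move=> _ _ [x [Ax ->]] [y [Ay ->]]; exists (x * y); rewrite rmorphM; split=> //; exact: A_M.
move=> _ [x [Ax ->]] x0.
have [|u [r [uu hr er]]] := fact x Ax; first by apply: contra_neq x0 => ->; rewrite rmorph0.
exists (phi u), (map phi r); split; first exact/un.
  move=> _ /mapP[p /hr[Ap p0 pu pd] ->]; split.
  - exact: AB.
  - by rewrite -(rmorph0 phi) (inj_eq inj).
  - by move/un.
  by move=> _ _ [a [Aa ->]] [b [Ab ->]]; rewrite -rmorphM => /dv/(pd _ _ Aa Ab)[/dv|/dv]; [left|right].
by rewrite big_map er rmorphM rmorph_prod.
Qed.

(** * Gauss' lemma *)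

Section Gauss.
Variables (K : fieldType) (S : {pred K}).
Let AS : K -> Prop := fun x => x \in S.
Hypothesis HS : subringA AS.
Hypothesis fact : factorialA AS.
Hypothesis fracS : forall x : K, exists n d, [/\ n \in S, d \in S, d != 0 & x = n / d].

Lemma polyS_subring : subringA (polyS S).
Proof.
have S0 : 0 \in S := A_0 HS.
split.
- by move=> i; rewrite coef1; case: (i == 0%N) => //=; exact: (A_1 HS).
- by move=> f g hf hg i; rewrite coefB; apply: (A_B HS); [exact: hf | exact: hg].
move=> f g hf hg i; rewrite coefM; apply: (big_ind (fun x => x \in S)) => // [|j _]; first exact: (A_D HS).
by apply: (A_M HS); [exact: hf | exact: hg].
Qed.

Lemma polySZ c f : c \in S -> polyS S f -> polyS S (c *: f).
Proof. by move=> cS fS i; rewrite coefZ; apply: (A_M HS); last exact: fS. Qed.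

Lemma polySC c : c \in S -> polyS S c%:P.
Proof. by move=> cS i; rewrite coefC; case: (i == 0%N) => //; exact: (A_0 HS). Qed.

Lemma polyS_clear f : exists n, [/\ n \in S, n != 0 & polyS S (n *: f)].
Proof.
elim/poly_ind: f => [|f c [n [nS n0 fS]]].
  exists 1; rewrite scale1r oner_eq0; split=> //; first exact: (A_1 HS).
  by move=> i; rewrite coef0; exact: (A_0 HS).
have [a [d [aS dS d0 ec]]] := fracS c.
exists (n * d); split; [exact: (A_M HS) | exact: mulf_neq0 |] => -[|i].
  rewrite coefZ coefD coefMX coefC /= add0r ec.
  have -> : n * d * (a / d) = n * a by field.
  exact: (A_M HS).
rewrite coefZ coefD coefMX coefC /= addr0 mulrAC -coefZ mulrC; apply: (A_M HS) => //; exact: fS.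
Qed.

Definition cdvd (p : K) (f : {poly K}) := polyS S (p^-1 *: f).

Lemma cdvd_dvdA p f : p != 0 -> dvdA (polyS S) p%:P f <-> cdvd p f.
Proof.
move=> p0; split=> [[q [qS ->]]|h].
  by rewrite /cdvd mul_polyC scalerA mulVf // scale1r.
by exists (p^-1 *: f); split=> //; rewrite mul_polyC scalerA divff // scale1r.
Qed.

(** Double induction from the constant terms: [p] divides their product, hence one of them, and
    removing that term from its polynomial keeps the product divisible by [p]. This replaces
    reduction modulo [p]. *)
Lemma cdvd_mul p f g : primeA AS p -> polyS S f -> polyS S g -> cdvd p (f * g) ->
  cdvd p f \/ cdvd p g.
Proof.
move=> pp; have [pS p0 pu pd] := pp.
have cdc c : dvdA AS p c <-> p^-1 * c \in S.
  split=> [[q [qS ->]]|h]; first by rewrite mulKf.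
  by exists (p^-1 * c); rewrite mulVKf.
have pX h c : polyS S (h * 'X + c%:P) -> polyS S h /\ c \in S.
  move=> H; split=> [i|]; last by have := H 0%N; rewrite coefD coefMX coefC add0r.
  by have := H i.+1; rewrite coefD coefMX coefC addr0.
have cX h c : cdvd p (h * 'X + c%:P) <-> cdvd p h /\ p^-1 * c \in S.
  have e : p^-1 *: c%:P = (p^-1 * c)%:P by rewrite -mul_polyC -polyCM.
  rewrite /cdvd scalerDr scalerAl e; split; first exact: pX.
  by move=> [h1 h2] [|i]; rewrite coefD coefMX coefC /= ?add0r ?addr0.
elim/poly_ind: f g => [|f a IHf] g; first by rewrite mul0r; left.
elim/poly_ind: g => [|g b IHg]; first by rewrite mulr0; right.
move=> fS gS; have [f1 aS] := pX _ _ fS; have [g1 bS] := pX _ _ gS.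
move=> H; have : dvdA AS p (a * b).
  apply/cdc; have := H 0%N.
  by rewrite coefZ coef0M !coefD !coefMX !coefC /= !add0r.
have PS := polyS_subring.
case/(pd _ _ aS bS) => [/cdc da|/cdc db].
  case: (IHf (g * 'X + b%:P) f1 gS) => [|df|]; last by right.
    suff : cdvd p (f * (g * 'X + b%:P) * 'X + 0%:P) by case/cX.
    have -> : f * (g * 'X + b%:P) * 'X + 0%:P =
       (f * 'X + a%:P) * (g * 'X + b%:P) - a%:P * (g * 'X + b%:P) by rewrite polyC0; ring.
    rewrite /cdvd scalerBr; apply: (A_B PS) => //.
    by rewrite scalerAl -mul_polyC -polyCM; apply: (A_M PS) => //; exact: polySC.
  by left; apply/cX.
case: (IHg fS g1) => [|df|dg]; [|by left|by right; apply/cX].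
suff : cdvd p ((f * 'X + a%:P) * g * 'X + 0%:P) by case/cX.
have -> : (f * 'X + a%:P) * g * 'X + 0%:P =
   (f * 'X + a%:P) * (g * 'X + b%:P) - b%:P * (f * 'X + a%:P) by rewrite polyC0; ring.
rewrite /cdvd scalerBr; apply: (A_B PS) => //.
by rewrite scalerAl -mul_polyC -polyCM; apply: (A_M PS) => //; exact: polySC.
Qed.

Definition primitive f := forall p, primeA AS p -> ~ cdvd p f.

(** Let [n] clear the denominators of [q]. Each prime of [n] divides [d * (n *: q)] but not the
    primitive [d], so it divides [n *: q] and can be removed from [n]. *)
Lemma primitive_cofactor d q : polyS S d -> primitive d -> polyS S (d * q) -> polyS S q.
Proof.
move=> dS dp hS; have [n [nS n0 nq]] := polyS_clear q.
have [u [r [uu hr en]]] := fact nS n0.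
elim: r n nS n0 nq hr en => [|p r IH] n nS n0 nq hr en.
  have [uS [u' [u'S eu]]] := uu; rewrite big_nil mulr1 in en.
  have -> : q = u' *: (n *: q) by rewrite scalerA en mulrC eu scale1r.
  exact: polySZ.
have pp := hr p (mem_head _ _); have [pS p0 pu pd] := pp.
have hr' x : x \in r -> primeA AS x by move=> xr; apply: hr; rewrite inE xr orbT.
rewrite big_cons in en.
have mS : u * \prod_(j <- r) j \in S.
  by apply: (A_M HS); [case: uu | apply: (A_prod HS) => x /hr'[]].
apply: (IH (u * \prod_(j <- r) j)) => //.
  by apply: contra_neq n0 => h; rewrite en mulrCA h mulr0.
case: (cdvd_mul pp dS nq) => [|/(dp _ pp)//|].
  rewrite /cdvd -scalerAr scalerA en mulrCA mulKf //; exact: polySZ.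
by rewrite /cdvd scalerA en mulrCA mulKf.
Qed.

(** A prime dividing all coefficients divides the leading one, so extraction stops after at most as
    many steps as the leading coefficient has prime factors. *)
Lemma primitive_part f : polyS S f -> f != 0 ->
  exists c f0, [/\ c \in S, c != 0, polyS S f0, primitive f0 & f = c *: f0].
Proof.
move=> fS f0; have l0 : lead_coef f != 0 by rewrite lead_coef_eq0.
have [u [r [uu hr er]]] := fact (fS _) l0.
have [n sr] : exists n, (size r < n)%N by exists (size r).+1.
elim: n f fS f0 {l0} u r uu hr er sr => [//|n IH] f fS f0 u r uu hr er; rewrite ltnS => sr.
case: (classic (primitive f)) => [pf|npf].
  by exists 1, f; rewrite scale1r oner_eq0; split=> //; exact: (A_1 HS).
have [p [pp pf]] : exists p, primeA AS p /\ cdvd p f.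
  apply: NNPP => H; apply: npf => p pp pf; apply: H; by exists p.
have [pS p0 pu pd] := pp.
have ef : f = p *: (p^-1 *: f) by rewrite scalerA divff // scale1r.
have [|u' [r' [uu' hr' sr' e']]] := prime_cancel HS pp uu hr.
  by rewrite -er; exists (p^-1 * lead_coef f); rewrite mulVKf //; split=> //; have := pf (size f).-1; rewrite coefZ.
have f0' : p^-1 *: f != 0 by rewrite scaler_eq0 invr_eq0 negb_or p0.
have e'' : lead_coef (p^-1 *: f) = u' * \prod_(q <- r') q by rewrite lead_coefZ /lead_coef er e' mulKf.
have [|c [g [cS c0 gS gp eg]]] := IH (p^-1 *: f) pf f0' u' r' uu' hr' e''.
  by rewrite sr'.
exists (p * c), g; split=> //; [exact: (A_M HS) | exact: mulf_neq0 |].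
by rewrite ef eg scalerA.
Qed.

Lemma const_prime p : primeA AS p -> primeA (polyS S) p%:P.
Proof.
move=> pp; have [pS p0 pu pd] := pp; split.
- exact: polySC.
- by rewrite polyC_eq0.
- move=> [_ [q [qS e]]]; apply: pu; split=> //; exists q`_0; split; first exact: qS.
  by have := congr1 (fun f : {poly K} => f`_0) e; rewrite mul_polyC coefZ coef1.
move=> f g fS gS /(cdvd_dvdA _ p0)/(cdvd_mul pp fS gS)[] h; [left|right]; exact/cdvd_dvdA.
Qed.

(** A nonconstant primitive polynomial without factorization into nonconstant polynomials over [S]
    is irreducible over [K]: a factor over [K] can be rescaled to a primitive one over [S], and
    [primitive_cofactor] puts the cofactor in [S[t]]. It is thus prime in [K[t]], and the same lemma
    brings quotients back to [S[t]]. *)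
Lemma polyS_factorial : factorialA (polyS S).
Proof.
have PS := polyS_subring.
have unC u : unitA AS u -> unitA (polyS S) u%:P.
  move=> [uS [u' [u'S eu]]]; split; first exact: polySC.
  by exists u'%:P; rewrite -polyCM eu; split=> //; exact: polySC.
have H n (f : {poly K}) : (size f < n)%N -> polyS S f -> f != 0 -> primitive f ->
    exists u r, [/\ unitA (polyS S) u, forall p, p \in r -> primeA (polyS S) p & f = u * \prod_(p <- r) p].
  elim: n f => [//|n IH] f; rewrite ltnS => sf fS f0 pf.
  case: (leqP (size f) 1) => sf1.
    have ef := size1_polyC sf1; have c0 : f`_0 != 0 by move: f0; rewrite {1}ef polyC_eq0.
    have [u [r [uu hr er]]] := fact (fS 0%N) c0.
    case: r hr er => [|p r] hr er.
      by exists f, [::]; rewrite big_nil mulr1; split=> //; rewrite ef er big_nil mulr1; exact: unC.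
    have pp := hr p (mem_head _ _); case: (pf p pp).
    have [_ p0 _ _] := pp.
    rewrite /cdvd ef er big_cons mulrCA -mul_polyC -polyCM mulKf //; apply: polySC.
    by apply: (A_M HS); [case: uu | apply: (A_prod HS) => x xr; case: (hr x); rewrite // inE xr orbT].
  case: (classic (exists g h, [/\ polyS S g, polyS S h, (1 < size g)%N, (1 < size h)%N & f = g * h])).
    move=> [g [h [gS hS sg sh efgh]]].
    have g0 : g != 0 by rewrite -size_poly_gt0 ltnW.
    have h0 : h != 0 by rewrite -size_poly_gt0 ltnW.
    have sz : size f = (size g + size h).-1 by rewrite efgh size_mul.
    have pg : primitive g.
      by move=> p pp pg; apply: (pf p pp); rewrite /cdvd efgh scalerAl; exact: (A_M PS).
    have ph : primitive h.
      by move=> p pp ph; apply: (pf p pp); rewrite /cdvd efgh scalerAr; exact: (A_M PS).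
    have [|u [r [uu hr er]]] := IH g _ gS g0 pg; first by lia.
    have [|u' [r' [uu' hr' er']]] := IH h _ hS h0 ph; first by lia.
    exists (u * u'), (r ++ r'); split; first exact: unitAM.
      by move=> p; rewrite mem_cat => /orP[/hr|/hr'].
    by rewrite efgh er er' big_cat /=; ring.
  move=> NF; exists 1, [:: f]; rewrite big_seq1 mul1r; split=> //; first exact: unitA1.
  have irr : irreducible_poly f.
    split=> // q sq /dvdpP[h eh].
    have q0 : q != 0 by apply: contra_neq f0 => q0; rewrite eh q0 mulr0.
    have [m [mS m0 mq]] := polyS_clear q.
    have mq0 : m *: q != 0 by rewrite scaler_eq0 negb_or m0.
    have [c [q1 [cS c0 q1S q1p eq1]]] := primitive_part mq mq0.
    have eq : q = (m^-1 * c) *: q1 by rewrite -scalerA -eq1 scalerA mulVf // scale1r.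
    have k0 : m^-1 * c != 0 by rewrite mulf_neq0 ?invr_eq0.
    have ef : f = q1 * ((m^-1 * c) *: h) by rewrite eh eq -scalerAr scalerAl mulrC.
    have hS : polyS S ((m^-1 * c) *: h) by apply: (primitive_cofactor q1S q1p); rewrite -ef.
    have sq1 : size q1 = size q by rewrite eq size_scale.
    case: (leqP (size ((m^-1 * c) *: h)) 1) => sh; last first.
      case: NF; exists q1, ((m^-1 * c) *: h); split=> //; rewrite sq1.
      by rewrite ltn_neqAle eq_sym sq size_poly_gt0.
    rewrite size_scale // in sh; rewrite eh (size1_polyC sh) mul_polyC eqp_sym.
    apply: eqp_scale; apply: contra_neq f0 => h0.
    by rewrite eh (size1_polyC sh) h0 polyC0 mul0r.
  move=> _ /[!inE] /eqP ->; split=> //.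
    move=> [_ [g [gS eg]]]; have := congr1 (fun p : {poly K} => size p) eg.
    have g0 : g != 0 by apply: contra_eq_neq eg => ->; rewrite mulr0 eq_sym oner_eq0.
    rewrite /= size_mul // size_poly1; have : (0 < size g)%N by rewrite size_poly_gt0.
    by case: (size g) (size f) sf1 => [//|m] [|[|k]] //= _ _; rewrite addnS.
  move=> a b aS bS [s [sS es]].
  have : f %| a * b by rewrite es dvdp_mulr.
  case: (boolP (f %| a)) => [/dvdpP[q eq] _|na].
    left; exists q; rewrite mulrC; split=> //; apply: (primitive_cofactor fS pf); by rewrite mulrC -eq.
  rewrite Gauss_dvdpr; last first.
    rewrite coprimep_def; apply/negPn/negP => hs.
    case: irr => _ /(_ _ hs (dvdp_gcdl _ _)) /eqp_dvdl E.
    by move: na; rewrite -E dvdp_gcdr.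
  move=> /dvdpP[q eq].
  by right; exists q; rewrite mulrC; split=> //; apply: (primitive_cofactor fS pf); rewrite mulrC -eq.
move=> f fS f0; have [c [g [cS c0 gS gp eg]]] := primitive_part fS f0.
have g0 : g != 0 by apply: contra_neq f0 => g0; rewrite eg g0 scaler0.
have [u [r [uu hr er]]] := fact cS c0.
have [u' [r' [uu' hr' er']]] := H _ g (ltnSn _) gS g0 gp.
exists (u%:P * u'), (map polyC r ++ r'); split; first by apply: unitAM => //; exact: unC.
  move=> p; rewrite mem_cat => /orP[/mapP[x xr ->]|/hr'//]; exact: const_prime (hr x xr).
rewrite eg er er' big_cat big_map /= -mul_polyC polyCM.
have -> : (\prod_(p <- r) p)%:P = \prod_(j <- r) j%:P by rewrite rmorph_prod.
by ring.
Qed.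

End Gauss.

(** * Places of the field of rational functions *)

Lemma common_denominator (R : fieldType) (n a b c : R) :
  a != 0 -> b != 0 -> c != 0 -> n / a = n * b * c / (a * b * c).
Proof. by move=> a0 b0 c0; field; rewrite ?a0 ?b0 ?c0. Qed.

Section RationalFunctions.
Variables (K F : fieldType) (phi : {rmorphism {poly K} -> F}).
Hypothesis phi_inj : injective phi.
Hypothesis phi_frac : forall x : F, exists n d, d != 0 /\ x = phi n / phi d.

Lemma phi_eq0 f : (phi f == 0) = (f == 0).
Proof. by rewrite -(rmorph0 phi) (inj_eq phi_inj). Qed.

(** Viewing [K[t]] as polynomials over the full subring of [K] lets Gauss' lemma also give its
    factoriality. *)
Definition full_poly : {poly K} -> Prop := polyS (predT : {pred K}).
Definition polysF : F -> Prop := fun x => exists f, full_poly f /\ x = phi f.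

Lemma full_polyT f : full_poly f. Proof. by []. Qed.
Local Hint Resolve full_polyT : core.

Lemma full_poly_factorial : subringA full_poly /\ factorialA full_poly.
Proof.
have HK : subringA (fun x : K => x \in predT) by [].
have fK : factorialA (fun x : K => x \in predT).
  move=> x _ x0; exists x, [::]; rewrite big_nil mulr1; split=> //; split=> //.
  by exists x^-1; rewrite divff.
have fr (x : K) : exists n d, [/\ n \in predT, d \in predT, d != 0 & x = n / d].
  by exists x, 1; rewrite divr1 oner_eq0.
split; [exact: polyS_subring HK | exact: polyS_factorial HK fK fr].
Qed.

Lemma polysF_frac (x : F) : exists n d, [/\ polysF n, polysF d, d != 0 & x = n / d].
Proof.
have [n [d [d0 ->]]] := phi_frac x; exists (phi n), (phi d); split=> //; first by exists n.
  by exists d.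
by rewrite phi_eq0.
Qed.

Lemma dvdA_dvdp (p q : {poly K}) : dvdA full_poly p q <-> p %| q.
Proof.
split=> [[r [_ ->]]|/dvdpP[r ->]]; first exact: dvdp_mulr.
by exists r; rewrite mulrC.
Qed.

Lemma primeA_dvdpM p f g : primeA full_poly p -> p %| f * g -> p %| f \/ p %| g.
Proof. by move=> [_ _ _ pd] /dvdA_dvdp/(pd _ _ (full_polyT f) (full_polyT g))[]/dvdA_dvdp; [left|right]. Qed.

Lemma primeA_size p : primeA full_poly p -> (1 < size p)%N.
Proof.
move=> [_ p0 pu _]; rewrite ltnNge; apply/negP => sp; apply: pu; split=> //.
exists (p`_0)^-1%:P; split=> //; rewrite {1}(size1_polyC sp) -polyCM divff //.
by move: p0; rewrite {1}(size1_polyC sp) polyC_eq0.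
Qed.

Lemma ex_prime_divisor (f : {poly K}) : f != 0 -> size f != 1%N -> exists p, primeA full_poly p /\ p %| f.
Proof.
move=> f0 sf; have [HA fact] := full_poly_factorial.
have [u [r [uu hr er]]] := fact f (full_polyT f) f0; case: r hr er => [|p r] hr er.
  rewrite big_nil mulr1 in er; subst u; have [_ [g [_ e]]] := uu.
  by move: sf; rewrite -dvdp1 -e dvdp_mulr.
exists p; split; first by apply: hr; rewrite mem_head.
by rewrite er big_cons mulrCA dvdp_mulr.
Qed.

(** The normalization is left free, as only integrality and divisibility by [p] are used. *)
Definition padic (p : {poly K}) (v : absval F) :=
  (forall f, v (phi f) <= 1) /\ (forall f, v (phi f) < 1 <-> p %| f).

Lemma padic_absval p : primeA full_poly p -> exists v, padic p v.
Proof.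
move=> pp; have [HA fact] := full_poly_factorial.
have [HB factB] := factorial_image phi_inj HA fact.
have dv f g : dvdA polysF (phi f) (phi g) <-> f %| g.
  rewrite -dvdA_dvdp; split=> [[_ [[q [_ ->]]]]|[q [_ ->]]].
    by rewrite -rmorphM => /phi_inj->; exists q.
  by exists (phi q); rewrite rmorphM; split=> //; exists q.
have ppF : primeA polysF (phi p).
  have [_ p0 pu pd] := pp; split.
  - by exists p.
  - by rewrite phi_eq0.
  - move=> [_ [_ [[q [_ ->]]]]]; rewrite -rmorphM -(rmorph1 phi) => /phi_inj e.
    by apply: pu; split=> //; exists q.
  move=> _ _ [f [_ ->]] [g [_ ->]]; rewrite -rmorphM => /dv/(primeA_dvdpM pp)[]/dv; by [left|right].
have [v [v1 vd _]] := prime_absval HB polysF_frac factB ppF.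
exists v; split=> f; first by apply: v1; exists f.
by rewrite -dv; apply: vd; exists f.
Qed.

(** The place at infinity. *)
Definition degv (v : absval F) := forall f, f != 0 -> v (phi f) = 2 ^ ((size f).-1%:Z).

Lemma deg_absval : exists v, degv v.
Proof.
pose d (f : {poly K}) : rat := if f == 0 then 0 else 2 ^ ((size f).-1%:Z).
have [a ha] : exists a : F -> rat, forall x f, x = phi f -> a x = d f.
  apply: (functional_choice (fun x q => forall f, x = phi f -> q = d f)) => x.
  case: (classic (exists f, x = phi f)) => [[f ->]|H].
    by exists (d f) => g /phi_inj ->.
  by exists 0 => f e; case: H; exists f.
have [HA fact] := full_poly_factorial.
have [HB _] := factorial_image phi_inj HA fact.
have a0 : a 0 = 0 by rewrite (ha 0 0) ?rmorph0 // /d eqxx.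
have dge f : 0 <= d f by rewrite /d; case: eqP => // _; rewrite exprz_ge0.
have [|||v hv] := absval_extension HB polysF_frac a0.
- move=> _ [f [_ ->]]; rewrite phi_eq0 => f0; rewrite (ha _ f erefl) /d (negbTE f0).
  by eexists.
- move=> _ _ [f [_ ->]] [g [_ ->]]; rewrite -rmorphM !(ha _ _ erefl) /d mulf_eq0.
  have [->|f0] := eqVneq f 0; first by rewrite /= mul0r.
  have [->|g0] := eqVneq g 0; first by rewrite ?orbT /= mulr0.
  rewrite /= size_mul // -expfzDr //; congr (_ ^ _).
  have : (0 < size f)%N by rewrite size_poly_gt0.
  have : (0 < size g)%N by rewrite size_poly_gt0.
  by case: (size f) (size g) => [|m] [|n] // _ _; rewrite addSn addnS PoszD.
- move=> _ _ m [f [_ ->]] [g [_ ->]]; rewrite -rmorphD !(ha _ _ erefl) => hf hg.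
  have m0 : 0 <= m by exact: le_trans (dge f) hf.
  have dle n (h : {poly K}) : (size h <= n)%N -> 0 <= m -> (forall k, (n = k.+1)%N -> (2 : rat) ^ (k%:Z) <= m) -> d h <= m.
    rewrite /d; case: eqP => // /eqP h0 sh _ H.
    have sp : (0 < size h)%N by rewrite size_poly_gt0.
    have [k ek] : exists k, n = k.+1 by exists n.-1; rewrite prednK // (leq_trans sp).
    apply: le_trans (H k ek); rewrite ler_eXz2l // lez_nat; lia.
  apply: (dle _ _ (size_polyD f g)) => // k; rewrite /maxn; case: ifP => _ e.
    by move: hg; rewrite /d e; case: eqP => // g0; move: e; rewrite g0 size_poly0.
  by move: hf; rewrite /d e; case: eqP => // f0; move: e; rewrite f0 size_poly0.
exists v => f f0; rewrite hv; last by exists f.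
by rewrite (ha _ f erefl) /d (negbTE f0).
Qed.

Hypothesis two0 : (2 : K) != 0.

Lemma two_poly : (2 : {poly K}) = 2%:P. Proof. by rewrite -polyC_natr. Qed.

Lemma two0F : (2 : F) != 0.
Proof. by rewrite -(rmorph_nat phi) phi_eq0 two_poly polyC_eq0. Qed.

Lemma padic2 p v : primeA full_poly p -> padic p v -> v 2 = 1.
Proof.
move=> pp [v1 vd]; apply/eqP; rewrite -(rmorph_nat phi) eq_le v1 leNgt; apply/negP => /vd.
rewrite two_poly => /dvdp_leq; rewrite polyC_eq0 two0 size_polyC two0 => /(_ isT).
by rewrite leqNgt primeA_size.
Qed.

Lemma degv2 v : degv v -> v 2 = 1.
Proof.
by move=> hv; rewrite -(rmorph_nat phi) hv two_poly ?polyC_eq0 // size_polyC two0.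
Qed.

Definition coprime3 (c1 c2 c3 : {poly K}) := forall d, d %| c1 -> d %| c2 -> d %| c3 -> d %= 1.

Lemma coprime3_coprime c1 c2 c3 : coprime3 c1 c2 c3 -> coprimep c1 (gcdp c2 c3).
Proof.
move=> h; apply/coprimepP => d d1; rewrite dvdp_gcd => /andP[d2 d3]; exact: h.
Qed.

Lemma coprime3_rep (s1 s2 s3 : F) : s1 != 0 ->
  exists h c1 c2 c3, [/\ h != 0, coprime3 c1 c2 c3, s1 = h * phi c1, s2 = h * phi c2 & s3 = h * phi c3].
Proof.
move=> s10.
have [n1 [d1 [d10 e1]]] := phi_frac s1; have [n2 [d2 [d20 e2]]] := phi_frac s2.
have [n3 [d3 [d30 e3]]] := phi_frac s3.
have n10 : n1 != 0 by apply: contra_neq s10 => n0; rewrite e1 n0 rmorph0 mul0r.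
have [f1 f2 f3] : [/\ phi d1 != 0, phi d2 != 0 & phi d3 != 0] by rewrite !phi_eq0.
have F1 : s1 = phi (n1 * d2 * d3) / (phi d1 * phi d2 * phi d3).
  by rewrite e1 !rmorphM (common_denominator (phi n1) f1 f2 f3).
have F2 : s2 = phi (n2 * d1 * d3) / (phi d1 * phi d2 * phi d3).
  by rewrite e2 !rmorphM [phi d1 * phi d2]mulrC (common_denominator (phi n2) f2 f1 f3).
have F3 : s3 = phi (n3 * d1 * d2) / (phi d1 * phi d2 * phi d3).
  by rewrite e3 !rmorphM [_ * phi d3]mulrC mulrA (common_denominator (phi n3) f3 f1 f2).
have N10 : n1 * d2 * d3 != 0 := mulf_neq0 (mulf_neq0 n10 d20) d30.
have D0 : phi d1 * phi d2 * phi d3 != 0 := mulf_neq0 (mulf_neq0 f1 f2) f3.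
move: (n1 * d2 * d3) (n2 * d1 * d3) (n3 * d1 * d2) (phi d1 * phi d2 * phi d3) F1 F2 F3 N10 D0.
move=> {e1 e2 e3 f1 f2 f3 d10 d20 d30 n10 d1 d2 d3 n1 n2 n3} N1 N2 N3 D F1 F2 F3 N10 D0.
have [g [g0 gd1 gd2 gd3 gm]] : exists g, [/\ g != 0, g %| N1, g %| N2, g %| N3 &
    forall d, d %| N1 -> d %| N2 -> d %| N3 -> d %| g].
  exists (gcdp N1 (gcdp N2 N3)); split.
  - by rewrite gcdp_eq0 negb_and N10.
  - exact: dvdp_gcdl.
  - by apply: dvdp_trans (dvdp_gcdr _ _) _; exact: dvdp_gcdl.
  - by apply: dvdp_trans (dvdp_gcdr _ _) _; exact: dvdp_gcdr.
  by move=> d h1 h2 h3; rewrite !dvdp_gcd h1 h2 h3.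
have [q1 eq1] := dvdpP _ _ gd1; have [q2 eq2] := dvdpP _ _ gd2; have [q3 eq3] := dvdpP _ _ gd3.
have E N q s : N = q * g -> s = phi N / D -> s = phi g / D * phi q.
  by move=> -> ->; rewrite rmorphM -mulrA [LHS]mulrC.
exists (phi g / D), q1, q2, q3.
split; [|move=> d h1 h2 h3| exact: E eq1 F1 | exact: E eq2 F2 | exact: E eq3 F3].
  by apply: (mulf_neq0 _ (invr_neq0 D0)); rewrite phi_eq0.
have : d * g %| g by apply: gm; rewrite ?eq1 ?eq2 ?eq3 dvdp_mul2r.
by rewrite -{2}(mul1r g) dvdp_mul2r // dvdp1 -size_poly_eq1.
Qed.

(** The degree does not depend on the coprime representative: cross-multiplying with a fixed one
    shows that [c1] divides [c2 * n1] and [c3 * n1], hence [n1], because [c1] is coprime to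
    [gcdp c2 c3]. *)
Lemma coprime3_bound (s1 s2 s3 : F) : s1 != 0 -> s2 != 0 -> s3 != 0 ->
  exists T, forall h c1 c2 c3, coprime3 c1 c2 c3 -> s1 = h * phi c1 -> s2 = h * phi c2 -> s3 = h * phi c3 ->
    [/\ (size c1 <= T)%N, (size c2 <= T)%N & (size c3 <= T)%N].
Proof.
move=> s10 s20 s30; have [k [n1 [n2 [n3 [k0 np e1 e2 e3]]]]] := coprime3_rep s2 s3 s10.
exists (size n1 + size n2 + size n3)%N => h c1 c2 c3 cp f1 f2 f3.
have nz s n : s != 0 -> s = k * phi n -> n != 0.
  by move=> s0 es; apply: contra_neq s0 => n0; rewrite es n0 rmorph0 mulr0.
have n10 := nz _ _ s10 e1; have n20 := nz _ _ s20 e2; have n30 := nz _ _ s30 e3.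
have X s s' n n' c c' : s = k * phi n -> s' = k * phi n' -> s = h * phi c -> s' = h * phi c' ->
   s != 0 -> c * n' = c' * n.
  move=> a1 a2 b1 b2 s0; have h0 : h != 0 by apply: contra_neq s0 => h0; rewrite b1 h0 mul0r.
  apply: phi_inj; rewrite !rmorphM; apply: (mulfI (mulf_neq0 h0 k0)).
  transitivity (s * s'); first by rewrite b1 a2; ring.
  by rewrite b2 a1; ring.
have Y a b c n m l : coprime3 a b c -> a * m = b * n -> a * l = c * n -> n != 0 -> (size a <= size n)%N.
  move=> ap x1 x2 n0; apply: dvdp_leq => //.
  have : a %| gcdp (b * n) (c * n) by rewrite dvdp_gcd -x1 -x2 !dvdp_mulr.
  by rewrite (eqp_dvdr _ (gcdp_mul2r _ _ _)) Gauss_dvdpr //; exact: coprime3_coprime.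
have cp2 : coprime3 c2 c1 c3 by move=> d h2 h1; exact: cp.
have cp3 : coprime3 c3 c1 c2 by move=> d h3 h1 h2; exact: cp.
have b1 := Y _ _ _ _ _ _ cp (X _ _ _ _ _ _ e1 e2 f1 f2 s10) (X _ _ _ _ _ _ e1 e3 f1 f3 s10) n10.
have b2 := Y _ _ _ _ _ _ cp2 (X _ _ _ _ _ _ e2 e1 f2 f1 s20) (X _ _ _ _ _ _ e2 e3 f2 f3 s20) n20.
have b3 := Y _ _ _ _ _ _ cp3 (X _ _ _ _ _ _ e3 e1 f3 f1 s30) (X _ _ _ _ _ _ e3 e2 f3 f2 s30) n30.
split; [apply: leq_trans b1 _ | apply: leq_trans b2 _ | apply: leq_trans b3 _].
- by rewrite -addnA leq_addr.
- by rewrite addnAC leq_addl.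
exact: leq_addl.
Qed.

End RationalFunctions.

(** * Growth of the degree under doubling *)

Section Growth.
Variables (K F : fieldType) (phi : {rmorphism {poly K} -> F}).
Hypothesis phi_inj : injective phi.
Hypothesis phi_frac : forall x : F, exists n d, d != 0 /\ x = phi n / phi d.
Hypothesis two0 : (2 : K) != 0.

(** A common prime of [c1] and [c2] does not divide [c3], so the triple is bad there. By [bad_sqr]
    this prime divides [dl], hence [disc]; it is then associate to a member of [L], where the triple
    is good. *)
Lemma coprime_of_good (L : seq {poly K}) (u disc : {poly K}) (a b c h : F) (c1 c2 c3 dl dl' : {poly K}) :
  unitA (@full_poly K) u -> (forall p, p \in L -> primeA (@full_poly K) p) -> disc = u * \prod_(p <- L) p ->
  h != 0 -> c1 != 0 -> coprime3 c1 c2 c3 -> a = h * phi c1 -> b = h * phi c2 -> c = h * phi c3 ->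
  a ^+ 2 - b ^+ 2 = phi dl -> a ^+ 2 - c ^+ 2 = phi dl' -> dl %| disc ->
  (forall p, p \in L -> exists v, padic phi p v /\ ~~ bad v a b c) -> coprimep c1 c2.
Proof.
move=> uu hL ed h0 c10 cp ea eb ec eab eac dd good.
have g0 : gcdp c1 c2 != 0 by rewrite gcdp_eq0 negb_and c10.
rewrite /coprimep; apply/negPn/negP => sg.
have [p [pp]] := ex_prime_divisor g0 sg; rewrite dvdp_gcd => /andP[p1 p2].
have B q v : primeA (@full_poly K) q -> padic phi q v -> q %| c1 -> q %| c2 -> bad v a b c.
  move=> pq [v1 vd] q1 q2.
  have q3 : ~~ (q %| c3).
    apply/negP => q3; have := cp _ q1 q2 q3; rewrite -size_poly_eq1.
    by have := primeA_size pq; rewrite ltn_neqAle eq_sym => /andP[/negbTE ->].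
  have e3 : v (phi c3) = 1.
    by apply/eqP; rewrite eq_le v1 leNgt; apply/negP => /vd; exact/negP.
  have hp := av_gt0 v h0.
  by rewrite /bad ea eb ec !avM e3 mulr1; apply/andP; split;
     rewrite -[ltRHS]mulr1 ltr_pM2l //; apply/vd.
have [v pv] := padic_absval phi_inj phi_frac pp.
have [l1 _] := bad_sqr (B _ _ pp pv p1 p2).
have pd : p %| disc.
  apply: dvdp_trans dd; apply/pv.2; rewrite -eab; apply: lt_le_trans l1 _.
  by rewrite eac; exact: pv.1.
have [HA _] := full_poly_factorial K.
have [|q [k [qL [_ [k' [_ ek]]] eq]]] := prime_dvd_prod HA pp uu hL.
  by apply/dvdA_dvdp; rewrite -ed.
have qp : q %| p.
  by apply/dvdpP; exists k'; rewrite eq mulrC -mulrA ek mulr1.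
have [w [pw /negP]] := good q qL; apply.
by apply: (B q) => //; [exact: hL | exact: dvdp_trans qp p1 | exact: dvdp_trans qp p2].
Qed.

Lemma size_of_good (v : absval F) (a b c h : F) (c1 c2 c3 : {poly K}) :
  degv phi v -> h != 0 -> c1 != 0 -> c2 != 0 -> c3 != 0 ->
  a = h * phi c1 -> b = h * phi c2 -> c = h * phi c3 ->
  ~~ bad v a b c -> ~~ ((size c1 < size c3) && (size c2 < size c3))%N.
Proof.
move=> hv h0 c10 c20 c30 -> -> ->; apply: contra => /andP[h1 h2].
have hp := av_gt0 v h0.
rewrite /bad !avM !ltr_pM2l // !hv // !exp2z_lt.
have : (0 < size c1)%N by rewrite size_poly_gt0.
have : (0 < size c2)%N by rewrite size_poly_gt0.
move: h1 h2; move: (size c1) (size c2) (size c3) => x y z; lia.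
Qed.

(* [dbl] in projective coordinates, as a quartic map. *)
Definition dblp (c1 c2 c3 : {poly K}) :=
  c1 ^+ 2 * c2 ^+ 2 + c1 ^+ 2 * c3 ^+ 2 - c2 ^+ 2 * c3 ^+ 2.

Lemma dbl_rep (h : F) c1 c2 c3 : h != 0 -> c1 != 0 -> c2 != 0 -> c3 != 0 ->
  dbl (h * phi c1) (h * phi c2) (h * phi c3) =
  h / (2 * phi c1 * phi c2 * phi c3) * phi (dblp c1 c2 c3).
Proof.
move=> h0 c10 c20 c30; rewrite /dbl /dblp rmorphB rmorphD !rmorphM.
have t0 := two0F phi_inj two0.
have [f1 f2 f3] : [/\ phi c1 != 0, phi c2 != 0 & phi c3 != 0] by rewrite !(phi_eq0 phi_inj).
by field; rewrite ?t0 ?h0 ?f1 ?f2 ?f3.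
Qed.

(** Pairwise sums of the quartic forms are [2 * c_i ^+ 2 * c_j ^+ 2], so the base points of the
    quartic map are the three coordinate points. Pairwise coprimality keeps away from them at every
    prime. *)
Lemma dblp_coprime3 c1 c2 c3 : c1 != 0 -> c2 != 0 -> c3 != 0 ->
  coprimep c1 c2 -> coprimep c1 c3 -> coprimep c2 c3 ->
  coprime3 (dblp c1 c2 c3) (dblp c2 c1 c3) (dblp c3 c1 c2).
Proof.
move=> c10 c20 c30 c12 c13 c23 d d1 d2 d3.
have t2 f : d %| 2 * f -> d %| f by rewrite two_poly mul_polyC dvdpZr.
have e12 : d %| c1 ^+ 2 * c2 ^+ 2.
  apply: t2; have -> : 2 * (c1 ^+ 2 * c2 ^+ 2) = dblp c1 c2 c3 + dblp c2 c1 c3 by rewrite /dblp; ring.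
  exact: dvdp_add.
have e13 : d %| c1 ^+ 2 * c3 ^+ 2.
  apply: t2; have -> : 2 * (c1 ^+ 2 * c3 ^+ 2) = dblp c1 c2 c3 + dblp c3 c1 c2 by rewrite /dblp; ring.
  exact: dvdp_add.
have e23 : d %| c2 ^+ 2 * c3 ^+ 2.
  apply: t2; have -> : 2 * (c2 ^+ 2 * c3 ^+ 2) = dblp c2 c1 c3 + dblp c3 c1 c2 by rewrite /dblp; ring.
  exact: dvdp_add.
have d0 : d != 0.
  by apply: contraTneq e12 => ->; rewrite dvd0p mulf_neq0 ?expf_neq0.
rewrite -size_poly_eq1; apply/negPn/negP => sd.
have [p [pp pd]] := ex_prime_divisor d0 sd.
have S f : p %| f ^+ 2 -> p %| f by rewrite expr2 => /(primeA_dvdpM pp)[].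
have N f g : coprimep f g -> p %| f -> p %| g -> False.
  move=> /coprimepP H pf pg; have := H _ pf pg; rewrite -size_poly_eq1.
  by have := primeA_size pp; rewrite ltn_neqAle eq_sym => /andP[/negbTE ->].
case: (primeA_dvdpM pp (dvdp_trans pd e12)) => /S p1;
case: (primeA_dvdpM pp (dvdp_trans pd e13)) => /S p2;
case: (primeA_dvdpM pp (dvdp_trans pd e23)) => /S p3;
by [exact: N c12 p1 p3 | exact: N c13 p1 p3 | exact: N c12 p2 p1 | exact: N c13 p1 p2 |
    exact: N c23 p1 p2 | exact: N c12 p2 p3 | exact: N c13 p2 p3].
Qed.

Definition some_size_gt (e : nat) (c1 c2 c3 : {poly K}) :=
  [|| e < size c1, e < size c2 | e < size c3]%N.

(** The largest size is attained at least twice, say by [c_i] and [c_j]; the sum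
    [2 * c_i ^+ 2 * c_j ^+ 2] of two of the forms then has degree at least [4 * e], hence so does
    one of them. Here size above [e] means degree at least [e]. *)
Lemma dblp_size e (c1 c2 c3 : {poly K}) : c1 != 0 -> c2 != 0 -> c3 != 0 ->
  ~~ ((size c1 < size c3) && (size c2 < size c3))%N ->
  ~~ ((size c1 < size c2) && (size c3 < size c2))%N ->
  ~~ ((size c2 < size c1) && (size c3 < size c1))%N ->
  some_size_gt e c1 c2 c3 ->
  some_size_gt (4 * e) (dblp c1 c2 c3) (dblp c2 c1 c3) (dblp c3 c1 c2).
Proof.
move=> c10 c20 c30 b3 b2 b1 he.
have sz (f g : {poly K}) : f != 0 -> g != 0 -> (e < size f)%N -> (e < size g)%N ->
    (4 * e < size (2 * (f ^+ 2 * g ^+ 2))%R)%N.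
  move=> f0 g0; rewrite two_poly mul_polyC size_scale // !expr2 !size_mul ?mulf_neq0 //.
  by move: (size f) (size g) => x y; lia.
have sD (f g : {poly K}) : (4 * e < size (f + g)%R)%N -> (4 * e < size f)%N || (4 * e < size g)%N.
  by move=> H; rewrite -leq_max; exact: leq_trans H (size_polyD _ _).
have E12 : dblp c1 c2 c3 + dblp c2 c1 c3 = 2 * (c1 ^+ 2 * c2 ^+ 2) by rewrite /dblp; ring.
have E13 : dblp c1 c2 c3 + dblp c3 c1 c2 = 2 * (c1 ^+ 2 * c3 ^+ 2) by rewrite /dblp; ring.
have E23 : dblp c2 c1 c3 + dblp c3 c1 c2 = 2 * (c2 ^+ 2 * c3 ^+ 2) by rewrite /dblp; ring.
have : [|| (e < size c1) && (e < size c2), (e < size c1) && (e < size c3)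
         | (e < size c2) && (e < size c3)]%N.
  move: he b1 b2 b3; rewrite /some_size_gt; move: (size c1) (size c2) (size c3) => x y z; lia.
rewrite /some_size_gt => /or3P[]/andP[h h'].
- have := sz _ _ c10 c20 h h'; rewrite -E12 => /sD/orP[]->; by rewrite ?orbT.
- have := sz _ _ c10 c30 h h'; rewrite -E13 => /sD/orP[]->; by rewrite ?orbT.
have := sz _ _ c20 c30 h h'; rewrite -E23 => /sD/orP[]->; by rewrite ?orbT.
Qed.

Section Sequence.
Variables (r1 r2 r3 : nat -> F) (al be : {poly K}).
Hypotheses (r10 : forall n, r1 n != 0) (r20 : forall n, r2 n != 0) (r30 : forall n, r3 n != 0).
Hypotheses (hal : forall n, r2 n ^+ 2 = r1 n ^+ 2 - phi al)
  (hbe : forall n, r3 n ^+ 2 = r1 n ^+ 2 - phi be).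
Hypotheses (al0 : al != 0) (be0 : be != 0) (alb : al != be).
Hypothesis w0 : forall n m, (n < m)%N -> r1 m ^+ 2 - r1 n ^+ 2 != 0.
Hypotheses (d1 : forall n, r1 n = dbl (r1 n.+1) (r2 n.+1) (r3 n.+1))
  (d2 : forall n, r2 n = dbl (r2 n.+1) (r1 n.+1) (r3 n.+1))
  (d3 : forall n, r3 n = dbl (r3 n.+1) (r1 n.+1) (r2 n.+1)).
Let s1 := sdif1 r1 r2 r3.
Let s2 := sdif2 r1 r2 r3.
Let s3 := sdif3 r1 r2 r3.
Hypotheses (s10 : forall n m, (n < m)%N -> s1 n m != 0)
  (s20 : forall n m, (n < m)%N -> s2 n m != 0) (s30 : forall n m, (n < m)%N -> s3 n m != 0).
Hypothesis nonconst : forall n m h (k1 k2 k3 : K), (n < m)%N ->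
  s1 n m = h * phi k1%:P -> s2 n m = h * phi k2%:P -> s3 n m = h * phi k3%:P -> False.

Definition allgood (v : absval F) n m :=
  [/\ ~~ bad v (s1 n m) (s2 n m) (s3 n m), ~~ bad v (s1 n m) (s3 n m) (s2 n m)
    & ~~ bad v (s2 n m) (s3 n m) (s1 n m)].

Let t0 := two0F phi_inj two0.

Let h12 n m : r1 n ^+ 2 - r1 m ^+ 2 = r2 n ^+ 2 - r2 m ^+ 2.
Proof. by rewrite !hal; ring. Qed.
Let h13 n m : r1 n ^+ 2 - r1 m ^+ 2 = r3 n ^+ 2 - r3 m ^+ 2.
Proof. by rewrite !hbe; ring. Qed.

Lemma allgood_colorable (v : absval F) : v 2 = 1 -> colorable (allgood v).
Proof.
move=> v2.
have A0 : phi al != 0 by rewrite (phi_eq0 phi_inj).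
have B0 : phi be != 0 by rewrite (phi_eq0 phi_inj).
have C0 : phi (be - al) != 0 by rewrite (phi_eq0 phi_inj) subr_eq0 eq_sym.
have NA0 : - phi al != 0 by rewrite oppr_eq0.
have w2 n m : (n < m)%N -> r2 m ^+ 2 - r2 n ^+ 2 != 0.
  by move=> nm; rewrite -h12; exact: w0.
have d1' n : r1 n = dbl (r1 n.+1) (r3 n.+1) (r2 n.+1) by rewrite dblC.
have d2' n : r2 n = dbl (r2 n.+1) (r3 n.+1) (r1 n.+1) by rewrite dblC.
have d3' n : r3 n = dbl (r3 n.+1) (r2 n.+1) (r1 n.+1) by rewrite dblC.
(* Starting the triple at [r2] replaces the parameters [al], [be] by [be - al] and [- al]. *)
have q1 n : r3 n ^+ 2 = r2 n ^+ 2 - phi (be - al) by rewrite hal hbe rmorphB; ring.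
have q2 n : r1 n ^+ 2 = r2 n ^+ 2 - (- phi al) by rewrite hal; ring.
have E1 n m : sdif1 r1 r3 r2 n m = s1 n m by rewrite /sdif1 difC.
have E2 n m : sdif1 r2 r3 r1 n m = s2 n m by rewrite /sdif1 difC.
have E3 n m : sdif2 r2 r3 r1 n m = s3 n m by rewrite /sdif2 difC.
have C1 : colorable (fun n m => ~~ bad v (s1 n m) (s2 n m) (s3 n m)).
  exact: (bad_colorable t0 v2 r10 r20 r30 hal hbe).
have C2 : colorable (fun n m => ~~ bad v (s1 n m) (s3 n m) (s2 n m)).
  have [T [col H]] := @bad_colorable _ v t0 v2 r1 r3 r2 _ _ r10 r30 r20 hbe hal B0 A0 w0 d1' d3 d2
    (fun n m nm => eq_ind_r (fun x => x != 0) (s10 nm) (E1 n m)) s30 s20.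
  by exists T, col => n m nm e; have := H n m nm e; rewrite E1.
have C3 : colorable (fun n m => ~~ bad v (s2 n m) (s3 n m) (s1 n m)).
  have [T [col H]] := @bad_colorable _ v t0 v2 r2 r3 r1 _ _ r20 r30 r10 q1 q2 C0 NA0 w2 d2' d3' d1
    (fun n m nm => eq_ind_r (fun x => x != 0) (s20 nm) (E2 n m))
    (fun n m nm => eq_ind_r (fun x => x != 0) (s30 nm) (E3 n m)) s10.
  by exists T, col => n m nm e; have := H n m nm e; rewrite E2 E3.
have [T [col H]] := colorable_and C1 (colorable_and C2 C3).
by exists T, col => n m nm e; have [? [? ?]] := H n m nm e.
Qed.

Let sd1 n m (nm : (n < m)%N) : s1 n m = dbl (s1 n.+1 m.+1) (s2 n.+1 m.+1) (s3 n.+1 m.+1).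
Proof. exact: (sdif1_dbl t0 r10 r20 r30 hal hbe w0 d1 d2 d3 s10 s20 s30 nm). Qed.
Let sd2 n m (nm : (n < m)%N) : s2 n m = dbl (s2 n.+1 m.+1) (s1 n.+1 m.+1) (s3 n.+1 m.+1).
Proof. exact: (sdif2_dbl t0 r10 r20 r30 hal hbe w0 d1 d2 d3 s10 s20 s30 nm). Qed.
Let sd3 n m (nm : (n < m)%N) : s3 n m = dbl (s3 n.+1 m.+1) (s1 n.+1 m.+1) (s2 n.+1 m.+1).
Proof. exact: (sdif3_dbl t0 r10 r20 r30 hal hbe w0 d1 d2 d3 s10 s20 s30 nm). Qed.

(** Goodness passes from a difference to its double, so a single good pair far out controls all the
    pairs below it with the same gap. *)
Lemma allgood_descends v n m : (n < m)%N -> allgood v n.+1 m.+1 -> allgood v n m.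
Proof.
move=> nm [g1 g2 g3].
have [z1 z2 z3] : [/\ s1 n.+1 m.+1 != 0, s2 n.+1 m.+1 != 0 & s3 n.+1 m.+1 != 0].
  by split; [exact: s10 | exact: s20 | exact: s30].
rewrite /allgood (sd1 nm) (sd2 nm) (sd3 nm); split.
- by apply: contra g1; exact: bad_dbl.
- by apply: contra g2; rewrite [dbl (s1 _ _) _ _]dblC; exact: bad_dbl.
apply: contra g3; rewrite [dbl (s2 _ _) _ _]dblC [dbl (s3 _ _) _ _]dblC; exact: bad_dbl.
Qed.

Lemma no_halving_sequence : False.
Proof.
pose disc := al * be * (be - al).
have disc0 : disc != 0 by rewrite !mulf_neq0 // subr_eq0 eq_sym.
have [HA fact] := full_poly_factorial K.
have [u [L [uu hL ed]]] := fact disc (full_polyT disc) disc0.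
pose good n m := (forall p, p \in L -> exists v, padic phi p v /\ allgood v n m) /\
  (exists v, degv phi v /\ allgood v n m).
have gcol : colorable good.
  apply: colorable_and.
    apply: (@colorable_all _ L (fun p n m => exists v, padic phi p v /\ allgood v n m)) => p pL.
    have [v pv] := padic_absval phi_inj phi_frac (hL p pL).
    have [T [col H]] := allgood_colorable (padic2 two0 (hL p pL) pv).
    by exists T, col => n m nm e; exists v; split=> //; exact: H.
  have [v dv] := deg_absval phi_inj phi_frac; have [T [col H]] := allgood_colorable (degv2 two0 dv).
  by exists T, col => n m nm e; exists v; split=> //; exact: H.
have gdesc n m : (n < m)%N -> good n.+1 m.+1 -> good n m.
  move=> nm [g1 [v [dv g2]]]; split.
    by move=> p /g1[w [pw gw]]; exists w; split=> //; exact: allgood_descends.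
  by exists v; split=> //; exact: allgood_descends.
have [M HM] := colorable_pigeonhole gcol.
(* One degree bound for the finitely many differences [P_0 - P_k], fixed before [N]. *)
have [T HT] : exists T, forall k, (0 < k <= M)%N -> forall h c1 c2 c3, coprime3 c1 c2 c3 ->
    s1 0 k = h * phi c1 -> s2 0 k = h * phi c2 -> s3 0 k = h * phi c3 ->
    [/\ (size c1 <= T)%N, (size c2 <= T)%N & (size c3 <= T)%N].
  elim: (M) => [|m [T IH]]; first by exists 0%N => k; case: k.
  have [T' HT'] := coprime3_bound phi_inj phi_frac (s10 (ltn0Sn m)) (s20 (ltn0Sn m)) (s30 (ltn0Sn m)).
  exists (T + T')%N => k /andP[k0]; rewrite leq_eqVlt => /orP[/eqP->|km] h c1 c2 c3 cp e1 e2 e3.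
    by have [? ? ?] := HT' h c1 c2 c3 cp e1 e2 e3; split; lia.
  have km' : (0 < k <= m)%N by rewrite k0.
  by have [? ? ?] := IH k km' h c1 c2 c3 cp e1 e2 e3; split; lia.
(* Starting beyond [T] suffices, because [4 ^ N > N >= T]. *)
have [N [k [TN kM gNk]]] := HM T; have k0 : (0 < k)%N by case/andP: kM.
have lt n : (n < n + k)%N by rewrite -{1}(addn0 n) ltn_add2l.
have main j : (j <= N)%N -> good (N - j)%N (N - j + k)%N /\
  exists h c1 c2 c3, [/\ h != 0, coprime3 c1 c2 c3, s1 (N - j) (N - j + k) = h * phi c1,
    s2 (N - j) (N - j + k) = h * phi c2 & s3 (N - j) (N - j + k) = h * phi c3] /\
    some_size_gt (4 ^ j) c1 c2 c3.
  elim: j => [|j IH] jN.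
    rewrite subn0; split=> //.
    have [h [c1 [c2 [c3 [h0 cp e1 e2 e3]]]]] := coprime3_rep phi_inj phi_frac (s2 N (N + k)) (s3 N (N + k)) (s10 (lt N)).
    exists h, c1, c2, c3; split=> //.
    (* Degree 0 would make the triple proportional to constants. *)
    apply/negPn/negP; rewrite /some_size_gt expn0 !negb_or -!leqNgt => /and3P[h1 h2 h3].
    apply: (@nonconst N (N + k) h c1`_0 c2`_0 c3`_0 (lt N)); by rewrite -size1_polyC.
  have [] := IH (ltnW jN); rewrite -(subnSK jN); set n := (N - j.+1)%N; rewrite addSn.
  move=> gn [h [c1 [c2 [c3 [[h0 cp e1 e2 e3] sz]]]]].
  have nk := lt n; have nk1 : (n.+1 < (n + k).+1)%N by [].
  split; first exact: gdesc.
  have nz s c : s != 0 -> s = h * phi c -> c != 0.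
    by move=> s0 es; apply: contra_neq s0 => c0; rewrite es c0 rmorph0 mulr0.
  have c10 := nz _ _ (s10 nk1) e1; have c20 := nz _ _ (s20 nk1) e2; have c30 := nz _ _ (s30 nk1) e3.
  have q12 := sdif2_sqr t0 hal hbe w0 nk1; have q13 := sdif3_sqr t0 hal hbe w0 nk1.
  rewrite -/s1 -/s2 -/s3 in q12 q13.
  have D12 : s1 n.+1 (n + k).+1 ^+ 2 - s2 n.+1 (n + k).+1 ^+ 2 = phi al by rewrite q12 subKr.
  have D13 : s1 n.+1 (n + k).+1 ^+ 2 - s3 n.+1 (n + k).+1 ^+ 2 = phi be by rewrite q13 subKr.
  have D23 : s2 n.+1 (n + k).+1 ^+ 2 - s3 n.+1 (n + k).+1 ^+ 2 = phi (be - al).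
    by rewrite q12 q13 rmorphB; ring.
  have D21 : s2 n.+1 (n + k).+1 ^+ 2 - s1 n.+1 (n + k).+1 ^+ 2 = phi (- al).
    by rewrite q12 rmorphN; ring.
  have cp13 : coprime3 c1 c3 c2 by move=> d a b c; exact: cp.
  have cp23 : coprime3 c2 c3 c1 by move=> d a b c; exact: cp.
  have C12 : coprimep c1 c2.
    apply: (coprime_of_good uu hL ed h0 c10 cp e1 e2 e3 D12 D13).
      by rewrite /disc -mulrA dvdp_mulr.
    by move=> p /gn.1[v [pv []]]; exists v.
  have C13 : coprimep c1 c3.
    apply: (coprime_of_good uu hL ed h0 c10 cp13 e1 e3 e2 D13 D12).
      by rewrite /disc mulrAC dvdp_mull.
    by move=> p /gn.1[v [pv []]]; exists v.
  have C23 : coprimep c2 c3.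
    apply: (coprime_of_good uu hL ed h0 c20 cp23 e2 e3 e1 D23 D21).
      by rewrite /disc dvdp_mull.
    by move=> p /gn.1[v [pv []]]; exists v.
  have [v [dv [b1 b2 b3]]] := gn.2.
  exists (h / (2 * phi c1 * phi c2 * phi c3)), (dblp c1 c2 c3), (dblp c2 c1 c3), (dblp c3 c1 c2).
  split; last first.
    rewrite expnS; apply: dblp_size => //.
    - exact: size_of_good dv h0 c10 c20 c30 e1 e2 e3 b1.
    - exact: size_of_good dv h0 c10 c30 c20 e1 e3 e2 b2.
    exact: size_of_good dv h0 c20 c30 c10 e2 e3 e1 b3.
  split.
  - by rewrite !mulf_neq0 ?invr_eq0 ?mulf_neq0 ?(phi_eq0 phi_inj).
  - exact: dblp_coprime3.
  - by rewrite (sd1 nk) e1 e2 e3 dbl_rep.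
  - rewrite (sd2 nk) e1 e2 e3 dbl_rep //; congr (_ / _ * _); ring.
  by rewrite (sd3 nk) e1 e2 e3 dbl_rep //; congr (_ / _ * _); ring.
have [_ [h [c1 [c2 [c3 [[h0 cp e1 e2 e3] sz]]]]]] := main N (leqnn N).
rewrite subnn add0n in e1 e2 e3.
have [b1 b2 b3] := HT k kM h c1 c2 c3 cp e1 e2 e3.
have big : (N < 4 ^ N)%N by exact: ltn_expl.
move: sz b1 b2 b3; rewrite /some_size_gt; move: (size c1) (size c2) (size c3) => x y z; lia.
Qed.

End Sequence.
End Growth.

(** * Evaluation at a point and halving *)

Section Evaluation.
Variables (K F : fieldType) (phi : {rmorphism {poly K} -> F}).
Hypothesis phi_inj : injective phi.
Hypothesis phi_frac : forall x : F, exists n d, d != 0 /\ x = phi n / phi d.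
Variable t0 : K.

(** Any fraction whose denominator does not vanish at [t0] is accepted, so sums and products need no
    reduction to lowest terms; [val_uniq] makes the value well defined. *)
Definition val_at (x : F) (c : K) :=
  exists n d : {poly K}, [/\ d.[t0] != 0, x = phi n / phi d & c = n.[t0] / d.[t0]].
Definition pole (x : F) := x != 0 /\ val_at x^-1 0.

Let eq0 := phi_eq0 phi_inj.

Lemma horner_neq0 (d : {poly K}) : d.[t0] != 0 -> d != 0.
Proof. by apply: contra_neq => ->; rewrite horner0. Qed.

Lemma val_phi f : val_at (phi f) f.[t0].
Proof. by exists f, 1; rewrite hornerC oner_eq0 rmorph1 !divr1. Qed.

Lemma val_cst c : val_at (phi c%:P) c.
Proof. by rewrite -{2}(hornerC c t0); exact: val_phi. Qed.

Lemma val_uniq x c c' : val_at x c -> val_at x c' -> c = c'.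
Proof.
move=> [n [d [d0 -> ->]]] [n' [d' [d0' e ->]]].
have D : phi d != 0 by rewrite eq0 horner_neq0.
have D' : phi d' != 0 by rewrite eq0 horner_neq0.
move/eqP: e; rewrite eqr_div // -!rmorphM => /eqP/phi_inj/(congr1 (horner^~ t0)).
by rewrite !hornerM => e; apply/eqP; rewrite eqr_div // e.
Qed.

Lemma valM x y c d : val_at x c -> val_at y d -> val_at (x * y) (c * d).
Proof.
move=> [n [m [m0 -> ->]]] [n' [m' [m0' -> ->]]]; exists (n * n'), (m * m').
by rewrite !hornerM !rmorphM mulf_neq0 // !mulf_div.
Qed.

Lemma valD x y c d : val_at x c -> val_at y d -> val_at (x + y) (c + d).
Proof.
move=> [n [m [m0 -> ->]]] [n' [m' [m0' -> ->]]]; exists (n * m' + n' * m), (m * m').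
have D : phi m != 0 by rewrite eq0 horner_neq0.
have D' : phi m' != 0 by rewrite eq0 horner_neq0.
by rewrite !hornerE !rmorphD !rmorphM mulf_neq0 // !addf_div.
Qed.

Lemma valN x c : val_at x c -> val_at (- x) (- c).
Proof. by move=> h; rewrite -mulN1r -[- c]mulN1r -[-1 : F](rmorphN1 phi) -(polyCN 1); apply: valM => //; exact: val_cst. Qed.

Lemma valB x y c d : val_at x c -> val_at y d -> val_at (x - y) (c - d).
Proof. by move=> hx hy; apply: valD => //; exact: valN. Qed.

Lemma valX x c n : val_at x c -> val_at (x ^+ n) (c ^+ n).
Proof.
move=> h; elim: n => [|n IH]; last by rewrite !exprS; exact: valM.
by rewrite !expr0 -(rmorph1 phi); exact: val_cst.
Qed.

Lemma val_neq0 x c : val_at x c -> c != 0 -> x != 0.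
Proof.
move=> h; apply: contra_neq => x0; apply: val_uniq h _.
by rewrite x0 -(rmorph0 phi); exact: (val_cst 0).
Qed.

Lemma valV x c : val_at x c -> c != 0 -> val_at x^-1 c^-1.
Proof.
move=> [n [d [d0 -> ->]]] c0; exists d, n; rewrite !invf_div; split=> //.
by apply: contra_neq c0 => ->; rewrite mul0r.
Qed.

Lemma reduce_frac (n d : {poly K}) : d != 0 ->
  phi n / phi d = phi (n %/ gcdp n d) / phi (d %/ gcdp n d).
Proof.
move=> d0.
have G0 : phi (gcdp n d) != 0 by rewrite eq0 gcdp_eq0 negb_and d0 orbT.
have -> : phi n = phi (n %/ gcdp n d) * phi (gcdp n d).
  by rewrite -rmorphM (divpK (dvdp_gcdl n d)).
have -> : phi d = phi (d %/ gcdp n d) * phi (gcdp n d).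
  by rewrite -rmorphM (divpK (dvdp_gcdr n d)).
by rewrite -mulf_div divff // mulr1.
Qed.

Lemma reduced_den_neq0 (n d : {poly K}) : d != 0 -> d %/ gcdp n d != 0.
Proof. by apply: contra_neq => h; rewrite -(divpK (dvdp_gcdr n d)) h mul0r. Qed.

Lemma coprime_rep (x : F) : exists n d, [/\ d != 0, coprimep n d & x = phi n / phi d].
Proof.
have [n [d [d0 ->]]] := phi_frac x.
exists (n %/ gcdp n d), (d %/ gcdp n d); split; [exact: reduced_den_neq0| |exact: reduce_frac].
by apply: coprimep_div_gcd; rewrite d0 orbT.
Qed.

Lemma coprime_horner (n d : {poly K}) : coprimep n d -> d.[t0] = 0 -> n.[t0] != 0.
Proof. by rewrite coprimep_sym => c d0; apply: coprimep_root c _; apply/eqP. Qed.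

Lemma pole_of_root (n d : {poly K}) : d != 0 -> coprimep n d -> d.[t0] = 0 -> pole (phi n / phi d).
Proof.
move=> d0 c dt; have nt := coprime_horner c dt; split.
  by rewrite mulf_neq0 ?invr_eq0 ?eq0 ?(horner_neq0 nt).
by exists d, n; rewrite invf_div dt mul0r.
Qed.

Lemma val_or_pole x : (exists c, val_at x c) \/ pole x.
Proof.
have [n [d [d0 c e]]] := coprime_rep x.
have [dt|dt] := eqVneq d.[t0] 0; last by left; exists (n.[t0] / d.[t0]), n, d.
by right; rewrite e; exact: pole_of_root.
Qed.

Lemma pole_not_val x c : pole x -> val_at x c -> False.
Proof.
move=> [x0 h] h'; have := valM h h'; rewrite mulVf // mul0r -(rmorph1 phi).
by move/(val_uniq (val_cst 1))/eqP; rewrite oner_eq0.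
Qed.

Lemma pole_sub x y c : pole x -> val_at y c -> pole (x - y).
Proof.
move=> px hy; case: (val_or_pole (x - y)) => [[d hd]|//].
by have := valD hd hy; rewrite subrK => /(pole_not_val px).
Qed.

Lemma val_sqrt x c : val_at (x ^+ 2) c -> exists2 d, val_at x d & d ^+ 2 = c.
Proof.
move=> h; case: (val_or_pole x) => [[d hd]|[x0 hp]].
  by exists d => //; apply: val_uniq (valX 2 hd) h.
have := valM (valX 2 hp) h; rewrite exprVn mulVf ?expf_neq0 // expr2 !mul0r -(rmorph1 phi).
by move/(val_uniq (val_cst 1))/eqP; rewrite oner_eq0.
Qed.

Lemma val_sqrt_sign x c : val_at (x ^+ 2) (c ^+ 2) ->
  exists x', val_at x' c /\ x' ^+ 2 = x ^+ 2.
Proof.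
move=> /val_sqrt[d hd /eqP]; rewrite eqf_sqr => /orP[/eqP e|/eqP e].
  by exists x; rewrite -e.
by exists (- x); rewrite sqrrN; split=> //; rewrite -[c]opprK -e; exact: valN.
Qed.

Lemma square_of_descent (S : {pred K}) (x y : F) (e1 e2 e3 : {poly K}) :
  subringA (fun c => c \in S) -> factorialA (fun c => c \in S) ->
  (forall c : K, exists n d, [/\ n \in S, d \in S, d != 0 & c = n / d]) ->
  polyS S e1 -> polyS S e2 -> polyS S e3 ->
  e1.[t0] != e2.[t0] -> e1.[t0] != e3.[t0] ->
  (forall h : {poly K}, (1 < size h)%N -> squarefreeS S h ->
     dvdS S h ((e1 - e2) * (e1 - e3)) -> ~ exists z : K, z ^+ 2 = h.[t0]) ->
  pole x -> y ^+ 2 = (x - phi e1) * (x - phi e2) * (x - phi e3) ->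
  exists r, r ^+ 2 = x - phi e1.
Proof.
move=> HS fS frS e1S e2S e3S e12 e13 H px ey.
have p1 := pole_sub px (val_phi e1); have p2 := pole_sub px (val_phi e2).
have p3 := pole_sub px (val_phi e3).
have [u0 vu] := p1; have [n2 _] := p2; have [n3 _] := p3.
have HP := polyS_subring HS; have fP := polyS_factorial HS fS frS.
have [HA fA] := factorial_image phi_inj HP fP.
set A := (fun y => _) in HA fA.
have frA (z : F) : exists n d, [/\ A n, A d, d != 0 & z = n / d].
  have [n [d [d0 ->]]] := phi_frac z.
  have [a [aS a0 an]] := polyS_clear HS frS n; have [b [bS b0 bd]] := polyS_clear HS frS d.
  exists (phi ((a * b) *: n)), (phi ((a * b) *: d)); split.
  - by exists ((a * b) *: n); split=> //; rewrite mulrC -scalerA; exact: polySZ.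
  - by exists ((a * b) *: d); split=> //; rewrite -scalerA; exact: polySZ.
  - by rewrite eq0 scaler_eq0 negb_or mulf_neq0.
  rewrite -!mul_polyC !rmorphM -mulf_div divff ?mul1r //.
  by rewrite -rmorphM -polyCM eq0 polyC_eq0 mulf_neq0.
have Ae i j : polyS S i -> polyS S j -> A (phi (i - j)).
  by move=> iS jS; exists (i - j); split=> //; exact: (A_B HP).
have y0 : y != 0 by rewrite -sqrf_eq0 ey !mulf_neq0.
have [|d [z [[d' [d'S ->]] ez z0 [_ [[q [qS ->]] eq]] sf]]] :=
  squarefree_descent HA frA fA (Ae _ _ e1S e2S) (Ae _ _ e1S e3S) y0 (x := x - phi e1).
  by rewrite ey !rmorphB; ring.
have dv : dvdS S d' ((e1 - e2) * (e1 - e3)).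
  by exists q; split=> //; apply: phi_inj; rewrite rmorphM eq -rmorphM.
have sq : squarefreeS S d'.
  split=> // g gS [k [kS ek]].
  have [_ [_ [[l [lS ->]] el]]] : unitA A (phi g).
    apply: sf; first by exists g.
    by exists (phi k); rewrite ek !rmorphM; split=> //; exists k.
  by split=> //; exists l; split=> //; apply: phi_inj; rewrite rmorphM el rmorph1.
have dt : d'.[t0] != 0.
  have : ((e1 - e2) * (e1 - e3)).[t0] != 0 by rewrite !hornerE mulf_neq0 // subr_eq0.
  have [k [_ ->]] := dv; by rewrite hornerM mulf_eq0 negb_or => /andP[].
(* [(x - e) / (x - e1)] has value [1] at [t0]. *)
have kap e : val_at (1 + phi (e1 - e) / (x - phi e1)) 1.
  have := valD (val_cst 1) (valM (val_phi (e1 - e)) vu); by rewrite mulr0 addr0 rmorph1.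
have := valM (val_phi d') (valM (kap e2) (kap e3)); rewrite !mulr1.
have -> : phi d' * ((1 + phi (e1 - e2) / (x - phi e1)) * (1 + phi (e1 - e3) / (x - phi e1))) =
   (y / ((x - phi e1) * z)) ^+ 2.
  have D0 : phi d' != 0 by rewrite eq0 (horner_neq0 dt).
  rewrite expr_div_n ey !rmorphB; set U := x - phi e1 in ez u0 *.
  have -> : x - phi e2 = U + (phi e1 - phi e2) by rewrite /U; ring.
  have -> : x - phi e3 = U + (phi e1 - phi e3) by rewrite /U; ring.
  have -> : phi d' = U / z ^+ 2 by rewrite ez mulfK ?expf_neq0.
  by field; rewrite ?z0 ?u0.
case/val_sqrt => c _ ec.
(* [d'.[t0]] is the square [c ^+ 2], so the hypothesis on divisors leaves only a constant [d'],
   equal to its value at [t0]. *)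
have sd : (size d' <= 1)%N.
  by rewrite leqNgt; apply/negP => sd; apply: (H d' sd sq dv); exists c.
exists (phi c%:P * z); rewrite exprMn ez; congr (_ * _).
rewrite -rmorphXn -polyC_exp ec; congr (phi _).
by rewrite {1}(size1_polyC sd) hornerC -size1_polyC.
Qed.

Lemma phi_sqrMB (a b c : {poly K}) : phi (a ^+ 2 * (b - c)) = phi a ^+ 2 * (phi b - phi c).
Proof. by rewrite rmorphM rmorphXn rmorphB. Qed.

(** * The halving sequence of a point with a pole at [t0] *)

Section Halving.
Variables e1 e2 e3 : {poly K}.
Hypotheses (e12 : e1 != e2) (e13 : e1 != e3) (e23 : e2 != e3).
Hypothesis char0 : forall n, (n.+1%:R : K) != 0.
Hypothesis desc : forall x y, pole x -> y ^+ 2 = (x - phi e1) * (x - phi e2) * (x - phi e3) ->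
  exists r1 r2 r3, [/\ r1 ^+ 2 = x - phi e1, r2 ^+ 2 = x - phi e2 & r3 ^+ 2 = x - phi e3].

Section Scaled.
Variable m : nat.
(** [m.+1] is the pole order of the square roots of the initial point. It is positive, so [al] and
    [be] vanish at [t0] and the squares of the scaled coordinates have the same value there. *)
Let s : {poly K} := ('X - t0%:P) ^+ m.+1.
Let al := s ^+ 2 * (e2 - e1).
Let be := s ^+ 2 * (e3 - e1).

(* Coordinates are multiplied by a power of ['X - t0] so as to have a finite
   nonzero value [l] at [t0]; [dbl] and [dif] are homogeneous of degree 1. *)
Definition htriple (T : F * F * F * K) := let: (f1, f2, f3, l) := T in
  [/\ f2 ^+ 2 = f1 ^+ 2 - phi al, f3 ^+ 2 = f1 ^+ 2 - phi be, l != 0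
    & [/\ val_at f1 l, val_at f2 l & val_at f3 l]].

Let k2 : (2 : K) != 0 := char0 1.
Let t2 : (2 : F) != 0 := two0F phi_inj k2.

Lemma shift_neq0 : s != 0. Proof. by rewrite expf_neq0 // polyXsubC_eq0. Qed.
Lemma shift_root : s.[t0] = 0. Proof. by rewrite horner_exp !hornerE subrr expr0n. Qed.

(** Equal values [l] at [t0] make each [f_i + f_j] a unit there with value [2 * l], which produces
    the pole of the half and later fixes all the signs. *)
Lemma halve T : htriple T -> exists T', htriple T' /\
  let: (f1, f2, f3, l) := T in let: (g1, g2, g3, l') := T' in
  [/\ f1 = dbl g1 g2 g3, f2 = dbl g2 g1 g3, f3 = dbl g3 g1 g2 & l' = 2 * l].
Proof.
case: T => [[[f1 f2] f3] l] [h2 h3 l0 [v1 v2 v3]].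
have S0 : phi s != 0 by rewrite eq0 shift_neq0.
have l2 : l + l != 0 by rewrite -mulr2n -mulr_natl mulf_neq0.
have v12 := valD v1 v2; have v13 := valD v1 v3; have v23 := valD v2 v3.
have n12 := val_neq0 v12 l2; have n13 := val_neq0 v13 l2; have n23 := val_neq0 v23 l2.
(* The classical halving formula [x' - e1 = (r1 + r2) * (r1 + r3)], with [f_i = s * r_i]. *)
pose x := (f1 + f2) * (f1 + f3) / phi s ^+ 2 + phi e1.
pose y := (f1 + f2) * (f1 + f3) * (f2 + f3) / phi s ^+ 3.
have x1 : x - phi e1 = (f1 + f2) * (f1 + f3) / phi s ^+ 2 by rewrite /x addrK.
have Eal : phi s ^+ 2 * (phi e2 - phi e1) = f1 ^+ 2 - f2 ^+ 2.
  by rewrite h2 subKr /al phi_sqrMB.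
have Ebe : phi s ^+ 2 * (phi e3 - phi e1) = f1 ^+ 2 - f3 ^+ 2.
  by rewrite h3 subKr /be phi_sqrMB.
have x2 : x - phi e2 = (f1 + f2) * (f2 + f3) / phi s ^+ 2.
  have -> : x - phi e2 = (f1 + f2) * (f1 + f3) / phi s ^+ 2 - phi s ^+ 2 * (phi e2 - phi e1) / phi s ^+ 2.
    by rewrite /x; field.
  by rewrite Eal; field.
have x3 : x - phi e3 = (f1 + f3) * (f2 + f3) / phi s ^+ 2.
  have -> : x - phi e3 = (f1 + f2) * (f1 + f3) / phi s ^+ 2 - phi s ^+ 2 * (phi e3 - phi e1) / phi s ^+ 2.
    by rewrite /x; field.
  by rewrite Ebe; field.
have px : pole x.
  have : pole (x - phi e1).
    rewrite x1; split; first by rewrite !mulf_neq0 ?invr_eq0 ?expf_neq0.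
    rewrite invf_div; have := valM (valX 2 (val_phi s)) (valV (valM v12 v13) (mulf_neq0 l2 l2)).
    by rewrite shift_root expr0n mul0r.
  by move/pole_sub/(_ (val_phi (- e1))); rewrite rmorphN opprK subrK.
have [q1 [q2 [q3 [E1 E2 E3]]]] : exists r1 r2 r3,
    [/\ r1 ^+ 2 = x - phi e1, r2 ^+ 2 = x - phi e2 & r3 ^+ 2 = x - phi e3].
  by apply: (desc (y := y) px); rewrite x1 x2 x3 /y; field.
have V a b q : val_at a (l + l) -> val_at b (l + l) -> q ^+ 2 = a * b / phi s ^+ 2 ->
    exists g, val_at g (l + l) /\ g ^+ 2 = a * b.
  move=> va vb eq.
  have e : (phi s * q) ^+ 2 = a * b by rewrite exprMn eq mulrC divfK ?expf_neq0.
  have [|g [vg eg]] := @val_sqrt_sign (phi s * q) (l + l); last by exists g; rewrite eg.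
  by rewrite e expr2; exact: valM.
have [g1 [w1 G1]] := V _ _ _ v12 v13 (etrans E1 x1).
have [g2 [w2 G2]] := V _ _ _ v12 v23 (etrans E2 x2).
have [g3 [w3 G3]] := V _ _ _ v13 v23 (etrans E3 x3).
have m1 := val_neq0 w1 l2; have m2 := val_neq0 w2 l2; have m3 := val_neq0 w3 l2.
exists (g1, g2, g3, l + l); split.
  split=> //.
    by rewrite G1 G2 /al phi_sqrMB Eal; ring.
  by rewrite G1 G3 /be phi_sqrMB Ebe; ring.
(* The squares give the relation up to sign, and both sides have the value [2 * l] at [t0], which
   differs from its opposite. *)
have sgn a x1' x2' x3' : val_at a (l + l) -> val_at x1' (l + l) -> val_at x2' (l + l) ->
    val_at x3' (l + l) -> a ^+ 2 * x3' ^+ 2 = x1' ^+ 2 * x2' ^+ 2 -> a = x1' * x2' / x3'.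
  move=> va b1 b2 b3 e; have b30 := val_neq0 b3 l2.
  have : (a * x3') ^+ 2 == (x1' * x2') ^+ 2 by rewrite !exprMn e.
  rewrite eqf_sqr => /orP[/eqP <-|/eqP eN]; first by rewrite mulfK.
  have := val_uniq (valM va b3) _; rewrite eN => /(_ _ (valN (valM b1 b2)))/eqP.
  by rewrite -addr_eq0 -mulr2n -mulr_natl !mulf_eq0 (negbTE l2) (negbTE k2).
have A12 : f1 + f2 = g1 * g2 / g3 by apply: sgn => //; rewrite G1 G2 G3; ring.
have A13 : f1 + f3 = g1 * g3 / g2 by apply: sgn => //; rewrite G1 G2 G3; ring.
have A23 : f2 + f3 = g2 * g3 / g1 by apply: sgn => //; rewrite G1 G2 G3; ring.
split.
- exact: dbl_unique A12 A13 A23.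
- apply: (dbl_unique t2 (d2 := f1) (d3 := f3)) => //.
  by rewrite addrC A12 [g1 * g2]mulrC.
- apply: (dbl_unique t2 (d2 := f1) (d3 := f2)) => //.
    by rewrite addrC A13 [g1 * g3]mulrC.
  by rewrite addrC A23 [g2 * g3]mulrC.
by rewrite -mulr2n mulr_natl.
Qed.

(** The three coordinates of [P_n - P_k] have the same nonzero value [c n k] at [t0]. If they were
    proportional to constants, the constants would be equal, so the first two coordinates would
    agree and [al] would vanish. *)
Lemma no_htriple T : ~ htriple T.
Proof.
move=> hT.
have [nx hnx] : exists nx : F * F * F * K -> F * F * F * K, forall T, htriple T -> htriple (nx T) /\
  let: (f1, f2, f3, l) := T in let: (g1, g2, g3, l') := nx T in
  [/\ f1 = dbl g1 g2 g3, f2 = dbl g2 g1 g3, f3 = dbl g3 g1 g2 & l' = 2 * l].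
  apply: (functional_choice (fun T T' => htriple T -> htriple T' /\
  let: (f1, f2, f3, l) := T in let: (g1, g2, g3, l') := T' in
  [/\ f1 = dbl g1 g2 g3, f2 = dbl g2 g1 g3, f3 = dbl g3 g1 g2 & l' = 2 * l])) => U.
  case: (classic (htriple U)) => [/halve[U' h]|]; last by exists T.
  by exists U'.
pose R n := iter n nx T.
have hR n : htriple (R n) by elim: n => // n IH; exact: (hnx _ IH).1.
pose r1 n := (R n).1.1.1; pose r2 n := (R n).1.1.2; pose r3 n := (R n).1.2; pose l n := (R n).2.
have P n : [/\ r2 n ^+ 2 = r1 n ^+ 2 - phi al, r3 n ^+ 2 = r1 n ^+ 2 - phi be, l n != 0
    & [/\ val_at (r1 n) (l n), val_at (r2 n) (l n) & val_at (r3 n) (l n)]].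
  by rewrite /r1 /r2 /r3 /l; have := hR n; case: (R n) => [[[a b] c] d].
have Q n : [/\ r1 n = dbl (r1 n.+1) (r2 n.+1) (r3 n.+1), r2 n = dbl (r2 n.+1) (r1 n.+1) (r3 n.+1),
    r3 n = dbl (r3 n.+1) (r1 n.+1) (r2 n.+1) & l n.+1 = 2 * l n].
  rewrite /r1 /r2 /r3 /l /R iterS -/(R n); have [_] := hnx _ (hR n).
  by case: (R n) => [[[a b] c] d]; case: (nx _) => [[[a' b'] c'] d'].
have hal n : r2 n ^+ 2 = r1 n ^+ 2 - phi al by case: (P n).
have hbe n : r3 n ^+ 2 = r1 n ^+ 2 - phi be by case: (P n).
have l0 n : l n != 0 by case: (P n).
have v1 n : val_at (r1 n) (l n) by case: (P n) => _ _ _ [].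
have v2 n : val_at (r2 n) (l n) by case: (P n) => _ _ _ [].
have v3 n : val_at (r3 n) (l n) by case: (P n) => _ _ _ [].
have lE n k : l (n + k)%N = (2 ^ k)%:R * l n.
  elim: k => [|k IH]; first by rewrite addn0 mul1r.
  by rewrite addnS; case: (Q (n + k)%N) => _ _ _ ->; rewrite IH mulrA -natrM -expnS.
have lw n k : (n < k)%N -> (l k - l n != 0) /\ (l k + l n != 0).
  move=> nk; rewrite -(subnKC (ltnW nk)) lE.
  (* [2 ^ (k - n) - 1] and [2 ^ (k - n) + 1] are positive integers, hence nonzero in [K]. *)
  have : (1 < 2 ^ (k - n))%N by rewrite -{1}(expn0 2) ltn_exp2l // subn_gt0.
  case: (2 ^ (k - n))%N => [//|[//|N]] _; split.
    by rewrite -natr1 mulrDl mul1r addrK mulf_neq0.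
  by rewrite -{2}(mul1r (l n)) -mulrDl natr1 mulf_neq0.
have w0 n k : (n < k)%N -> l k ^+ 2 - l n ^+ 2 != 0.
  by move=> /lw[a b]; rewrite subr_sqr mulf_neq0.
have shift2_neq0 := expf_neq0 2 shift_neq0.
have al0 : al != 0 by apply: (mulf_neq0 shift2_neq0); rewrite subr_eq0 eq_sym.
have be0 : be != 0 by apply: (mulf_neq0 shift2_neq0); rewrite subr_eq0 eq_sym.
have alb : al != be.
  rewrite -subr_eq0 -mulrBr; apply: (mulf_neq0 shift2_neq0).
  by rewrite subr_eq0; apply: contra_neq e23 => /(congr1 (+%R^~ e1)); rewrite !subrK.
pose c n k := (l n * l k * l k + l k * l n * l n) / (l k ^+ 2 - l n ^+ 2).
have c0 n k : (n < k)%N -> c n k != 0.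
  move=> nk; have [_ h] := lw n k nk.
  have -> : c n k = l n * l k * (l k + l n) / (l k ^+ 2 - l n ^+ 2) by rewrite /c; congr (_ / _); ring.
  by rewrite !mulf_neq0 // invr_eq0 w0.
have vd (p q t : nat -> F) : (forall n, val_at (p n) (l n)) -> (forall n, val_at (q n) (l n)) ->
  (forall n, val_at (t n) (l n)) -> forall n k, (n < k)%N ->
  val_at (dif (p n) (q n) (t n) (p k) (q k) (t k)) (c n k).
  move=> vp vq vt n k nk; apply: valM.
    by apply: valD; do !apply: valM.
  by apply: valV (w0 _ _ nk); apply: valB; exact: valX.
have V1 n k nk := vd _ _ _ v1 v2 v3 n k nk.
have V2 n k nk := vd _ _ _ v2 v1 v3 n k nk.
have V3 n k nk := vd _ _ _ v3 v1 v2 n k nk.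
apply: (no_halving_sequence phi_inj phi_frac k2 (r1 := r1) (r2 := r2) (r3 := r3) (al := al) (be := be)) => //.
- by move=> n; exact: val_neq0 (v1 n) (l0 n).
- by move=> n; exact: val_neq0 (v2 n) (l0 n).
- by move=> n; exact: val_neq0 (v3 n) (l0 n).
- by move=> n k nk; apply: val_neq0 (valB (valX 2 (v1 k)) (valX 2 (v1 n))) (w0 _ _ nk).
- by move=> n; case: (Q n).
- by move=> n; case: (Q n).
- by move=> n; case: (Q n).
- by move=> n k nk; apply: val_neq0 (V1 n k nk) (c0 n k nk).
- by move=> n k nk; apply: val_neq0 (V2 n k nk) (c0 n k nk).
- by move=> n k nk; apply: val_neq0 (V3 n k nk) (c0 n k nk).
move=> n k h a b d nk E1 E2 _.
have E : sdif1 r1 r2 r3 n k * phi b%:P = sdif2 r1 r2 r3 n k * phi a%:P by rewrite E1 E2; ring.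
have := valM (V1 n k nk) (val_cst b); rewrite -/(sdif1 r1 r2 r3 n k) E => W.
have := val_uniq W (valM (V2 n k nk) (val_cst a)) => /(mulfI (c0 n k nk)) ab.
have E12 : sdif1 r1 r2 r3 n k = sdif2 r1 r2 r3 n k by rewrite E1 E2 ab.
have W0 n' k' : (n' < k')%N -> r1 k' ^+ 2 - r1 n' ^+ 2 != 0.
  by move=> nk'; apply: val_neq0 (valB (valX 2 (v1 k')) (valX 2 (v1 n'))) (w0 _ _ nk').
have := sdif2_sqr t2 hal hbe W0 nk; rewrite E12 => h'.
have := subKr (sdif2 r1 r2 r3 n k ^+ 2) (phi al); rewrite -h' subrr => /esym/eqP.
by rewrite eq0 (negbTE al0).
Qed.

End Scaled.

Lemma no_pole_point x y : pole x -> y ^+ 2 = (x - phi e1) * (x - phi e2) * (x - phi e3) -> False.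
Proof.
move=> px ey; have [r1 [r2 [r3 [E1 E2 E3]]]] := desc px ey.
have [n [d [d0 c e]]] := coprime_rep r1.
have dt : d.[t0] = 0.
  apply/eqP; apply: contraT => dt.
  have h : val_at r1 (n.[t0] / d.[t0]) by exists n, d.
  by have := valX 2 h; rewrite E1 => /(pole_not_val (pole_sub px (val_phi e1))).
have nt := coprime_horner c dt.
(* The multiplicity of [t0] in the reduced denominator is the pole order of [r1]; it is positive
   since [d] vanishes at [t0]. *)
have [[|m] [b bt eb]] := multiplicity_XsubC d t0.
  rewrite mulr1 in eb; move: bt; rewrite d0 /= -eb => /negP[]; exact/eqP.
rewrite d0 /= in bt; set s := ('X - t0%:P) ^+ m.+1 in eb.
have S0 : phi s != 0 by rewrite eq0 /s shift_neq0.
have B0 : phi b != 0 by rewrite eq0; apply: contraNneq bt => ->; rewrite root0.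
pose l := n.[t0] / b.[t0].
have l0 : l != 0 by rewrite mulf_neq0 // invr_eq0.
have v1 : val_at (phi s * r1) l.
  exists n, b; split=> //; rewrite e eb rmorphM; by field; rewrite ?S0 ?B0.
have V r g : r ^+ 2 = x - phi g -> exists f, val_at f l /\ f ^+ 2 = (phi s * r1) ^+ 2 - phi (s ^+ 2 * (g - e1)).
  move=> er.
  have e' : (phi s * r) ^+ 2 = (phi s * r1) ^+ 2 - phi (s ^+ 2 * (g - e1)).
    by rewrite !exprMn er E1 phi_sqrMB; ring.
  have [|f [vf ef]] := @val_sqrt_sign (phi s * r) l; last by exists f; rewrite ef.
  rewrite e'; have := valB (valX 2 v1) (val_phi (s ^+ 2 * (g - e1))).
  by rewrite hornerM horner_exp shift_root expr0n mul0r subr0.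
have [f2 [v2 F2]] := V _ _ E2; have [f3 [v3 F3]] := V _ _ E3.
by apply: (@no_htriple m (phi s * r1, f2, f3, l)).
Qed.

End Halving.
End Evaluation.

(** * The difference of two points with the same specialization *)

Section Collision.
Variables (K F : fieldType) (phi : {rmorphism {poly K} -> F}).
Hypothesis phi_inj : injective phi.
Hypothesis phi_frac : forall x : F, exists n d, d != 0 /\ x = phi n / phi d.
Variable t0 : K.
Variables e1 e2 e3 : {poly K}.
Hypotheses (d12 : e1.[t0] != e2.[t0]) (d13 : e1.[t0] != e3.[t0]) (d23 : e2.[t0] != e3.[t0]).
Hypothesis k2 : (2 : K) != 0.

Let f (x : F) := (x - phi e1) * (x - phi e2) * (x - phi e3).

Let t2 : (2 : F) != 0 := two0F phi_inj k2.

Lemma pole_slope (l x1 x2 : F) a1 a2 : pole phi t0 l -> val_at phi t0 x1 a1 -> val_at phi t0 x2 a2 ->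
  pole phi t0 (l ^+ 2 + phi e1 + phi e2 + phi e3 - x1 - x2).
Proof.
move=> [l0 lv] v1 v2.
have -> : l ^+ 2 + phi e1 + phi e2 + phi e3 - x1 - x2 =
   l ^+ 2 - (x1 + x2 - phi e1 - phi e2 - phi e3) by ring.
have h := valB phi_inj (valB phi_inj (valB phi_inj (valD phi_inj v1 v2)
   (val_phi phi t0 e1)) (val_phi phi t0 e2)) (val_phi phi t0 e3).
apply: (pole_sub phi_inj phi_frac _ h); split; first by rewrite expf_neq0.
by have := valX 2 lv; rewrite exprVn expr0n.
Qed.

(** The line through the first point and the opposite of the second, tangent if these coincide, has
    a slope with a pole at [t0], hence so has the abscissa of its third intersection with the curve.
    When [b = 0] this uses that [f'], the derivative of the specialized cubic at [a], is nonzero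
    because the roots at [t0] are distinct. *)
Lemma pole_of_collision x1 y1 x2 y2 a b :
  y1 ^+ 2 = f x1 -> y2 ^+ 2 = f x2 ->
  val_at phi t0 x1 a -> val_at phi t0 x2 a -> val_at phi t0 y1 b -> val_at phi t0 y2 b ->
  (x1, y1) <> (x2, y2) -> exists x y, pole phi t0 x /\ y ^+ 2 = f x.
Proof.
move=> c1 c2 vx1 vx2 vy1 vy2 ne.
have ve (e : {poly K}) := val_phi phi t0 e.
have vb : b ^+ 2 = (a - e1.[t0]) * (a - e2.[t0]) * (a - e3.[t0]).
  apply: (val_uniq phi_inj (valX 2 vy1)); rewrite c1.
  by apply: valM; [apply: valM|]; apply: (valB phi_inj).
pose f' := (a - e2.[t0]) * (a - e3.[t0]) + (a - e1.[t0]) * (a - e3.[t0]) + (a - e1.[t0]) * (a - e2.[t0]).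
have f'0 : b = 0 -> f' != 0.
  move=> b0; move/esym/eqP: vb; rewrite b0 expr0n !mulf_eq0 !subr_eq0 => /orP[/orP[]|] /eqP e;
  rewrite /f' e subrr !(mul0r, mulr0, add0r, addr0) mulf_neq0 // subr_eq0 //; by rewrite eq_sym.
have [ex|nx] := eqVneq x1 x2.
  subst x2; have : y1 ^+ 2 == y2 ^+ 2 by rewrite c1 c2.
  rewrite eqf_sqr => /orP[/eqP ey|/eqP ey]; first by case: ne; rewrite ey.
  have b0 : b = 0.
    have := val_uniq phi_inj vy1; rewrite ey => /(_ _ (valN vy2))/eqP.
    by rewrite -addr_eq0 -mulr2n -mulr_natl mulf_eq0 (negbTE k2) => /eqP.
  have y0 : y1 != 0.
    apply/eqP => y0; apply: ne; rewrite y0; congr (_, _); apply/esym/eqP.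
    by rewrite -oppr_eq0 -ey y0.
  pose g := (x1 - phi e2) * (x1 - phi e3) + (x1 - phi e1) * (x1 - phi e3) + (x1 - phi e1) * (x1 - phi e2).
  have vg : val_at phi t0 g f'.
    by do 2?apply: (valD phi_inj); apply: valM; apply: (valB phi_inj).
  have g0 := val_neq0 phi_inj vg (f'0 b0).
  pose l := g / (2 * y1).
  have pl : pole phi t0 l.
    split; first by rewrite mulf_neq0 // invr_eq0 mulf_neq0.
    rewrite invf_div; have := valM (valM (val_cst phi t0 2) vy1) (valV vg (f'0 b0)).
    by rewrite b0 mulr0 mul0r polyC_natr rmorph_nat.
  pose x3 := l ^+ 2 + phi e1 + phi e2 + phi e3 - x1 - x1.
  exists x3, (y1 + l * (x3 - x1)); split; first exact: (pole_slope pl vx1 vx1).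
  have E : g = 2 * l * y1 by rewrite /l; field; rewrite ?t2 ?y0.
  suff C : f x3 - (y1 + l * (x3 - x1)) ^+ 2 = (f x1 - y1 ^+ 2) + (g - 2 * l * y1) * (x3 - x1).
    by apply/esym/eqP; rewrite -subr_eq0 C E c1 !subrr mul0r addr0.
  by rewrite /f /g /x3; ring.
have dx : x1 - x2 != 0 by rewrite subr_eq0.
pose l := (y1 + y2) / (x1 - x2).
have vdx : val_at phi t0 (x1 - x2) 0 by rewrite -(subrr a); exact: valB.
have pl : pole phi t0 l.
  have [b0|b0] := eqVneq b 0; last first.
    have b2 : b + b != 0 by rewrite -mulr2n -mulr_natl mulf_neq0.
    have vy := valD phi_inj vy1 vy2; have y0 := val_neq0 phi_inj vy b2.
    split; first by rewrite mulf_neq0 // invr_eq0.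
    by rewrite invf_div; have := valM vdx (valV vy b2); rewrite mul0r.
  (* [g] is the divided difference of [f] at [x1], [x2]; the slope equals [g / (y1 - y2)], which is
     no longer of the form 0/0 at [t0]. *)
  pose g := (x1 - phi e2) * (x1 - phi e3) + (x2 - phi e1) * (x1 - phi e3) + (x2 - phi e1) * (x2 - phi e2).
  have vg : val_at phi t0 g f'.
    by do 2?apply: (valD phi_inj); apply: valM; apply: (valB phi_inj).
  have g0 := val_neq0 phi_inj vg (f'0 b0).
  have E : (y1 - y2) * (y1 + y2) = g * (x1 - x2).
    by rewrite -subr_sqr c1 c2 /f /g; ring.
  have y0 : (y1 - y2) * (y1 + y2) != 0 by rewrite E mulf_neq0.
  move: y0; rewrite mulf_eq0 negb_or => /andP[y0 y0'].
  split; first by rewrite mulf_neq0 // invr_eq0.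
  have -> : l^-1 = (y1 - y2) / g.
    rewrite /l invf_div; apply/eqP; rewrite eqr_div // mulrC -E; exact/eqP.
  have := valM (valB phi_inj vy1 vy2) (valV vg (f'0 b0)).
  by rewrite subrr mul0r.
pose x3 := l ^+ 2 + phi e1 + phi e2 + phi e3 - x1 - x2.
exists x3, (y1 + l * (x3 - x1)); split; first exact: (pole_slope pl vx1 vx2).
have E : l * (x2 - x1) = - (y1 + y2) by rewrite /l; field.
have C2 : f x2 - (y1 + l * (x2 - x1)) ^+ 2 = 0 by rewrite E -c2; ring.
(* By the choice of [x3], the cubic minus the squared line differs from
   [(X - x1) * (X - x2) * (X - x3)] by a linear polynomial in [X]; its value at [x3] is interpolated
   from those at [x1] and [x2]. *)
suff C : (f x3 - (y1 + l * (x3 - x1)) ^+ 2) * (x1 - x2) =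
   (f x1 - y1 ^+ 2) * (x3 - x2) - (f x2 - (y1 + l * (x2 - x1)) ^+ 2) * (x3 - x1).
  move/eqP: C; rewrite C2 c1 subrr !mul0r subr0 mulf_eq0 (negbTE dx) orbF subr_eq0.
  by move=> /eqP ->.
by rewrite /f /x3; ring.
Qed.

End Collision.

(** * Number fields: characteristic zero and integral multiples *)

Section NumberField.
Variable K : fieldExtType rat.

Lemma numfield_char0 n : (n.+1%:R : K) != 0.
Proof. by rewrite -(rmorph_nat (in_alg K)) fmorph_eq0 pnatr_eq0. Qed.

Lemma numfield_int_neq0 (a : int) : a != 0 -> (a%:~R : K) != 0.
Proof. by move=> a0; rewrite -(rmorph_int (in_alg K)) fmorph_eq0 intr_eq0. Qed.

Lemma integral_multiple (x : K) : exists2 a : int, a != 0 & integralZ (a%:~R * x).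
Proof.
have [q eq] := polyOver1P (minPolyOver 1%AS x).
have [p [a a0 ep]] := rat_poly_scale q.
have q0 : q != 0.
  apply: contraTneq (monic_minPoly 1%AS x) => h.
  by rewrite eq h rmorph0 monicE lead_coef0 eq_sym oner_eq0.
have p0 : p != 0 by apply: contra_neq q0 => h; rewrite ep h rmorph0 scaler0.
have rx : (map_poly intr p).[x] = 0 :> K.
  have := root_minPoly 1%AS x; rewrite eq ep map_polyZ rootZ; last first.
    by rewrite fmorph_eq0 invr_eq0 intr_eq0.
  rewrite -map_poly_comp /root => /eqP <-; congr (_.[x]).
  by apply: eq_map_poly => i; exact: esym (rmorph_int (in_alg K) i).
pose n := (size p).-1; have sp : size p = n.+1 by rewrite /n prednK // size_poly_gt0.
pose c : int := p`_n; have c0 : c != 0 by rewrite /c /n -/(lead_coef p) lead_coef_eq0.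
exists c => //.
have ev (g : {poly int}) (y : K) m : (size g <= m)%N ->
    (map_poly intr g).[y] = \sum_(i < m) (g`_i)%:~R * y ^+ i.
  move=> sg; rewrite (@horner_coef_wide _ m); last first.
    by rewrite (leq_trans (size_poly _ _)).
  by apply: eq_bigr => i _; rewrite coef_map.
move: rx; rewrite (ev p x n.+1) ?sp // big_ord_recr /= => rx.
case: n @c c0 rx sp => [|m] c c0 rx sp.
  move/eqP: rx; rewrite big_ord0 add0r expr0 mulr1.
  by rewrite (negbTE (numfield_int_neq0 c0)).
(* With [m.+1] the degree and [c] the leading coefficient of [p], this is [c ^+ m * p(X / c)]:
   monic, with root [c * x]. *)
pose g : {poly int} := \poly_(i < m.+2) (if i == m.+1 then 1 else p`_i * c ^+ (m - i)).
have sg : size g = m.+2 by rewrite size_poly_eq // eqxx.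
exists g; split.
  by rewrite monicE lead_coefE sg coef_poly ltnSn eqxx.
rewrite /root (ev g _ m.+2) ?sg // big_ord_recr /= coef_poly ltnSn eqxx mul1r.
suff -> : \sum_(i < m.+1) (g`_i)%:~R * (c%:~R * x) ^+ i + (c%:~R * x) ^+ m.+1 =
   c%:~R ^+ m * (\sum_(i < m.+1) (p`_i)%:~R * x ^+ i + (p`_m.+1)%:~R * x ^+ m.+1).
  by rewrite rx mulr0.
rewrite mulrDr mulr_sumr; congr (_ + _); last first.
  by rewrite exprMn mulrA exprSr.
apply: eq_bigr => i _; rewrite coef_poly (leq_trans (ltn_ord i)) // ltn_eqF //.
rewrite rmorphM rmorphXn exprMn !mulrA; congr (_ * _).
have im : (i <= m)%N by rewrite -ltnS.
by rewrite -mulrA -exprD (subnK im) [LHS]mulrC.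
Qed.

Lemma numfield_frac (S : {pred K}) : (forall x : K, integralZ x -> x \in S) ->
  forall x : K, exists n d, [/\ n \in S, d \in S, d != 0 & x = n / d].
Proof.
move=> HS x; have [a a0 h] := integral_multiple x.
have a0' := numfield_int_neq0 a0.
exists (a%:~R * x), a%:~R; split=> //; first exact: HS.
  apply: HS; exists ('X - a%:P); split; first exact: monicXsubC.
  by rewrite map_polyXsubC root_XsubC.
by rewrite mulrC mulKf.
Qed.

End NumberField.

(** * Reduced fractions and evaluation in [K(t)] *)

Section Specialization.
Variable K : fieldType.
Local Notation F := {fraction {poly K}}.
Local Notation phi := (@FracField.tofrac {poly K} : {rmorphism {poly K} -> F}).

Lemma tofrac_inj : injective phi.
Proof. by move=> f g /eqP; rewrite tofrac_eq => /eqP. Qed.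

Lemma frac_repr (x : F) : x * phi \d_(repr x) = phi \n_(repr x).
Proof.
rewrite -{1}[x]reprK /=; unlock FracField.tofrac; rewrite -[LHS]FracField.pi_mul.
apply/eqmodP; rewrite /= FracField.equivfE /FracField.mulf /= !numden_Ratio
  ?mulf_neq0 ?oner_eq0 ?denom_ratioP //.
by rewrite !mulr1 mulrC.
Qed.

Lemma frac_numden (x : F) : x = phi \n_(repr x) / phi \d_(repr x).
Proof.
have h : phi \d_(repr x) != 0 by rewrite (phi_eq0 tofrac_inj) denom_ratioP.
by rewrite -(frac_repr x) (mulfK h).
Qed.

Lemma tofrac_frac (x : F) : exists n d, d != 0 /\ x = phi n / phi d.
Proof.
by exists \n_(repr x), \d_(repr x); split; [exact: denom_ratioP | exact: frac_numden].
Qed.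

Lemma fnum_fden (x : F) :
  [/\ x = phi (fnum x) / phi (fden x), fden x != 0 & coprimep (fnum x) (fden x)].
Proof.
have d0 := denom_ratioP (repr x).
split.
- exact: etrans (frac_numden x) (reduce_frac tofrac_inj _ d0).
- exact: reduced_den_neq0.
by apply: coprimep_div_gcd; rewrite d0 orbT.
Qed.

Lemma regular_val t0 x : regular_at t0 x -> val_at phi t0 x (fval t0 x).
Proof. by move=> r; have [e _ _] := fnum_fden x; exists (fnum x), (fden x). Qed.

Lemma irregular_pole t0 x : ~~ regular_at t0 x -> pole phi t0 x.
Proof.
move/negPn/eqP => r; have [e d0 c] := fnum_fden x; rewrite e.
exact: (pole_of_root tofrac_inj d0 c r).
Qed.

End Specialization.

Theorem theorem3p2 (K : fieldExtType rat) (RK : {pred K})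
  (e1 e2 e3 : {poly K}) (t0 : K) :
  (* O_K ⊂ R_K ⊂ K, R_K a subring which is a UFD with f.g. unit group *)
  (forall x : K, integralZ x -> x \in RK) ->
  subring_of RK -> UFD RK -> units_fin_gen RK ->
  (* e_i ∈ R_K[t] *)
  polyS RK e1 -> polyS RK e2 -> polyS RK e3 ->
  (* E is an elliptic curve over K(t), nonconstant *)
  e1 != e2 -> e1 != e3 -> e2 != e3 ->
  nonconstant_leg e1 e2 e3 ->
  (* E(t0) is an elliptic curve over K *)
  e1.[t0] != e2.[t0] -> e1.[t0] != e3.[t0] -> e2.[t0] != e3.[t0] ->
  (* square-free divisor hypothesis *)
  (forall h : {poly K}, (1 < size h)%N -> squarefreeS RK h ->
     dvdS RK h ((e1 - e2) * (e1 - e3)) \/ dvdS RK h ((e2 - e1) * (e2 - e3)) \/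
     dvdS RK h ((e3 - e1) * (e3 - e2)) ->
     ~ exists z : K, z ^+ 2 = h.[t0]) ->
  (* the specialization map E(K(t)) -> E(t0)(K) is injective *)
  forall P Q : option ({fraction {poly K}} * {fraction {poly K}}),
    on_leg (polF e1) (polF e2) (polF e3) P ->
    on_leg (polF e1) (polF e2) (polF e3) Q ->
    specialize t0 P = specialize t0 Q -> P = Q.
Proof.
move=> HI HS HU _ s1 s2 s3 e12 e13 e23 _ d12 d13 d23 H.
pose F : fieldType := {fraction {poly K}}.
pose phi : {rmorphism {poly K} -> F} := @FracField.tofrac {poly K}.
have inj : injective phi := @tofrac_inj K.
have frac : forall x : F, exists n d, d != 0 /\ x = phi n / phi d := @tofrac_frac K.
have [HA fA] := UFD_factorial HS HU.
have frS := numfield_frac HI.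
have e21 : e2.[t0] != e1.[t0] by rewrite eq_sym.
have e31 : e3.[t0] != e1.[t0] by rewrite eq_sym.
have e32 : e3.[t0] != e2.[t0] by rewrite eq_sym.
have no_pole x y : pole phi t0 x -> y ^+ 2 = (x - phi e1) * (x - phi e2) * (x - phi e3) -> False.
  apply: (no_pole_point inj frac e12 e13 e23 (@numfield_char0 K)) => {}x {}y px ey.
  have H1 h sh sq dv := H h sh sq (or_introl dv).
  have H2 h sh sq dv := H h sh sq (or_intror (or_introl dv)).
  have H3 h sh sq dv := H h sh sq (or_intror (or_intror dv)).
  have [r1 E1] := square_of_descent inj frac HA fA frS s1 s2 s3 d12 d13 H1 px ey.
  have ey2 : y ^+ 2 = (x - phi e2) * (x - phi e1) * (x - phi e3).
    by rewrite ey [_ * (x - phi e2)]mulrC.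
  have [r2 E2] := square_of_descent inj frac HA fA frS s2 s1 s3 e21 d23 H2 px ey2.
  have ey3 : y ^+ 2 = (x - phi e3) * (x - phi e1) * (x - phi e2).
    by rewrite ey [LHS]mulrC mulrA.
  have [r3 E3] := square_of_descent inj frac HA fA frS s3 s1 s2 e31 e32 H3 px ey3.
  by exists r1, r2, r3.
have onE x y : on_leg (polF e1) (polF e2) (polF e3) (Some (x, y)) ->
    y ^+ 2 = (x - phi e1) * (x - phi e2) * (x - phi e3) :> F.
  by move=> h; apply: subr0_eq.
(* No affine point specializes to infinity: [x] has no pole by [no_pole], and then [y] has none
   because its square has a value at [t0]. *)
have reg x y : on_leg (polF e1) (polF e2) (polF e3) (Some (x, y)) ->
    regular_at t0 x && regular_at t0 y.
  move/onE => h.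
  case rx : (regular_at t0 x); last first.
    by case: (no_pole x y (irregular_pole (negbT rx)) h).
  case ry : (regular_at t0 y) => //.
  have vx := regular_val rx.
  have ve e := val_phi phi t0 e.
  have : val_at phi t0 (y ^+ 2) ((fval t0 x - e1.[t0]) * (fval t0 x - e2.[t0]) * (fval t0 x - e3.[t0])).
    by rewrite h; apply: valM; [apply: valM|]; apply: (valB inj).
  case/(val_sqrt inj frac) => c vc _.
  by case: (pole_not_val inj (irregular_pole (negbT ry)) vc).
case=> [[x1 y1]|] [[x2 y2]|] hP hQ //; last first.
- by rewrite /= (reg _ _ hQ).
- by rewrite /= (reg _ _ hP).
rewrite /= (reg _ _ hP) (reg _ _ hQ) => -[ex ey].
have /andP[rx1 ry1] := reg _ _ hP; have /andP[rx2 ry2] := reg _ _ hQ.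
apply: NNPP => ne.
have vx2 := regular_val rx2; rewrite -ex in vx2.
have vy2 := regular_val ry2; rewrite -ey in vy2.
have [|x [y [px hxy]]] := pole_of_collision inj frac d12 d13 d23 (numfield_char0 K 1)
  (onE _ _ hP) (onE _ _ hQ) (regular_val rx1) vx2 (regular_val ry1) vy2; last exact: no_pole px hxy.
by move=> e; apply: ne; rewrite e.
Qed.
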